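(* Let $k\ge1$, $r\ge2$ be integers with $\gcd(k+1,r-1)=1$ and $\alpha=\alpha_{k,r}=-(k+1)/(r-1)$. Let $T\in\{\mathrm{AS},\mathrm{AA},\mathrm{SA},\mathrm{SS}\}$ and let $\Lambda$ be a $(k,r,N)$-admissible superpartition of bi-degree $(n|m)$ in the index set of type $T$. Then $P^T_\Lambda(x;\alpha_{k,r})$ is the unique polynomial $P$ satisfying (1) $P=m^T_\Lambda+\sum_{\Gamma<\Lambda}c_{\Lambda,\Gamma}m^T_\Gamma$ with $c_{\Lambda,\Gamma}\in\mathbb{C}$; (2) $S^*(u)P=\varepsilon_{\Lambda^*}(\alpha,u)P$ and $S^\circledast(u,u)P=\varepsilon_{\Lambda^\circledast}(\alpha,u)P$, where the operators and eigenvalues are taken at $\alpha=\alpha_{k,r}$.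
   Context: Fix $N\ge1$, $0\le m\le N$; $I=\{1,\dots,m\}$, $J=\{m+1,\dots,N\}$, $x=(x_1,\dots,x_N)$. $K_{i,j}$ exchanges $x_i,x_j$. For $K\subseteq\{1,\dots,N\}$, $S_K$ = permutations fixing every element outside $K$; $\mathrm{Asym}_Kf=\sum_{\sigma\in S_K}\mathrm{sgn}(\sigma)f(x_{\sigma(1)},\dots,x_{\sigma(N)})$, $\mathrm{Sym}_Kf=\sum_{\sigma\in S_K}f(x_{\sigma(1)},\dots,x_{\sigma(N)})$. Compositions $\eta\in\mathbb{Z}_{\ge0}^N$, $\eta^+$ decreasing rearrangement; dominance on partitions of equal size; $\eta\succ\nu$ iff $\eta\ne\nu$ and $\eta^+>\nu^+$, or $\eta^+=\nu^+$ and $\sum_{i\le k}\eta_i\ge\sum_{i\le k}\nu_i$ for all $k$. Cherednik operators $\xi_j=\alpha x_j\partial_{x_j}+\sum_{i<j}\frac{x_j}{x_j-x_i}(1-K_{i,j})+\sum_{i>j}\frac{x_i}{x_j-x_i}(1-K_{i,j})-(j-1)$. For $\alpha$ formal, $E_\eta(x;\alpha)$ is the unique polynomial $x^\eta+\sum_{\nu\prec\eta}c_{\eta,\nu}x^\nu$ with $\xi_jE_\eta=\bar\eta_jE_\eta$, $\bar\eta_j=\alpha\eta_j-\#\{i<j:\eta_i\ge\eta_j\}-\#\{i>j:\eta_i>\eta_j\}$. Superpartition of bi-degree $(n|m)$: $\Lambda=(\Lambda_1,\dots,\Lambda_m;\Lambda_{m+1},\dots,\Lambda_N)$, nonnegative,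 $\Lambda_1\ge\dots\ge\Lambda_m$, $\Lambda_{m+1}\ge\dots\ge\Lambda_N$, sum $n$; strict if $\Lambda_1>\dots>\Lambda_m$. $\Lambda^\circledast=(\Lambda_1+1,\dots,\Lambda_m+1,\Lambda_{m+1},\dots,\Lambda_N)^+$, $\Lambda^*=(\Lambda_1,\dots,\Lambda_N)^+$. $\Lambda>\Omega$ iff $\Lambda^*>\Omega^*$, or $\Lambda^*=\Omega^*$ and $\Lambda^\circledast>\Omega^\circledast$. With $\eta_\Lambda=(\Lambda_m,\dots,\Lambda_1,\Lambda_N,\dots,\Lambda_{m+1})$: $P^{AS}_\Lambda=c\,\mathrm{Asym}_I\mathrm{Sym}_JE_{\eta_\Lambda}$, $P^{AA}_\Lambda=c\,\mathrm{Asym}_I\mathrm{Asym}_JE_{\eta_\Lambda}$, $P^{SA}_\Lambda=c\,\mathrm{Sym}_I\mathrm{Asym}_JE_{\eta_\Lambda}$, $P^{SS}_\Lambda=c\,\mathrm{Sym}_I\mathrm{Sym}_JE_{\eta_\Lambda}$, $c$ chosen so the coefficient of $x_1^{\Lambda_1}\cdots x_N^{\Lambda_N}$ is $1$. Index sets: AS strict; AA strict with $\Lambda_{m+1}>\dots>\Lambda_N$; SA $\Lambda_{m+1}>\dots>\Lambda_N$; SS all. Monomials ($\lambda=(\Lambda_1..\Lambda_m)$, $\mu=(\Lambda_{m+1}..\Lambda_N)$): $m^{AS}_\Lambda=a_\lambda(x_1..x_m)m_\mu(x_{m+1}..x_N)$, $m^{AA}_\Lambda=a_\lambda a_\mu$,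 $m^{SA}_\Lambda=m_\lambda a_\mu$, $m^{SS}_\Lambda=m_\lambda m_\mu$, with $a_\nu(y_1..y_p)=\sum_{\sigma\in S_p}\mathrm{sgn}(\sigma)\prod_i y_{\sigma(i)}^{\nu_i}$ and $m_\nu$ the monomial symmetric function. Admissibility: weakly $(k,r,N)$-admissible: $\Lambda^\circledast_i-\Lambda^*_{i+k}\ge r$ for $1\le i\le N-k$; moderately: $\Lambda^\circledast_i-\Lambda^\circledast_{i+k}\ge r$ for $1\le i\le N-k$; strongly: moderately and $\Lambda^*_i-\Lambda^*_{i+k+1}\ge r$ for $1\le i\le N-k-1$. ''$(k,r,N)$-admissible'' = strongly, or strict and weakly. For such $\Lambda$, $P^T_\Lambda(x;\alpha)$ has no pole at $\alpha_{k,r}$, and $P^T_\Lambda(x;\alpha_{k,r})$ denotes its value there. Sekiguchi operators: $S^*(u)=\prod_{i=1}^N(u+\xi_i)$, $S^\circledast(u,v)=\prod_{i=1}^m(u+\xi_i+\alpha)\prod_{i=m+1}^N(v+\xi_i)$, $u,v$ formal parameters; for a partition $\lambda$ (padded with zeros to $N$ parts), $\varepsilon_\lambda(\alpha,u)=\prod_{i=1}^N(u+\alpha\lambda_i-i+1)$.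
   Formalization: Added hypothesis: P^T_Λ(x;α) has no pole at α_{k,r}; this is not automatic for strict, weakly admissible Λ of type SA or SS, e.g. N=m=3, T=SS, k=1, r=2, Λ=(2,1,0): P=m_(2,1)+6/(α+2) m_(1,1,1) has a pole at α=-2. *)

(* Defs.v *)
From HB Require Import structures.
From mathcomp Require Import all_boot all_order all_algebra fingroup perm.
From mathcomp Require Import mpoly complex reals.
From mathcomp Require classical_sets.

Set Implicit Arguments.
Unset Strict Implicit.
Unset Printing Implicit Defensive.

Import GRing.Theory.
Local Open Scope ring_scope.

(* Indices are 0-based throughout: the variable x_i is ['X_j] with j = i - 1,
   so I = {1..m} is [setI_ N m] and J = {m+1..N} is [setJ_ N m].
   Partitions are sequences, read with [nth 0]; compositions and
   superpartitions are exponent vectors in ['X_{1..N}]. *)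

Definition setI_ (N m : nat) : {set 'I_N} := [set i : 'I_N | (i < m)%N].
Definition setJ_ (N m : nat) : {set 'I_N} := [set i : 'I_N | (m <= i)%N].

Section Combinatorics.
Local Open Scope nat_scope.
Variable N : nat.
Implicit Types (eta nu L G : 'X_{1..N}) (lam mu : seq nat).

Definition parts eta : seq nat := [seq eta i | i <- enum 'I_N].

Definition decr_rearr (s : seq nat) : seq nat := sort geq s.

Definition psums_ge (s t : seq nat) : bool :=
  all (fun k => sumn (take k t) <= sumn (take k s)) (iota 0 (size s + size t).+1).

Definition dom_ge lam mu : bool := (sumn lam == sumn mu) && psums_ge lam mu.
Definition dom_gt lam mu : bool := (lam != mu) && dom_ge lam mu.

Definition comp_gt eta nu : bool :=
  let ep := decr_rearr (parts eta) in
  let np := decr_rearr (parts nu) in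
  (eta != nu) &&
  (dom_gt ep np || ((ep == np) && psums_ge (parts eta) (parts nu))).

Variable m : nat.

Definition noninc_on (K : {set 'I_N}) L : bool :=
  [forall i in K, forall j in K, (i < j) ==> (L j <= L i)].
Definition decr_on (K : {set 'I_N}) L : bool :=
  [forall i in K, forall j in K, (i < j) ==> (L j < L i)].

Definition superpartition L : bool :=
  noninc_on (setI_ N m) L && noninc_on (setJ_ N m) L.
Definition strict L : bool := decr_on (setI_ N m) L.

Definition sp_star L : seq nat := decr_rearr (parts L).
Definition sp_circ L : seq nat :=
  decr_rearr [seq L i + (i < m) | i <- enum 'I_N].

Definition sp_gt L G : bool :=
  dom_gt (sp_star L) (sp_star G) ||
  ((sp_star L == sp_star G) && dom_gt (sp_circ L) (sp_circ G)).

(* (L_m, ..., L_1, L_N, ..., L_{m+1}) *)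
Definition eta_of L : 'X_{1..N} :=
  [multinom nth 0 (rev (take m (parts L)) ++ rev (drop m (parts L))) i | i < N].

(* The differences in the admissibility conditions are between integers;
   a - b >= r is written b + r <= a. *)
Definition weakly_admissible (k r : nat) L : Prop :=
  forall i : nat, i + k < N ->
    nth 0 (sp_star L) (i + k) + r <= nth 0 (sp_circ L) i.
Definition moderately_admissible (k r : nat) L : Prop :=
  forall i : nat, i + k < N ->
    nth 0 (sp_circ L) (i + k) + r <= nth 0 (sp_circ L) i.
Definition strongly_admissible (k r : nat) L : Prop :=
  moderately_admissible k r L /\
  forall i : nat, i + k.+1 < N ->
    nth 0 (sp_star L) (i + k.+1) + r <= nth 0 (sp_star L) i.
Definition admissible (k r : nat) L : Prop :=
  strongly_admissible k r L \/ (strict L /\ weakly_admissible k r L).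

End Combinatorics.

Inductive symtype := AS | AA | SA | SS.

Definition in_index (N m : nat) (T : symtype) (L : 'X_{1..N}) : bool :=
  superpartition m L &&
  match T with
  | AS => strict m L
  | AA => strict m L && decr_on (setJ_ N m) L
  | SA => decr_on (setJ_ N m) L
  | SS => true
  end.

Section Operators.
Variables (R : idomainType) (N : nat).
Implicit Types (p q : {mpoly R[N]}) (K : {set 'I_N}) (nu L : 'X_{1..N}).

(* [msym s p] is p(x_{s(1)}, ..., x_{s(N)}). *)
Definition Asym_on K p : {mpoly R[N]} :=
  \sum_(s : 'S_N | perm_on K s) (-1) ^+ s *: msym s p.
Definition Sym_on K p : {mpoly R[N]} :=
  \sum_(s : 'S_N | perm_on K s) msym s p.

Definition symmetrizer (m : nat) (T : symtype) p : {mpoly R[N]} :=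
  let I := setI_ N m in let J := setJ_ N m in
  match T with
  | AS => Asym_on I (Sym_on J p)
  | AA => Asym_on I (Asym_on J p)
  | SA => Sym_on I (Asym_on J p)
  | SS => Sym_on I (Sym_on J p)
  end.

Definition alt_mono K nu : {mpoly R[N]} :=
  \sum_(s : 'S_N | perm_on K s) (-1) ^+ s *: \prod_(i in K) 'X_(s i) ^+ nu i.

(* The monomial symmetric function sums the distinct rearrangements, each
   with coefficient 1; hence [undup]. *)
Definition sym_mono K nu : {mpoly R[N]} :=
  \sum_(p <- undup [seq \prod_(i in K) ('X_(s i) : {mpoly R[N]}) ^+ nu i
                   | s : 'S_N <- enum (perm_on K)]) p.

Definition mono (m : nat) (T : symtype) L : {mpoly R[N]} :=
  let I := setI_ N m in let J := setJ_ N m in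
  match T with
  | AS => alt_mono I L * sym_mono J L
  | AA => alt_mono I L * alt_mono J L
  | SA => sym_mono I L * alt_mono J L
  | SS => sym_mono I L * sym_mono J L
  end.

(* Exact quotient p / q: 0 if q does not divide p, and otherwise the quotient,
   which is unique for q != 0. *)
Definition exact_quo p q : {mpoly R[N]} :=
  classical_sets.xget 0 (fun g : {mpoly R[N]} => g * q = p).

Lemma exact_quoE p q g : q != 0 -> g * q = p -> exact_quo p q = g.
Proof.
move=> q0 gE; rewrite /exact_quo.
case: classical_sets.xgetP => [h _ hE|/(_ g)/(_ gE)] //.
by apply: (mulIf q0); rewrite gE.
Qed.

Definition dunkl_quo (i j : 'I_N) p : {mpoly R[N]} :=
  exact_quo (p - msym (tperm i j) p) ('X_j - 'X_i).

Definition cherednik (a : R) (j : 'I_N) p : {mpoly R[N]} :=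
  a *: ('X_j * p^`M(j))
  + \sum_(i < N | (i < j)%N) 'X_j * dunkl_quo i j p
  + \sum_(i < N | (j < i)%N) 'X_i * dunkl_quo i j p
  - p *+ j.

Definition bar (a : R) (eta : 'X_{1..N}) (j : 'I_N) : R :=
  a *+ eta j
  - #|[set i : 'I_N | (i < j)%N && (eta j <= eta i)%N]|%:R
  - #|[set i : 'I_N | (j < i)%N && (eta j < eta i)%N]|%:R.

(* The factors of the Sekiguchi operators are composed in increasing order of
   the index, the factor of index 1 being applied last. *)
Definition sekiguchi_star (a u : R) p : {mpoly R[N]} :=
  foldr (fun i q => u *: q + cherednik a i q) p (enum 'I_N).

Definition sekiguchi_circ (m : nat) (a u v : R) p : {mpoly R[N]} :=
  foldr (fun (i : 'I_N) q => if (i < m)%N then (u + a) *: q + cherednik a i q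
                    else v *: q + cherednik a i q) p (enum 'I_N).

End Operators.

Definition eps (R : idomainType) (N : nat) (lam : seq nat) (a u : R) : R :=
  \prod_(i < N) (u + a *+ nth 0%N lam i - i%:R).

Section Jack.
Variables (F : fieldType) (N : nat).

(* F(alpha), with alpha the image of the variable. *)
Definition ratfun : fieldType := {fraction {poly F}}.
Definition alpha_gen : ratfun := FracField.tofrac 'X.

Definition is_nsJack (eta : 'X_{1..N}) (E : {mpoly ratfun[N]}) : Prop :=
  (exists c : 'X_{1..N} -> ratfun,
     E = 'X_[eta] + \sum_(nu : 'X_{1..N < (mdeg eta).+1} | comp_gt eta nu)
                      c nu *: 'X_[nu])
  /\ forall j : 'I_N, cherednik alpha_gen j E = bar alpha_gen eta j *: E.

Definition nsJack (eta : 'X_{1..N}) : {mpoly ratfun[N]} :=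
  classical_sets.xget 0 (is_nsJack eta).

Definition jack (m : nat) (T : symtype) (L : 'X_{1..N}) : {mpoly ratfun[N]} :=
  let Q := symmetrizer m T (nsJack (eta_of m L)) in (Q@_L)^-1 *: Q.

Definition ratfun_value (a : F) (f : ratfun) (y : F) : Prop :=
  exists n d : {poly F},
    [/\ d.[a] != 0, f = FracField.tofrac n / FracField.tofrac d
      & y = n.[a] / d.[a]].

(* Total version: 0 if f has a pole at a. *)
Definition ratfun_eval (a : F) (f : ratfun) : F :=
  classical_sets.xget 0 (ratfun_value a f).

Lemma ratfun_evalE (a : F) (n d : {poly F}) : d.[a] != 0 ->
  ratfun_eval a (FracField.tofrac n / FracField.tofrac d) = n.[a] / d.[a].
Proof.
have nz (q : {poly F}) : q.[a] != 0 -> FracField.tofrac q != 0.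
  by move=> qa; rewrite tofrac_eq0; apply: contraNneq qa => ->; rewrite horner0.
move=> da; rewrite /ratfun_eval.
case: classical_sets.xgetP => [y _ [n' [d' [d'a /eqP fE ->]]]|H]; last first.
  by case: (H (n.[a] / d.[a])); exists n, d.
move: fE; rewrite eqr_div ?nz // -!tofracM tofrac_eq => /eqP nd.
by apply/eqP; rewrite eqr_div // -!hornerM nd.
Qed.

(* Regularity of P^T_L at alpha_{k,r} has to be assumed: it does not follow
   from L being strict and weakly admissible when T is SA or SS. For instance,
   for N = m = 3 and T = SS,
     P_(2,1,0) = m_(2,1,0) + 6/(alpha + 2) m_(1,1,1)
   has a pole at alpha_{1,2} = -2. *)
Definition no_pole_at (a : F) (p : {mpoly ratfun[N]}) : Prop :=
  forall nu : 'X_{1..N}, exists y : F, ratfun_value a p@_nu y.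

Definition jack_at (a : F) (m : nat) (T : symtype) (L : 'X_{1..N}) :
  {mpoly F[N]} := map_mpoly (ratfun_eval a) (jack m T L).

Definition triangular (m : nat) (T : symtype) (L : 'X_{1..N})
    (P : {mpoly F[N]}) : Prop :=
  exists c : 'X_{1..N} -> F,
    P = mono F m T L
      + \sum_(G : 'X_{1..N < (mdeg L).+1} |
               [&& in_index m T G, mdeg G == mdeg L & sp_gt m L G])
          c G *: mono F m T G.

(* The parameter u is the variable of {poly F}: the operators act on
   polynomials in x with coefficients in F[u]. *)
Definition sekiguchi_eigen (a : F) (m : nat) (L : 'X_{1..N})
    (P : {mpoly F[N]}) : Prop :=
  let Pu : {mpoly {poly F}[N]} := map_mpoly polyC P in
  sekiguchi_star a%:P 'X Pu = eps N (sp_star L) a%:P 'X *: Pu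
  /\ sekiguchi_circ m a%:P 'X 'X Pu = eps N (sp_circ m L) a%:P 'X *: Pu.

End Jack.

Definition alpha_kr (F : fieldType) (k r : nat) : F :=
  - (k.+1)%:R / (r.-1)%:R.

(* Main.v *)
(** The value [P0] of the Jack polynomial at [alpha = -(k+1)/(r-1)] is triangular
    because every non-symmetric Jack polynomial is, and it is an eigenfunction by
    specialisation. For uniqueness, let [P] be a second solution. A maximal
    monomial of [P - P0], sorted within the two blocks, is a superpartition
    [G < L] with the same Sekiguchi eigenvalues as [L]. Comparing the multisets of
    values [(k+1) L_i + (r-1) i] of [L] and [G], for both partitions attached to
    them, leaves a single possibility: [L] is strict, [G] is not, and [L] has two
    overlapping pairs of rows [(A, A+k)] and [(B, B+k)], all of them fermionic, of
    difference exactly [r-1]. In that case [P_L] has a pole. Indeed [P_L] is a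
    combination of the [E_nu], [nu] a rearrangement of [L], with coefficients that
    are units at [alpha], so if [P_L] were regular then every [E_nu] would be.
    Sorting [nu] by groups of rows keeps [E_nu] regular, and the part of the result
    in the variables carrying the rows [A..B+k] is a non-symmetric Jack
    polynomial; its value at [(1,...,1)] is an explicit product in which more factors
    of the denominator than of the numerator vanish at [alpha]. *)
Require Import Defs.
From HB Require Import structures.
From mathcomp Require Import all_boot all_order all_algebra fingroup perm.
From mathcomp Require Import mpoly complex reals.
From mathcomp Require Import zify ring.
From mathcomp Require boolp classical_sets.

Set Implicit Arguments.
Unset Strict Implicit.
Unset Printing Implicit Defensive.

Import GRing.Theory.
Local Open Scope ring_scope.

(** * Cherednik operators on monomials *)

Section Update.
Variable N : nat.
Implicit Types (m k : 'X_{1..N}) (i j : 'I_N).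

(** The number compared is the eigenvalue of row i, counted from 0, times -(r-1). As k+1 and r-1 are
    coprime it fixes the row modulo k+1, and admissibility makes it drop by at least k+1 between
    successive rows of a class. So G comes from L by a permutation of rows that respects the
    classes, and the work is to see how little such a permutation can do. The exceptional pair
    cannot be excluded through eigenvalues, which agree on it; this is why the regularity of P_L has
    to be contradicted. For types antisymmetric in I it does not arise, because G would have to be
    strict. The value at (1,...,1) is accessible because each E_nu is built from 1 by intertwiners
    and a raising operator, which change that value by known factors. In a full E_nu the remaining
    rows would add zeros and poles that are not under control. The extracted block has at most 2k+1
    rows, so a linear factor alpha s + d met there vanishes only for s = r-1 and d = k+1. An
    inverted tight pair stops one column short of s = r-1 and thereby loses its zero. *)

Definition mupd m i j (b a : nat) : 'X_{1..N} :=
  [multinom if l == i then b else if l == j then a else m l | l < N].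

Lemma mupdE m i j b a l :
  mupd m i j b a l = if l == i then b else if l == j then a else m l.
Proof. by rewrite mnmE. Qed.

Lemma mupd_id m i j : mupd m i j (m i) (m j) = m.
Proof. by apply/mnmP => l; rewrite mupdE; case: eqP => [->|_] //; case: eqP => [->|]. Qed.

Lemma mupd_eq m k i j b a : i != j ->
  (mupd m i j b a == k) =
  [&& k == mupd m i j (k i) (k j), k i == b & k j == a].
Proof.
move=> ij; apply/eqP/and3P => [<-|[/eqP kE /eqP kb /eqP ka]]; last first.
  by rewrite -kb -ka.
by rewrite !mupdE !eqxx (eq_sym j) (negPf ij); split.
Qed.

Lemma mupd_tperm m i j : i != j ->
  [multinom m (tperm i j l) | l < N] = mupd m i j (m j) (m i).
Proof.
move=> ij; apply/mnmP => l; rewrite mupdE mnmE.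
by case: tpermP => [->|->|/eqP/negPf-> /eqP/negPf->] //; rewrite eqxx // eq_sym (negPf ij).
Qed.

Lemma mupdDr m i j b a : i != j -> (mupd m i j b a + U_(j))%MM = mupd m i j b a.+1.
Proof.
move=> ij; apply/mnmP => l; rewrite mnmDE mnm1E !mupdE (eq_sym j).
case: (eqVneq l i) => [->|_]; first by rewrite (negPf ij) addn0.
by case: (eqVneq l j) => _; rewrite ?addn1 ?addn0.
Qed.

Lemma mupdDl m i j b a : i != j -> (mupd m i j b a + U_(i))%MM = mupd m i j b.+1 a.
Proof.
move=> ij; apply/mnmP => l; rewrite mnmDE mnm1E !mupdE (eq_sym i).
by case: (eqVneq l i) => _; rewrite ?addn1 ?addn0.
Qed.

End Update.

Lemma sum_ord_pick (R : pzRingType) (n x : nat) (c : bool) :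
  \sum_(l < n) (c && (l == x :> nat))%:R = (c && (x < n)%N)%:R :> R.
Proof.
elim: n => [|n IH]; first by rewrite big_ord0 andbF.
rewrite big_ord_recr /= IH ltnS.
by case: c {IH} => //=; case: (ltngtP n x) => /=; rewrite ?addr0 ?add0r.
Qed.

Section Dunkl.
Variables (R : idomainType) (N : nat).
Implicit Types (p q : {mpoly R[N]}) (m k : 'X_{1..N}) (i j l : 'I_N).

(** Divided difference of a monomial as a geometric sum. The case split keeps the subtractions of
    naturals exact, and [.-1] is the degree lost in the division. *)
Definition dunklX i j m : {mpoly R[N]} :=
  if (m i <= m j)%N then
    \sum_(l < m j - m i) 'X_[mupd m i j (m i + l) (m j - l).-1]
  else - \sum_(l < m i - m j) 'X_[mupd m i j (m i - l).-1 (m j + l)].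

Lemma subX_neq0 i j : i != j -> 'X_j - 'X_i != 0 :> {mpoly R[N]}.
Proof.
move=> ij; apply/eqP => /(congr1 (mcoeff U_(i))).
rewrite mcoeffB !mcoeffXU eqxx mcoeff0 eq_sym (negPf ij) sub0r => /eqP.
by rewrite oppr_eq0 oner_eq0.
Qed.

Lemma dunklXE i j m : i != j ->
  dunklX i j m * ('X_j - 'X_i) = 'X_[m] - msym (tperm i j) 'X_[m].
Proof.
move=> ij.
have ->: msym (tperm i j) 'X_[m] = 'X_[mupd m i j (m j) (m i)] :> {mpoly R[N]}.
  by rewrite msymX tpermV; congr ('X_[_]); apply: mupd_tperm.
rewrite /dunklX; case: (leqP (m i) (m j)) => mij.
  (* The product telescopes along the monomials in which h units have moved from [x_j] to [x_i]. *)
  pose f (h : nat) : {mpoly R[N]} := 'X_[mupd m i j (m i + h) (m j - h)].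
  have f0 : 'X_[m] = f 0%N by rewrite /f addn0 subn0 mupd_id.
  have f1 : 'X_[mupd m i j (m j) (m i)] = f (m j - m i)%N.
    by rewrite /f subnKC // subKn.
  rewrite [in RHS]f0 f1 -[RHS]opprB -(telescope_sumr f (leq0n (m j - m i))).
  rewrite big_mkord -sumrN mulr_suml; apply: eq_bigr => l _.
  rewrite mulrBr -!mpolyXD mupdDr // mupdDl // opprB; congr ('X_[_] - 'X_[_]).
    by congr mupd; have := ltn_ord l; lia.
  by congr mupd; have := ltn_ord l; lia.
pose f (h : nat) : {mpoly R[N]} := 'X_[mupd m i j (m i - h) (m j + h)].
have f0 : 'X_[m] = f 0%N by rewrite /f addn0 subn0 mupd_id.
have f1 : 'X_[mupd m i j (m j) (m i)] = f (m i - m j)%N.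
  by rewrite /f subnKC 1?ltnW // subKn // ltnW.
rewrite [in RHS]f0 f1 -[RHS]opprB -(telescope_sumr f (leq0n (m i - m j))).
rewrite big_mkord mulNr mulr_suml; congr (- _); apply: eq_bigr => l _.
rewrite mulrBr -!mpolyXD mupdDr // mupdDl //; congr ('X_[_] - 'X_[_]).
  by congr mupd; have := ltn_ord l; lia.
by congr mupd; have := ltn_ord l; lia.
Qed.

Lemma dunklE i j p : i != j ->
  dunkl_quo i j p * ('X_j - 'X_i) = p - msym (tperm i j) p.
Proof.
move=> ij.
suff E : (\sum_(m <- msupp p) p@_m *: dunklX i j m) * ('X_j - 'X_i)
         = p - msym (tperm i j) p.
  by rewrite /dunkl_quo (exact_quoE (subX_neq0 ij) E).
have -> : p - msym (tperm i j) p =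
    \sum_(m <- msupp p) p@_m *: ('X_[m] - msym (tperm i j) 'X_[m]).
  rewrite {1 2}[p]mpolyE (raddf_sum (msym (tperm i j))) -sumrB.
  by apply: eq_bigr => m _ /=; rewrite scalerBr -msymZ.
rewrite mulr_suml; apply: eq_bigr => m _.
by rewrite -scalerAl dunklXE.
Qed.

Lemma dunkl_quoE i j p g : i != j ->
  g * ('X_j - 'X_i) = p - msym (tperm i j) p -> dunkl_quo i j p = g.
Proof. by move=> ij; apply: exact_quoE; apply: subX_neq0. Qed.

Lemma dunkl_quoX i j m : i != j -> dunkl_quo i j 'X_[m] = dunklX i j m.
Proof. by move=> ij; apply: dunkl_quoE => //; apply: dunklXE. Qed.

Lemma dunkl_linear i j c p q : i != j ->
  dunkl_quo i j (c *: p + q) = c *: dunkl_quo i j p + dunkl_quo i j q.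
Proof.
move=> ij; apply: dunkl_quoE => //.
by rewrite mulrDl -scalerAl !dunklE // msymD msymZ scalerBr; ring.
Qed.

(** The exponents k within reach of m for a homogeneous operator acting on the variables i and j
    alone. *)
Definition agree i j m k : bool :=
  (k == mupd m i j (k i) (k j)) && (k i + k j == m i + m j)%N.

Lemma coef_XjdunklX i j m k : i != j ->
  ('X_j * dunkl_quo i j 'X_[m])@_k =
  (agree i j m k && (m i < k j <= m j)%N)%:R
  - (agree i j m k && (m j < k j <= m i)%N)%:R :> R.
Proof.
move=> ij; rewrite dunkl_quoX // /dunklX /agree.
case: (leqP (m i) (m j)) => mij.
  rewrite (_ : (m j < k j <= m i)%N = false) ?andbF ?subr0; last lia.
  rewrite mulr_sumr raddf_sum /=.
  under eq_bigr => l _.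
    rewrite mulrC -mpolyXD mupdDr // mcoeffX mupd_eq // .
    have -> : [&& k == mupd m i j (k i) (k j), k i == (m i + l)%N
                & k j == (m j - l).-1.+1]
       = [&& k == mupd m i j (k i) (k j), (k i + k j == m i + m j)%N
           & (m i <= k i)%N] && (l == (k i - m i)%N :> nat).
      by case: (k == _) => //=; have := ltn_ord l; lia.
    over.
  rewrite sum_ord_pick; congr (_ %:R); case: (k == _) => //=; lia.
rewrite (_ : (m i < k j <= m j)%N = false) ?andbF ?sub0r; last lia.
rewrite mulrN mcoeffN mulr_sumr raddf_sum /=; congr (- _).
under eq_bigr => l _.
  rewrite mulrC -mpolyXD mupdDr // mcoeffX mupd_eq // .
  have -> : [&& k == mupd m i j (k i) (k j), k i == (m i - l).-1
              & k j == (m j + l).+1]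
     = [&& k == mupd m i j (k i) (k j), (k i + k j == m i + m j)%N
         & (m j < k j)%N] && (l == (k j - m j).-1%N :> nat).
    by case: (k == _) => //=; have := ltn_ord l; lia.
  over.
rewrite sum_ord_pick; congr (_ %:R); case: (k == _) => //=; lia.
Qed.

Lemma coef_XidunklX i j m k : i != j ->
  ('X_i * dunkl_quo i j 'X_[m])@_k =
  (agree i j m k && (m i <= k j < m j)%N)%:R
  - (agree i j m k && (m j <= k j < m i)%N)%:R :> R.
Proof.
move=> ij; rewrite dunkl_quoX // /dunklX /agree.
case: (leqP (m i) (m j)) => mij.
  rewrite (_ : (m j <= k j < m i)%N = false) ?andbF ?subr0; last lia.
  rewrite mulr_sumr raddf_sum /=.
  under eq_bigr => l _.
    rewrite mulrC -mpolyXD mupdDl // mcoeffX mupd_eq // .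
    have -> : [&& k == mupd m i j (k i) (k j), k i == (m i + l).+1
                & k j == (m j - l).-1]
       = [&& k == mupd m i j (k i) (k j), (k i + k j == m i + m j)%N
           & (m i < k i)%N] && (l == (k i - m i).-1%N :> nat).
      by case: (k == _) => //=; have := ltn_ord l; lia.
    over.
  rewrite sum_ord_pick; congr (_ %:R); case: (k == _) => //=; lia.
rewrite (_ : (m i <= k j < m j)%N = false) ?andbF ?sub0r; last lia.
rewrite mulrN mcoeffN mulr_sumr raddf_sum /=; congr (- _).
under eq_bigr => l _.
  rewrite mulrC -mpolyXD mupdDl // mcoeffX mupd_eq // .
  have -> : [&& k == mupd m i j (k i) (k j), k i == (m i - l).-1.+1
              & k j == (m j + l)%N]
     = [&& k == mupd m i j (k i) (k j), (k i + k j == m i + m j)%N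
         & (m j <= k j)%N] && (l == (k j - m j)%N :> nat).
    by case: (k == _) => //=; have := ltn_ord l; lia.
  over.
rewrite sum_ord_pick; congr (_ %:R); case: (k == _) => //=; lia.
Qed.

Lemma coef_euler j p k : ('X_j * p^`M(j))@_k = p@_k *+ k j.
Proof.
have [kj|kj] := posnP (k j).
  rewrite kj mulr0n; apply: memN_msupp_eq0; apply/negP => /msuppM_le.
  case/allpairsP => [[u v] /= [+ _ kE]]; rewrite msuppX inE => /eqP uE.
  by move: kj; rewrite kE uE mnmDE mnm1E eqxx.
have kE : k = (U_(j) + (k - U_(j)))%MM.
  apply/mnmP => l; rewrite mnmDE mnmBE mnm1E.
  by case: (eqVneq j l) => [<-|_]; lia.
rewrite {1}kE mulrC mcoeffMX mcoeff_deriv addmC -kE; congr (_ *+ _).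
by rewrite mnmBE mnm1E eqxx; lia.
Qed.

Lemma sum_dunkl_linear (P : pred 'I_N) (X : 'I_N -> {mpoly R[N]}) j c p q :
  (forall i, P i -> i != j) ->
  \sum_(i | P i) X i * dunkl_quo i j (c *: p + q) =
  c *: (\sum_(i | P i) X i * dunkl_quo i j p) + \sum_(i | P i) X i * dunkl_quo i j q.
Proof.
move=> ne; rewrite scaler_sumr -big_split /=; apply: eq_bigr => i Pi.
by rewrite (dunkl_linear _ _ _ (ne i Pi)) mulrDr -scalerAr.
Qed.

Lemma linear_comb4 (V : lmodType R) c (x1 x2 x3 x4 y1 y2 y3 y4 : V) :
  (c *: x1 + y1) + (c *: x2 + y2) + (c *: x3 + y3) - (c *: x4 + y4) =
  c *: (x1 + x2 + x3 - x4) + (y1 + y2 + y3 - y4).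
Proof.
by rewrite scalerBr !scalerDr opprD (addrACA (c *: x1)) (addrACA (c *: x1 + c *: x2))
  (addrACA (c *: x1 + c *: x2 + c *: x3)).
Qed.

Lemma cherednik_is_linear (a : R) j : linear (@cherednik R N a j).
Proof.
move=> c p q; rewrite /cherednik.
have lt_neq (i : 'I_N) : (i < j)%N -> i != j by move=> ij; rewrite -val_eqE neq_ltn ij.
have gt_neq (i : 'I_N) : (j < i)%N -> i != j by move=> ij; rewrite -val_eqE neq_ltn ij orbT.
rewrite -[RHS]linear_comb4; congr (_ + _ + _ - _).
- by rewrite mderivD mderivZ mulrDr -scalerAr scalerDr scalerA (mulrC a) -scalerA.
- exact: (sum_dunkl_linear (fun=> 'X_j) c p q lt_neq).
- exact: (sum_dunkl_linear (fun i => 'X_i) c p q gt_neq).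
- by rewrite mulrnDl scalerMnr.
Qed.

HB.instance Definition _ (a : R) j :=
  GRing.isLinear.Build R {mpoly R[N]} {mpoly R[N]} _ (@cherednik R N a j)
    (cherednik_is_linear a j).

Lemma coef_cherednik (a : R) j p k :
  (cherednik a j p)@_k = \sum_(m <- msupp p) p@_m * (cherednik a j 'X_[m])@_k.
Proof.
rewrite {1}(mpolyE p) linear_sum raddf_sum /=; apply: eq_bigr => m _.
by rewrite linearZ /= mcoeffZ.
Qed.

(** Matrix of the Cherednik operator on monomials. Its entries are integers apart from multiples of
    [a]; triangularity, base change, restriction to a block and specialisation of alpha are all read
    off here. *)
Lemma coef_cherednikX (a : R) j m k :
  (cherednik a j 'X_[m])@_k =
  (m == k)%:R * (a *+ m j - j%:R)
  + \sum_(i < N | (i < j)%N) ((agree i j m k && (m i < k j <= m j)%N)%:R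
      - (agree i j m k && (m j < k j <= m i)%N)%:R)
  + \sum_(i < N | (j < i)%N) ((agree i j m k && (m i <= k j < m j)%N)%:R
      - (agree i j m k && (m j <= k j < m i)%N)%:R).
Proof.
rewrite /cherednik mcoeffB !mcoeffD mcoeffZ coef_euler mcoeffMn mcoeffX !raddf_sum /=.
under eq_bigr => i ij.
  rewrite coef_XjdunklX; last by rewrite -val_eqE neq_ltn ij.
  over.
under [X in _ + _ + X - _]eq_bigr => i ij.
  rewrite coef_XidunklX; last by rewrite -val_eqE neq_ltn ij orbT.
  over.
rewrite (addrAC _ _ (- _)) (addrAC _ _ (- _)); congr (_ + _ + _).
case: eqVneq => [->|_]; last by rewrite !mul0rn mulr0 subr0 mul0r.
by rewrite mul1r mulr_natr.
Qed.

End Dunkl.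

#[local] Opaque dunkl_quo msym mderiv mpolyX tperm
  mpoly_mul mpoly_add mpoly_opp mpoly_scale.

(** * Exchange relations between Cherednik operators and permutations *)

Section Relations.
Variables (R : idomainType) (N : nat).
Implicit Types (p q g : {mpoly R[N]}) (m k : 'X_{1..N}) (i j l : 'I_N) (s : 'S_N).

Lemma msymXU s i : msym s 'X_i = 'X_(s i) :> {mpoly R[N]}.
Proof.
rewrite msymX; congr ('X_[_]); apply/mnmP => l.
by rewrite mnmE !mnm1E -(inj_eq (@perm_inj _ s)) permKV.
Qed.

Lemma msym_tpermK i j : involutive (@msym N R (tperm i j)).
Proof. by move=> p; rewrite -msymMm tperm2 msym1m. Qed.

Lemma msym_dunkl s i j p : i != j ->
  msym s (dunkl_quo i j p) = dunkl_quo (s i) (s j) (msym s p).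
Proof.
move=> ij; apply/esym/dunkl_quoE; first by rewrite (inj_eq perm_inj).
have -> : msym (tperm (s i) (s j)) (msym s p) = msym s (msym (tperm i j) p).
  by rewrite -!msymMm -tpermJ -conjgC.
by rewrite -msymB -dunklE // msymM msymB !msymXU.
Qed.

Lemma msym_euler s j p :
  msym s ('X_j * p^`M(j)) = 'X_(s j) * (msym s p)^`M(s j).
Proof.
by apply/mpolyP => k; rewrite mcoeff_sym !coef_euler mcoeff_sym mnmE.
Qed.

Lemma euler_X j l g :
  'X_j * ('X_l * g)^`M(j) = 'X_l * ('X_j * g^`M(j)) + (j == l)%:R *: ('X_l * g).
Proof.
rewrite mderivM mderivX mnm1E eq_sym mulrDr addrC.
rewrite mulrCA; congr (_ + _).
case: eqVneq => [->|_]; last by rewrite !scale0r mul0r mulr0.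
rewrite !scale1r (_ : (U_(l) - U_(l))%MM = 0%MM) ?mpolyX0 ?mul1r //.
by apply/mnmP => h; rewrite mnmBE mnm0E subnn.
Qed.

Lemma dunkl_Xl i j l g : i != j -> l != i -> l != j ->
  dunkl_quo i j ('X_l * g) = 'X_l * dunkl_quo i j g.
Proof.
move=> ij li lj; apply: dunkl_quoE => //.
by rewrite -mulrA dunklE // msymM msymXU tpermD 1?eq_sym // mulrBr.
Qed.

Lemma dunkl_Xi i j g : i != j ->
  dunkl_quo i j ('X_i * g) = 'X_j * dunkl_quo i j g - g.
Proof.
move=> ij; apply: dunkl_quoE => //.
rewrite mulrBl -mulrA dunklE // msymM msymXU tpermL.
by move: (msym _ _) => h; ring.
Qed.

Lemma dunkl_Xj i j g : i != j ->
  dunkl_quo i j ('X_j * g) = 'X_i * dunkl_quo i j g + g.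
Proof.
move=> ij; apply: dunkl_quoE => //.
rewrite mulrDl -mulrA dunklE // msymM msymXU tpermR.
by move: (msym _ _) => h; ring.
Qed.

Lemma ltn_ord_neq i j : (i < j)%N -> i != j.
Proof. by rewrite -val_eqE neq_ltn => ->. Qed.

Lemma gtn_ord_neq i j : (j < i)%N -> i != j.
Proof. by rewrite -val_eqE neq_ltn => ->; rewrite orbT. Qed.

Definition lowS j p : {mpoly R[N]} :=
  \sum_(i < N | (i < j)%N) 'X_j * dunkl_quo i j p.
Definition highS j p : {mpoly R[N]} :=
  \sum_(i < N | (j < i)%N) 'X_i * dunkl_quo i j p.

Lemma cherednikE (a : R) j p : cherednik a j p =
  a *: ('X_j * p^`M(j)) + lowS j p + highS j p - p *+ j.
Proof. by []. Qed.

Lemma msym_lowS s j p : msym s (lowS j p) =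
  \sum_(i < N | (i < j)%N) 'X_(s j) * dunkl_quo (s i) (s j) (msym s p).
Proof.
rewrite raddf_sum /=; apply: eq_bigr => i ij.
by rewrite msymM msymXU msym_dunkl ?ltn_ord_neq.
Qed.

Lemma msym_highS s j p : msym s (highS j p) =
  \sum_(i < N | (j < i)%N) 'X_(s i) * dunkl_quo (s i) (s j) (msym s p).
Proof.
rewrite raddf_sum /=; apply: eq_bigr => i ij.
by rewrite msymM msymXU msym_dunkl ?gtn_ord_neq.
Qed.

Lemma msym_cherednik s (a : R) j p : msym s (cherednik a j p) =
  a *: ('X_(s j) * (msym s p)^`M(s j)) + msym s (lowS j p) + msym s (highS j p)
  - msym s p *+ j.
Proof. by rewrite cherednikE msymB !msymD msymZ msym_euler msymMn. Qed.

Variables (x y : 'I_N).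
Hypothesis xy : y = x.+1 :> nat.
Variable s : 'S_N.
Hypothesis sE : s = tperm x y.

Lemma cherednik_simple_other (a : R) j p : j != x -> j != y ->
  cherednik a j (msym s p) = msym s (cherednik a j p).
Proof.
move=> jx jy; rewrite msym_cherednik cherednikE.
have sj : s j = j by rewrite sE tpermD // eq_sym.
have vx : j != x :> nat by []. have vy : j != y :> nat by [].
have lt1 (i : 'I_N) : (s i < j)%N = (i < j)%N by rewrite sE; case: tpermP => [->|->|//]; lia.
have lt2 (i : 'I_N) : (j < s i)%N = (j < i)%N by rewrite sE; case: tpermP => [->|->|//]; lia.
have -> : msym s (lowS j p) = lowS j (msym s p).
  rewrite msym_lowS /lowS [RHS](reindex_inj (@perm_inj _ s)) [RHS](eq_bigl _ _ lt1).
  by apply: eq_bigr => i ij; rewrite sj.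
have -> : msym s (highS j p) = highS j (msym s p).
  rewrite msym_highS /highS [RHS](reindex_inj (@perm_inj _ s)) [RHS](eq_bigl _ _ lt2).
  by apply: eq_bigr => i ij; rewrite sj.
by rewrite sj.
Qed.

(** Degenerate Hecke relation. Only the mutual quotient of x and y fails to transport: it is a lower
    term for y and a higher one for x. The two differ by [x_y - x_x] times the quotient, that is by
    [K p - p], and the change of the shift by one unit absorbs [K p]. *)
Lemma cherednik_simple_r (a : R) p :
  cherednik a y (msym s p) = msym s (cherednik a x p) - p.
Proof.
have nxy : x != y by apply: ltn_ord_neq; rewrite xy.
rewrite msym_cherednik cherednikE.
have sx : s x = y by rewrite sE tpermL.
have sy : s y = x by rewrite sE tpermR.
have lowE : lowS y (msym s p) = 'X_y * dunkl_quo x y (msym s p) + msym s (lowS x p).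
  rewrite [lowS y _]/lowS [LHS](bigD1 x) /=; last by rewrite xy.
  apply: (congr1 (+%R _)).
  rewrite msym_lowS [LHS](reindex_inj (@perm_inj _ s)) /= sx; apply: eq_bigl => i.
  rewrite sE -val_eqE /=; case: tpermP => [->|->|/eqP nx /eqP ny]; rewrite -?val_eqE /=.
  - lia.
  - lia.
  - by move: nx ny; rewrite -!val_eqE /=; lia.
have highE : msym s (highS x p) = 'X_x * dunkl_quo x y (msym s p) + highS y (msym s p).
  rewrite msym_highS [LHS](bigD1 y) /=; last by rewrite xy.
  rewrite sy sx; apply: (congr1 (+%R _)).
  rewrite /highS [RHS](reindex_inj (@perm_inj _ s)) /=; apply: eq_bigl => i.
  rewrite sE; case: tpermP => [->|->|/eqP nx /eqP ny]; rewrite -?val_eqE /=.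
  - lia.
  - lia.
  - by move: nx ny; rewrite -!val_eqE /=; lia.
rewrite lowE highE sx; have := dunklE (msym s p) nxy.
rewrite -sE -[msym s (msym s p)]msymMm sE tperm2 msym1m -sE xy mulrSr.
move: (msym s (lowS x p)) (highS y _) (a *: _) => S1 S2 e.
move: (msym s p) (dunkl_quo _ _ _) => g d E.
have -> : p = g - d * ('X_y - 'X_x) by rewrite E; ring.
ring.
Qed.

Lemma cherednik_simple_l (a : R) p :
  cherednik a x (msym s p) = msym s (cherednik a y p) + p.
Proof.
have sK q : msym s (msym s q) = q by rewrite sE msym_tpermK.
by have := cherednik_simple_r a (msym s p); rewrite sK => ->; rewrite msymB !sK subrK.
Qed.

End Relations.

(** * The raising operator *)

Section Raising.
Variables (R : idomainType) (n : nat).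
Implicit Types (p g : {mpoly R[n.+1]}) (i j : 'I_n.+1).

Definition cyc : 'S_n.+1 := perm (@ord_pred_inj n.+1).

Lemma cycE i : cyc i = (if i == 0%N :> nat then n else i.-1) :> nat.
Proof.
rewrite permE /=; case: i => [[|i] ilt] /=; first by rewrite modn_small.
by rewrite modnDr modn_small // ltnW.
Qed.

Lemma cyc0 : cyc ord0 = ord_max.
Proof. by apply/val_inj; rewrite /= cycE. Qed.

#[local] Opaque cyc.

(* The affine intertwiner of Knop and Sahi. *)
Definition phi p : {mpoly R[n.+1]} := 'X_ord_max * msym cyc p.

(** The cycle sends index 0 to the end, so its quotient passes from the lower sum to the higher one.
    Commuting it with the last variable costs one copy of p, exactly the change of the shift from j
    to j - 1. *)
Lemma cherednik_phi (a : R) j p : j != ord0 ->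
  cherednik a (cyc j) (phi p) = phi (cherednik a j p).
Proof.
move=> j0; rewrite /phi msym_cherednik cherednikE.
have jgt0 : (0 < j)%N by rewrite lt0n.
have j'E : j = (cyc j).+1 :> nat.
  by rewrite cycE; move: jgt0; case: (nat_of_ord j).
have jlt := ltn_ord j.
have j'L : cyc j != ord_max by rewrite -val_eqE /=; lia.
rewrite euler_X (negPf j'L) scale0r addr0.
have lowE : msym cyc (lowS j p) = 'X_(cyc j) * dunkl_quo ord_max (cyc j) (msym cyc p) +
  lowS (cyc j) (msym cyc p).
  rewrite msym_lowS [LHS](bigD1 ord0) /=; last by [].
  rewrite cyc0; apply: (congr1 (+%R _)).
  rewrite /lowS [RHS](reindex_inj (@perm_inj _ cyc)) /=; apply: eq_bigl => i.
  move: (ltn_ord i) jgt0 jlt; rewrite -val_eqE /= !cycE.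
  by case: (nat_of_ord i) => [|b]; case: (nat_of_ord j) => [|c] //=; lia.
have highE : highS (cyc j) ('X_ord_max * msym cyc p) =
  'X_ord_max * ('X_(cyc j) * dunkl_quo ord_max (cyc j) (msym cyc p) - msym cyc p)
  + 'X_ord_max * msym cyc (highS j p).
  rewrite [highS (cyc j) _]/highS [LHS](bigD1 ord_max) /=; last by rewrite /=; lia.
  rewrite dunkl_Xi; last by rewrite eq_sym.
  apply: (congr1 (+%R _)).
  rewrite msym_highS [RHS]mulr_sumr [LHS](reindex_inj (@perm_inj _ cyc)) /=.
  have condE i : (cyc j < cyc i)%N && (cyc i != ord_max) = (j < i)%N.
    move: (ltn_ord i) jgt0 jlt; rewrite -val_eqE /= !cycE.
    by case: (nat_of_ord i) => [|b]; case: (nat_of_ord j) => [|c] //=; lia.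
  rewrite [LHS](eq_bigl _ _ condE); apply: eq_bigr => i.
  rewrite -condE => /andP[ij iL]; rewrite dunkl_Xl; first exact: mulrCA.
  - exact: gtn_ord_neq.
  - by rewrite eq_sym.
  - by rewrite eq_sym.
have low2 : lowS (cyc j) ('X_ord_max * msym cyc p) = 'X_ord_max * lowS (cyc j) (msym cyc p).
  rewrite /lowS [RHS]mulr_sumr; apply: eq_bigr => i ij.
  rewrite dunkl_Xl; first exact: mulrCA.
  - exact: ltn_ord_neq.
  - by rewrite -val_eqE /=; lia.
  - by rewrite eq_sym.
rewrite highE low2 lowE j'E mulrSr -!mul_mpolyC.
move: (lowS _ _) (msym cyc (highS _ _)) (_%:MP) => S1 S2 e.
move: (msym cyc p) (dunkl_quo _ _ _) (_^`M(_)) => g d g'.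
ring.
Qed.

(** Index 0 has only higher partners and the last index only lower ones. Each of the n commutations
    with the last variable adds a copy of p, which together cancel the shift; the derivative of that
    variable supplies the extra [a]. *)
Lemma cherednik_phi0 (a : R) p :
  cherednik a ord_max (phi p) = phi (cherednik a ord0 p + a *: p).
Proof.
rewrite /phi msymD msymZ msym_cherednik cyc0 cherednikE euler_X eqxx scale1r.
have low0 : lowS ord0 p = 0 by rewrite /lowS big_pred0.
have highL : highS ord_max ('X_ord_max * msym cyc p) = 0.
  by rewrite /highS big_pred0 // => i /=; have := ltn_ord i; lia.
have highE : msym cyc (highS ord0 p) =
  \sum_(i < n.+1 | (i < @ord_max n)%N) 'X_i * dunkl_quo i ord_max (msym cyc p).
  rewrite msym_highS [RHS](reindex_inj (@perm_inj _ cyc)) /= cyc0; apply: eq_bigl => i.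
  by have := ltn_ord i; rewrite cycE; case: (nat_of_ord i) => [|b] /=; lia.
have lowE : lowS ord_max ('X_ord_max * msym cyc p) =
  'X_ord_max * (msym cyc (highS ord0 p) + msym cyc p *+ n).
  have -> : msym cyc p *+ n = \sum_(i < n.+1 | (i < @ord_max n)%N) msym cyc p.
    by rewrite -(big_ord_widen _ (fun=> _)) //= sumr_const card_ord.
  rewrite highE -big_split [RHS]mulr_sumr; apply: eq_bigr => i ij /=.
  by rewrite dunkl_Xj ?ltn_ord_neq.
rewrite lowE highL low0 msym0 /= mulr0n -!mul_mpolyC.
move: (msym cyc (highS _ _)) (_%:MP) => S1 e.
move: (msym cyc p) (_^`M(_)) => g g'; ring.
Qed.

End Raising.

(** * Dominance order and triangularity *)

Lemma geq_total : total geq. Proof. by move=> x y; apply: leq_total. Qed.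
Lemma geq_trans : transitive geq. Proof. by move=> x y z /= yx xz; apply: leq_trans xz yx. Qed.
Lemma geq_anti : antisymmetric geq.
Proof. by move=> x y /andP[] /= yx xy; apply/eqP; rewrite eqn_leq xy yx. Qed.

Section Dominance.
Local Open Scope nat_scope.
Implicit Types (s t : seq nat) (c k v : nat).

Lemma sumn_take_le s c k : sumn (take k s) <= \sum_(x <- s) (x - c) + k * c.
Proof.
elim: s k => [|x s IH] [|k] //=; rewrite big_cons.
by have := IH k; rewrite mulSn; lia.
Qed.

Lemma sumn_take_sorted s k : sorted geq s ->
  sumn (take k s) = \sum_(x <- s) (x - nth 0 s k) + k * nth 0 s k.
Proof.
elim: s k => [|x s IH] k /= ss; first by rewrite big_nil nth_nil muln0.
have xs : all (geq x) s by apply: order_path_min ss; apply: geq_trans.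
rewrite big_cons; case: k => [|k] /=.
  rewrite subnn addn0 !add0n big_seq big1 // => y /(allP xs) /=; lia.
rewrite (IH k (path_sorted ss)) mulSn.
suff : nth 0 s k <= x by lia.
have [ks|ks] := ltnP k (size s); last by rewrite nth_default.
exact: (allP xs) (mem_nth 0 ks).
Qed.

Lemma big_decr_rearr s (F : nat -> nat) :
  \sum_(x <- decr_rearr s) F x = \sum_(x <- s) F x.
Proof. by apply: perm_big; rewrite perm_sort. Qed.

(** The sum of the k largest parts is the minimum over c of the total excess over c plus k c,
    attained at the sorted part of index k. Dominance thus follows from inequalities between
    excesses, which do not involve sorting. *)
Lemma dom_ge_sort s t : sumn s = sumn t ->
  (forall c, \sum_(x <- t) (x - c) <= \sum_(x <- s) (x - c)) ->
  dom_ge (decr_rearr s) (decr_rearr t).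
Proof.
move=> st Hst; rewrite /dom_ge !sumnE !big_decr_rearr -!sumnE st eqxx /=.
apply/allP => k _.
have ss : sorted geq (decr_rearr s) by apply: sort_sorted geq_total _.
rewrite (sumn_take_sorted k ss); set c := nth _ _ _.
apply: leq_trans (sumn_take_le _ c k) _.
by rewrite leq_add2r !big_decr_rearr.
Qed.

Lemma count_gtE s c :
  count (fun x => c < x) s = \sum_(x <- s) (x - c) - \sum_(x <- s) (x - c.+1).
Proof.
suff -> : \sum_(x <- s) (x - c) = \sum_(x <- s) (x - c.+1) + count (fun x => c < x) s.
  lia.
by elim: s => [|x s IH]; rewrite ?big_nil ?big_cons //=; lia.
Qed.

(** Successive differences of excesses count the parts above c, and successive differences of these
    counts are multiplicities; the equality of lengths settles the multiplicity of 0. *)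
Lemma excess_perm s t : size s = size t ->
  (forall c, \sum_(x <- s) (x - c) = \sum_(x <- t) (x - c)) -> perm_eq s t.
Proof.
move=> sz Hst.
have Hgt c : count (fun x => c < x) s = count (fun x => c < x) t by rewrite !count_gtE !Hst.
have Hge c : count (fun x => c <= x) s = count (fun x => c <= x) t.
  by case: c => [|c]; [rewrite !(eq_count (a2 := predT)) ?count_predT | apply: Hgt].
have mem u v : count (fun x => v <= x) u = count (fun x => v < x) u + count_mem v u.
  by elim: u => //= x u ->; case: (ltngtP v x) => //=; lia.
apply/allP => v _ /=; apply/eqP.
by have := Hge v; rewrite (mem s v) (mem t v) Hgt => /addnI.
Qed.

Lemma decr_rearr_eq s t : perm_eq s t -> decr_rearr s = decr_rearr t.
Proof. by move=> st; apply/perm_sortP => //; [exact: geq_total|exact: geq_trans|exact: geq_anti]. Qed.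

Lemma perm_decr_rearr s t : decr_rearr s = decr_rearr t -> perm_eq s t.
Proof. by move=> st; rewrite -(perm_sort geq s) -/(decr_rearr s) st perm_sort. Qed.

End Dominance.

Section CompOrder.
Variable N : nat.
Local Open Scope nat_scope.
Implicit Types (m k h : 'X_{1..N}) (i j l : 'I_N).

Definition excess m c := \sum_(i < N) (m i - c).
Definition heads m p v := \sum_(i < N | i < p) (v <= m i).

(* [excess] encodes the dominance order on the sorted parts, and [heads] compares
   rearrangements of the same parts; the Cherednik operators are triangular for
   this order. *)
Definition cle k m : Prop :=
  [/\ mdeg k = mdeg m, forall c, excess k c <= excess m c
    & (forall c, excess k c = excess m c) -> forall p v, heads k p v <= heads m p v].

Lemma cle_refl m : cle m m. Proof. by split. Qed.

Lemma cle_trans m k h : cle k m -> cle h k -> cle h m.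
Proof.
move=> [d1 e1 c1] [d2 e2 c2]; split; first by rewrite d2.
  by move=> c; apply: leq_trans (e2 c) (e1 c).
move=> E.
have E1 c : excess k c = excess m c.
  by apply/eqP; rewrite eqn_leq e1 -E e2.
have E2 c : excess h c = excess k c by rewrite E E1.
by move=> p v; apply: leq_trans (c2 E2 p v) (c1 E1 p v).
Qed.

Lemma headsS m i v : heads m i.+1 v = heads m i v + (v <= m i).
Proof.
rewrite /heads (bigD1 i) //= addnC; congr (_ + _); apply: eq_bigl => l.
by rewrite -val_eqE /=; lia.
Qed.

Lemma heads_inj m k : (forall p v, heads m p v = heads k p v) -> m = k.
Proof.
move=> H; apply/mnmP => i.
have E v : (v <= m i) = (v <= k i).
  have := H i.+1 v; rewrite !headsS H => /eqP; rewrite eqn_add2l.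
  by case: (v <= m i); case: (v <= k i).
by apply/eqP; rewrite eqn_leq -E leqnn E leqnn.
Qed.

Lemma cle_anti m k : cle m k -> cle k m -> m = k.
Proof.
move=> [_ e1 c1] [_ e2 c2].
have E c : excess m c = excess k c by apply/eqP; rewrite eqn_leq e1 e2.
apply: heads_inj => p v; apply/eqP.
by rewrite eqn_leq c1 // c2 // => c; rewrite E.
Qed.

Lemma agree_off i j m k l : agree i j m k -> l != i -> l != j -> k l = m l.
Proof.
by case/andP => /eqP -> _ li lj; rewrite mupdE (negPf li) (negPf lj).
Qed.

Lemma agree_sym i j m k : i != j -> agree i j m k = agree j i m k.
Proof.
move=> ij; rewrite /agree addnC (addnC (m i)); congr (_ && _).
have -> : mupd m i j (k i) (k j) = mupd m j i (k j) (k i); last by [].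
apply/mnmP => l; rewrite !mupdE.
by case: (eqVneq l i) => // ->; rewrite (negPf ij).
Qed.

Lemma sum_agree (F : nat -> nat) i j m k (P : pred 'I_N) : i != j -> agree i j m k ->
  \sum_(l < N | P l) F (k l) + (P i * F (m i) + P j * F (m j)) =
  \sum_(l < N | P l) F (m l) + (P i * F (k i) + P j * F (k j)).
Proof.
move=> ij ag; rewrite !(big_mkcond P) (bigD1 i) //= (bigD1 j) 1?eq_sym //=.
rewrite [X in _ = X + _](bigD1 i) //= [X in _ = _ + X + _](bigD1 j) 1?eq_sym //=.
rewrite (eq_bigr (fun l => if P l then F (m l) else 0)); last first.
  by move=> l /andP[li lj]; rewrite (agree_off ag).
by case: (P i); case: (P j); rewrite ?mul1n ?mul0n; lia.
Qed.

Lemma excess0 m : excess m 0 = mdeg m.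
Proof. by rewrite /excess mdegE; apply: eq_bigr => l _; rewrite subn0. Qed.

(** The two exponents do not spread apart, so no excess grows. If none changes they were kept or
    swapped, and the last hypothesis excludes the swap that brings the larger one to the left. *)
Lemma cle_agree i j m k : i < j -> agree i j m k ->
  k i <= maxn (m i) (m j) -> k j <= maxn (m i) (m j) ->
  ~~ ((m i < m j) && (k i == m j)) -> cle k m.
Proof.
move=> ltij ag ki kj ns.
have ij : i != j by rewrite -val_eqE neq_ltn ltij.
have sE : k i + k j = m i + m j by case/andP: ag => _ /eqP.
have HE c : excess k c + ((m i - c) + (m j - c)) = excess m c + ((k i - c) + (k j - c)).
  by have := sum_agree (fun x => x - c) predT ij ag; rewrite !mul1n.
split.
- by have := HE 0; rewrite !excess0; lia.
- by move=> c; have := HE c; lia.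
move=> E p v.
(* At c equal to the larger new exponent the new pair has excess 0, hence so has the old pair; with
   equal sums and the bounds on k the two pairs coincide as multisets. *)
have sw : (k i == m i) && (k j == m j) || (k i == m j) && (k j == m i) && (m j <= m i).
  by have := HE (maxn (k i) (k j)); rewrite E; lia.
have := sum_agree (fun x => (v <= x) : nat) (fun l => l < p) ij ag.
rewrite -/(heads k p v) -/(heads m p v).
case/orP: sw => [/andP[/eqP-> /eqP->]|/andP[/andP[/eqP-> /eqP->] le]]; first lia.
have [ip|ip] := ltnP i p; have [jp|jp] := ltnP j p; rewrite ?mul1n ?mul0n; lia.
Qed.

Lemma excessE m c : excess m c = \sum_(x <- parts m) (x - c).
Proof. by rewrite big_map big_enum. Qed.

Lemma size_parts m : size (parts m) = N.
Proof. by rewrite size_map size_enum_ord. Qed.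

Lemma sumn_parts m : sumn (parts m) = mdeg m.
Proof. by rewrite sumnE big_map big_enum mdegE. Qed.

Lemma nth_parts m i : nth 0 (parts m) i = m i.
Proof. by rewrite (nth_map i) ?size_enum_ord // nth_ord_enum. Qed.

Lemma excess_star m k : (forall c, excess m c = excess k c) <-> sp_star m = sp_star k.
Proof.
split=> [E|E c]; last first.
  by rewrite !excessE -!(big_decr_rearr (parts _)) -!/(sp_star _) E.
apply: decr_rearr_eq; apply: excess_perm; first by rewrite !size_parts.
by move=> c; rewrite -!excessE.
Qed.

Lemma take_partsE m p : p <= N -> sumn (take p (parts m)) = \sum_(i < N | i < p) m i.
Proof.
move=> pN; rewrite sumnE (big_nth 0) size_take size_parts.
have -> : (if p < N then p else N) = p by case: ltnP pN => //; lia.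
rewrite big_mkord (big_ord_widen _ (fun i : nat => nth 0 (take p (parts m)) i) pN).
by apply: eq_bigr => i ip; rewrite nth_take // nth_parts.
Qed.

(** Layer-cake summation: it turns the levelwise comparison by [heads] into the partial sums used in
    [comp_gt]. *)
Lemma sum_heads m p : \sum_(i < N | i < p) m i = \sum_(1 <= v < (mdeg m).+1) heads m p v.
Proof.
rewrite exchange_big /=; apply: eq_bigr => i ip.
have mi : m i <= mdeg m by rewrite mdegE (bigD1 i) //= leq_addr.
suff -> : forall d, \sum_(1 <= v < d.+1) (v <= m i) = minn (m i) d by rewrite (minn_idPl mi).
elim=> [|d IH]; first by rewrite big_geq ?minn0.
by rewrite big_nat_recr //= IH; lia.
Qed.

Lemma cle_dom m k : cle k m -> dom_ge (sp_star m) (sp_star k).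
Proof.
move=> [d e _]; apply: dom_ge_sort; first by rewrite !sumn_parts.
by move=> c; rewrite -!excessE.
Qed.

Lemma cle_comp_gt m k : cle k m -> m != k -> comp_gt m k.
Proof.
move=> km neq; rewrite /comp_gt neq /=.
have [E|E] := eqVneq (decr_rearr (parts m)) (decr_rearr (parts k)); last first.
  by rewrite /dom_gt E (cle_dom km).
rewrite /= orbC; apply/orP; left; apply/allP => p _.
have [d _ c] := km.
have EE : forall c', excess k c' = excess m c'.
  by apply/excess_star; rewrite /sp_star E.
have [pN|pN] := leqP p N; last first.
  by rewrite !take_oversize ?size_parts ?(ltnW pN) // !sumn_parts d.
rewrite !take_partsE // !sum_heads d; apply: leq_sum => v _; exact: c.
Qed.

Variable M : nat.

(** Raising an entry by 1 raises its excess over c exactly when the entry is at least c. Hence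
    [excess] and [heads] at M together control the circled partition. *)
Lemma excess_circ m c :
  \sum_(x <- [seq m i + (i < M) | i <- enum 'I_N]) (x - c) = excess m c + heads m M c.
Proof.
rewrite big_map big_enum /= /excess /heads [X in _ = _ + X]big_mkcond -big_split /=.
apply: eq_bigr => i _; case: (i < M) => /=; lia.
Qed.

Lemma cle_dom_circ m k : cle k m -> sp_star m = sp_star k ->
  dom_ge (sp_circ M m) (sp_circ M k).
Proof.
move=> [d e h] /excess_star E; apply: dom_ge_sort.
  have S h' : sumn [seq h' i + (i < M) | i <- enum 'I_N] = mdeg h' + \sum_(i < N) (i < M).
    by rewrite sumnE big_map big_enum /= big_split /= -mdegE.
  by rewrite !S d.
by move=> c; rewrite !excess_circ leq_add // h // => c'; rewrite E.
Qed.

End CompOrder.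

Lemma max_above (T : eqType) (le : T -> T -> Prop) (s : seq T) x :
  (forall y z w, le z y -> le w z -> le w y) ->
  (forall y z, le y z -> le z y -> y = z) -> (forall y, le y y) ->
  x \in s -> exists y, [/\ y \in s, le x y & forall z, z \in s -> le y z -> z = y].
Proof.
move=> tr an rf; have [n] := ubnP (size s); elim: n s x => // n IH s x ss xs.
have [H|H] := boolp.EM (exists z, [/\ z \in s, le x z & z <> x]); last first.
  exists x; split => // z zs xz; have [//|/eqP zx] := eqVneq z x.
  by case: H; exists z.
case: H => z [zs xz /eqP zx].
have [||y [ys zy ymax]] := IH (rem x s) z.
- by rewrite size_rem //; case: s ss xs {zs} => //= a s; rewrite ltnS.
- by move: zs; rewrite (perm_mem (perm_to_rem xs)) inE (negPf zx).
have xy : le x y by apply: tr zy xz.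
exists y; split => //; first exact: mem_rem ys.
move=> w ws yw; have [wx|wx] := eqVneq w x.
  by apply: an => //; rewrite wx.
by apply: ymax => //; move: ws; rewrite (perm_mem (perm_to_rem xs)) inE (negPf wx).
Qed.

Section Triangularity.
Variables (R : idomainType) (N : nat).
Implicit Types (p : {mpoly R[N]}) (m k : 'X_{1..N}) (i j : 'I_N) (a : R).

Lemma agree_refl i j m : agree i j m m.
Proof. by rewrite /agree mupd_id eqxx eqxx. Qed.

Lemma sum_ltn_ord j : (\sum_(i < N | (i < j)%N) 1 = j)%N.
Proof.
by rewrite -(big_ord_widen _ (fun=> 1%N)) 1?ltnW // sum_nat_const card_ord muln1.
Qed.

Lemma card_setN (P : pred 'I_N) : #|[set i | P i]| = (\sum_(i < N) P i)%N.
Proof. by rewrite -sum1_card big_mkcond; apply: eq_bigr => i _; rewrite inE; case: (P i). Qed.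

(* The row, counted from 0, that position j occupies in the sorted composition;
   equal parts are ordered from left to right. *)
Definition rkn m j : nat :=
  (#|[set i : 'I_N | (i < j)%N && (m j <= m i)%N]| +
   #|[set i : 'I_N | (j < i)%N && (m j < m i)%N]|)%N.

Lemma barE a m j : bar a m j = a *+ m j - (rkn m j)%:R.
Proof. by rewrite /bar /rkn natrD opprD addrA. Qed.

Lemma coef_cherednik_diag a j m : (cherednik a j 'X_[m])@_m = bar a m j.
Proof.
rewrite coef_cherednikX eqxx mul1r barE -addrA -addrA; congr (_ + _).
rewrite /rkn !card_setN natrD opprD !natr_sum -!sumrN.
have -> : j%:R = \sum_(i < N | (i < j)%N) 1%:R :> R by rewrite -natr_sum sum_ltn_ord.
rewrite -sumrN addrA -big_split /= !(big_mkcond (fun i : 'I_N => _ < _)%N) /=.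
congr (_ + _); apply: eq_bigr => i _; rewrite agree_refl leqnn ltnn /= ?andbT.
  by case: (i < j)%N => /=; case: (leqP (m j) (m i)) => _ /=; ring.
by case: (j < i)%N => /=; case: (m j < m i)%N => /=; rewrite ?ltnn ?andbF /=; ring.
Qed.

(** Lower quotients are multiplied by [x_j] and higher ones by [x_i]; the half-open ranges of
    exponents that result omit precisely the swap that would go up in the order. *)
Lemma coef_cherednik_cle a j m k : (cherednik a j 'X_[m])@_k != 0 -> cle k m.
Proof.
rewrite coef_cherednikX => nz.
have [<-|mk] := eqVneq m k; first exact: cle_refl.
move: nz; rewrite (negPf mk) mul0r add0r => nz.
have [|] := eqVneq (\sum_(i < N | (i < j)%N) ((agree i j m k && (m i < k j <= m j)%N)%:R
      - (agree i j m k && (m j < k j <= m i)%N)%:R) : R) 0 => [z1|].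
  move: nz; rewrite z1 add0r => nz.
  have [i ij] : exists2 i : 'I_N, (j < i)%N &
     agree i j m k && ((m i <= k j < m j)%N || (m j <= k j < m i)%N).
    apply/exists_inP; apply: contraNT nz => /exists_inPn H.
    rewrite big1 // => i ij; have := H i ij; case: (agree i j m k) => /=; last by rewrite subr0.
    by rewrite negb_or => /andP[/negPf-> /negPf->]; rewrite subr0.
  case/andP => ag c; have sE : (k i + k j = m i + m j)%N by case/andP: ag => _ /eqP.
  have ji : i != j by rewrite gtn_ord_neq.
  apply: (@cle_agree _ j i) => //; [by rewrite -agree_sym|lia|lia|lia].
move=> z1; have [i ij] : exists2 i : 'I_N, (i < j)%N &
     agree i j m k && ((m i < k j <= m j)%N || (m j < k j <= m i)%N).
  apply/exists_inP; apply: contraNT z1 => /exists_inPn H.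
  rewrite big1 // => i ij; have := H i ij; case: (agree i j m k) => /=; last by rewrite subr0.
  by rewrite negb_or => /andP[/negPf-> /negPf->]; rewrite subr0.
case/andP => ag c; have sE : (k i + k j = m i + m j)%N by case/andP: ag => _ /eqP.
by apply: (@cle_agree _ i j) => //; lia.
Qed.

Definition top_at k p := forall m, cle k m -> m != k -> p@_m = 0.

Lemma coef_cherednik_top a j k p : top_at k p ->
  (cherednik a j p)@_k = bar a k j * p@_k.
Proof.
move=> top; rewrite coef_cherednik.
have [kp|kp] := boolP (k \in msupp p); last first.
  rewrite (memN_msupp_eq0 kp) mulr0 big_seq big1 // => m mp.
  have [->|/eqP nz] := eqVneq ((cherednik a j 'X_[m])@_k) 0; first by rewrite mulr0.
  have km := coef_cherednik_cle (introN eqP nz).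
  rewrite top ?mul0r //; apply: contraNneq kp => <- //.
rewrite (bigD1_seq k) ?msupp_uniq //= coef_cherednik_diag mulrC big1 ?addr0 // => m mk.
have [->|/eqP nz] := eqVneq ((cherednik a j 'X_[m])@_k) 0; first by rewrite mulr0.
by rewrite top ?mul0r //; apply: (coef_cherednik_cle (introN eqP nz)).
Qed.

Lemma top_at_cherednik a j k p : top_at k p -> top_at k (cherednik a j p).
Proof.
move=> top m km mk; rewrite coef_cherednik big1 // => h _.
have [->|/eqP nz] := eqVneq ((cherednik a j 'X_[h])@_m) 0; first by rewrite mulr0.
have mh := coef_cherednik_cle (introN eqP nz).
rewrite top ?mul0r //; first exact: cle_trans mh km.
by apply: contraNneq mk => hk; move: mh; rewrite hk => /cle_anti/(_ km)->.
Qed.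

Definition joint_eigen a (t : 'I_N -> R) p := forall j, cherednik a j p = t j *: p.

Lemma top_exists p m : m \in msupp p ->
  exists k, [/\ k \in msupp p, cle m k & top_at k p].
Proof.
move=> mp; have [k [kp mk kmax]] := max_above (@cle_trans N) (@cle_anti N) (@cle_refl N) mp.
exists k; split => // h kh hk; apply: memN_msupp_eq0.
by apply: contraNN hk => hp; rewrite (kmax h).
Qed.

(** Above m in the support there is a maximal monomial, and at its coefficient only the diagonal
    entries of the operators contribute. *)
Lemma joint_eigen_top a t p m : joint_eigen a t p -> m \in msupp p ->
  exists k, [/\ k \in msupp p, cle m k & forall j, t j = bar a k j].
Proof.
move=> ep /top_exists[k [kp mk top]]; exists k; split => // j.
have := coef_cherednik_top a j top; rewrite ep mcoeffZ => /(mulIf _); apply.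
by rewrite -mcoeff_msupp.
Qed.

Lemma joint_eigenD a t p q : joint_eigen a t p -> joint_eigen a t q ->
  joint_eigen a t (p + q).
Proof. by move=> ep eq j; rewrite linearD /= ep eq scalerDr. Qed.

Lemma joint_eigenZ a t c p : joint_eigen a t p -> joint_eigen a t (c *: p).
Proof. by move=> ep j; rewrite linearZ /= ep !scalerA mulrC. Qed.

End Triangularity.

(** * Rows of a composition *)

Section Rank.
Variable N : nat.
Implicit Types (m k : 'X_{1..N}) (i j l : 'I_N).

Definition before m i j : bool := (m j < m i)%N || ((m i == m j) && (i < j)%N).

Lemma rknE m j : rkn m j = #|[set i | before m i j]|.
Proof.
rewrite /rkn !card_setN -big_split /=; apply: eq_bigr => i _.
rewrite /before; have [->|] := eqVneq i j; first by rewrite !ltnn eqxx.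
by rewrite -val_eqE /=; lia.
Qed.

Lemma before_irr m i : before m i i = false.
Proof. by rewrite /before !ltnn andbF. Qed.

Lemma before_trans m i j l : before m i j -> before m j l -> before m i l.
Proof. rewrite /before; lia. Qed.

Lemma before_total m i j : i != j -> before m i j || before m j i.
Proof. by rewrite /before -val_eqE /=; lia. Qed.

Lemma rkn_lt m i j : (rkn m i < rkn m j)%N = before m i j.
Proof.
have H x y : before m x y -> (rkn m x < rkn m y)%N.
  move=> xy; rewrite !rknE; apply: proper_card; apply/properP; split.
    by apply/subsetP => z; rewrite !inE => zx; apply: before_trans xy.
  by exists x; rewrite !inE ?before_irr.
apply/idP/idP; last exact: H.
apply: contraTT => nij; have [->|ij] := eqVneq i j; first by rewrite ltnn.
have := before_total m ij; rewrite (negPf nij) /= => /H; lia.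
Qed.

Lemma rkn_ltN m j : (rkn m j < N)%N.
Proof.
rewrite rknE -[X in (_ < X)%N](card_ord N) -cardsT; apply: proper_card.
by apply/properP; split; [apply: subsetT | exists j; rewrite !inE ?before_irr].
Qed.

Definition rk m j : 'I_N := Ordinal (rkn_ltN m j).

Lemma rk_inj m : injective (rk m).
Proof.
move=> i j /(congr1 val) /= E; apply/eqP; apply: contraTT isT => ij.
by have := before_total m ij; rewrite -!rkn_lt E ltnn.
Qed.

Definition rkp m : 'S_N := perm (@rk_inj m).

Lemma rkpE m j : rkp m j = rkn m j :> nat.
Proof. by rewrite permE. Qed.

(** Serves both partitions of a superpartition: ties are ranked from left to right, so adding 1 on
    the first M positions leaves the order of the rows unchanged. *)
Lemma nth_decr_rearr m (v : 'I_N -> nat) j :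
  (forall i j, before m i j -> v j <= v i)%N ->
  nth 0%N (decr_rearr [seq v i | i <- enum 'I_N]) (rkn m j) = v j.
Proof.
move=> mono; pose w := rkp m.
have nE l : nth 0%N [seq v ((w^-1)%g i) | i <- enum 'I_N] l = v ((w^-1)%g l).
  by rewrite (nth_map l) ?size_enum_ord // nth_ord_enum.
have -> : decr_rearr [seq v i | i <- enum 'I_N] = [seq v ((w^-1)%g i) | i <- enum 'I_N].
  apply: (sorted_eq geq_trans geq_anti); first exact: sort_sorted geq_total _.
    apply/(sortedP 0%N) => i; rewrite size_map size_enum_ord => iN.
    have iN' := ltnW iN.
    rewrite (nE (Ordinal iN)) (nE (Ordinal iN')) /=.
    apply: mono; rewrite -rkn_lt -!rkpE !permKV //.
  rewrite perm_sort (map_comp v (w^-1)%g); apply: perm_map.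
  apply: uniq_perm; rewrite ?enum_uniq ?(map_inj_uniq perm_inj) ?enum_uniq //.
  move=> i; rewrite mem_enum inE; apply/esym/mapP.
  by exists (w i); rewrite ?mem_enum // permK.
by rewrite -rkpE nE permK.
Qed.

Lemma nth_star m j : nth 0%N (sp_star m) (rkn m j) = m j.
Proof. by apply: nth_decr_rearr => i l; rewrite /before; lia. Qed.

Lemma nth_circ M m j : nth 0%N (sp_circ M m) (rkn m j) = (m j + (j < M))%N.
Proof. by apply: nth_decr_rearr => i l; rewrite /before; lia. Qed.

End Rank.

(** * Sekiguchi operators and their eigenvalues *)

Section Sekiguchi.
Variables (R : idomainType) (N M : nat).
Implicit Types (p : {mpoly R[N]}) (m k : 'X_{1..N}) (i j : 'I_N) (a u : R).

Lemma eps_star a u m : eps N (sp_star m) a u = \prod_(j < N) (u + bar a m j).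
Proof.
rewrite /eps (reindex_inj (@perm_inj _ (rkp m))); apply: eq_bigr => j _.
by rewrite rkpE nth_star barE addrA.
Qed.

Lemma eps_circ a u m :
  eps N (sp_circ M m) a u = \prod_(j < N) (u + a *+ (j < M)%N + bar a m j).
Proof.
rewrite /eps (reindex_inj (@perm_inj _ (rkp m))); apply: eq_bigr => j _.
by rewrite rkpE nth_circ barE mulrnDr; ring.
Qed.

(** Common form of the two operators at u = v, with [w] the scalar shift of each factor. *)
Definition sek (w : 'I_N -> R) a p :=
  foldr (fun i q => w i *: q + cherednik a i q) p (enum 'I_N).

Lemma sek_starE a u p : sekiguchi_star a u p = sek (fun=> u) a p.
Proof. by []. Qed.

Lemma sek_circE a u p :
  sekiguchi_circ M a u u p = sek (fun j => u + a *+ (j < M)%N) a p.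
Proof.
rewrite /sekiguchi_circ /sek; elim: (enum _) => //= i s ->.
by case: ltnP; rewrite ?mulr1n ?mulr0n ?addr0.
Qed.

Lemma sek_joint w a t p : joint_eigen a t p ->
  sek w a p = (\prod_(j < N) (w j + t j)) *: p.
Proof.
move=> ep; rewrite /sek -big_enum /=; elim: (enum _) => [|i s IH] /=.
  by rewrite big_nil scale1r.
rewrite big_cons IH (joint_eigenZ _ ep) !scalerA -scalerDl; congr (_ *: _); ring.
Qed.

Lemma sek_top w a k p : top_at k p ->
  (sek w a p)@_k = \prod_(j < N) (w j + bar a k j) * p@_k.
Proof.
move=> top; rewrite /sek -big_enum /=.
suff [] : top_at k (foldr (fun i q => w i *: q + cherednik a i q) p (enum 'I_N)) /\
  (foldr (fun i q => w i *: q + cherednik a i q) p (enum 'I_N))@_k =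
  \prod_(j <- enum 'I_N) (w j + bar a k j) * p@_k by [].
elim: (enum _) => [|i s [IH1 IH2]] /=; first by rewrite big_nil mul1r.
split; last by rewrite big_cons mcoeffD mcoeffZ (coef_cherednik_top _ _ IH1) IH2; ring.
move=> m km mk; rewrite mcoeffD mcoeffZ IH1 // mulr0 add0r.
exact: (top_at_cherednik a i IH1).
Qed.

Lemma sek_is_linear w a : linear (sek w a).
Proof.
move=> c p q; rewrite /sek; elim: (enum _) => //= i s ->.
by rewrite cherednik_is_linear !scalerDr !scalerA (mulrC (w i) c) addrACA.
Qed.

HB.instance Definition _ w a :=
  GRing.isLinear.Build R {mpoly R[N]} {mpoly R[N]} _ (sek w a) (sek_is_linear w a).

End Sekiguchi.

Section Morphism.
Variables (R S : idomainType) (f : {rmorphism R -> S}) (N : nat).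
Implicit Types (p : {mpoly R[N]}) (i j : 'I_N).

Lemma map_cherednik a j p :
  map_mpoly f (cherednik a j p) = cherednik (f a) j (map_mpoly f p).
Proof.
have E m : map_mpoly f (cherednik a j 'X_[m]) = cherednik (f a) j 'X_[m].
  apply/mpolyP => k; rewrite mcoeff_map_mpoly /= !coef_cherednikX.
  rewrite !(rmorphD f) (rmorphM f) (rmorphB f).
  rewrite (raddfMn f (m j) a) !(rmorph_nat f) !rmorph_sum /=.
  by congr (_ + _ + _); apply: eq_bigr => i _; rewrite rmorphB /= !rmorph_nat.
have -> : map_mpoly f p = \sum_(m <- msupp p) f p@_m *: 'X_[m].
  rewrite {1}[p]mpolyE raddf_sum /=; apply: eq_bigr => m _.
  by rewrite map_mpolyZ map_mpolyX.
rewrite {1}[p]mpolyE (linear_sum (cherednik a j)) (linear_sum (cherednik (f a) j)).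
rewrite (raddf_sum (map_mpoly f)) /=; apply: eq_bigr => m _.
have -> : cherednik a j (p@_m *: 'X_[m]) = p@_m *: cherednik a j 'X_[m] by rewrite linearZ.
have -> : cherednik (f a) j (f p@_m *: 'X_[m]) = f p@_m *: cherednik (f a) j 'X_[m].
  by rewrite linearZ.
by rewrite map_mpolyZ E.
Qed.

End Morphism.

(** * Generic non-symmetric Jack polynomials *)

Section Perm.
Variable N : nat.
Implicit Types (m k : 'X_{1..N}) (i j : 'I_N) (s : 'S_N).

Definition mact s m : 'X_{1..N} := [multinom m (s i) | i < N].

Lemma mactE s m i : mact s m i = m (s i). Proof. by rewrite mnmE. Qed.

Lemma mcoeff_mact (R : nzRingType) s (p : {mpoly R[N]}) m :
  (msym s p)@_m = p@_(mact s m).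
Proof. exact: mcoeff_sym. Qed.

Lemma mact_tpermK i j : involutive (mact (tperm i j)).
Proof. by move=> m; apply/mnmP => l; rewrite !mactE tpermK. Qed.

Lemma mdeg_mact s m : mdeg (mact s m) = mdeg m.
Proof.
rewrite !mdegE [RHS](reindex_inj (@perm_inj _ s)) /=.
by apply: eq_bigr => i _; rewrite mactE.
Qed.

Lemma rkn_transport m k s :
  (forall i j, before k (s i) (s j) = before m i j) -> forall j, rkn k (s j) = rkn m j.
Proof.
move=> H j; rewrite !rknE !card_setN (reindex_inj (@perm_inj _ s)) /=.
by apply: eq_bigr => i _; rewrite H.
Qed.

Lemma before_simple (x y : 'I_N) m i j : y = x.+1 :> nat -> m x != m y ->
  before (mact (tperm x y) m) (tperm x y i) (tperm x y j) = before m i j.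
Proof.
move=> xy mxy; rewrite /before !mactE !tpermK.
case: (tpermP x y i) => [->|->|/eqP ix /eqP iy]; case: (tpermP x y j) => [->|->|/eqP jx /eqP jy];
  rewrite ?ltnn ?eqxx //; try (by move: mxy; lia).
- by move: jx jy; rewrite -!val_eqE /=; lia.
- by move: jx jy; rewrite -!val_eqE /=; lia.
- by move: ix iy; rewrite -!val_eqE /=; lia.
- by move: ix iy; rewrite -!val_eqE /=; lia.
Qed.

Lemma adj_trans (r : rel 'I_N) :
  (forall x y z, r x y -> r y z -> r x z) ->
  (forall x y : 'I_N, y = x.+1 :> nat -> r x y) ->
  forall x y : 'I_N, (x < y)%N -> r x y.
Proof.
move=> tr adj x y xy; have [d dE] : {d | (y - x = d.+1)%N}.
  by exists (y - x).-1; lia.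
elim: d y xy dE => [|d IH] y xy dE; first by apply: adj; lia.
have zN : (y.-1 < N)%N by have := ltn_ord y; lia.
apply: (tr _ (Ordinal zN)); last by apply: adj => /=; lia.
by apply: IH => /=; lia.
Qed.

End Perm.

Section Eval1.
Variables (R : comNzRingType) (N : nat).
Implicit Types (p : {mpoly R[N]}).

Definition ev1 p : R := p.@[fun=> 1].

Lemma ev1X m : ev1 'X_[m] = 1.
Proof. by rewrite /ev1 mevalX big1 // => i _; rewrite expr1n. Qed.

Lemma ev1D p q : ev1 (p + q) = ev1 p + ev1 q. Proof. exact: mevalD. Qed.
Lemma ev1Z c p : ev1 (c *: p) = c * ev1 p. Proof. exact: mevalZ. Qed.
Lemma ev1M p q : ev1 (p * q) = ev1 p * ev1 q. Proof. exact: mevalM. Qed.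

Lemma ev1E p : ev1 p = \sum_(m <- msupp p) p@_m.
Proof.
rewrite /ev1 mevalE; apply: eq_bigr => m _; rewrite big1 ?mulr1 // => i _.
by rewrite expr1n.
Qed.

Lemma ev1_msym s p : ev1 (msym s p) = ev1 p.
Proof.
rewrite [p]mpolyE raddf_sum /= /ev1 !raddf_sum /=; apply: eq_bigr => m _.
by rewrite msymZ msymX !mevalZ -!/(ev1 _) !ev1X.
Qed.

End Eval1.

Section Generic.
Variables (K : fieldType) (a : K).
(** The form in which alpha is generic; it holds for the variable of F(alpha) in characteristic 0,
    and lets a composition be recovered from its eigenvalues. *)
Hypothesis gen : forall x y n1 n2 : nat,
  a *+ x + n1%:R = a *+ y + n2%:R -> x = y /\ n1 = n2.

Lemma gen_neq0 d n : (0 < d)%N -> a *+ d + n%:R != 0.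
Proof.
move=> d0; apply/eqP => E.
by have [] := @gen d 0 n 0; rewrite ?mulr0n ?addr0 //; lia.
Qed.

Lemma bar_inj N (m k : 'X_{1..N}) : (forall j, bar a m j = bar a k j) -> m = k.
Proof.
move=> E; apply/mnmP => j; have := E j; rewrite !barE => E'.
have [] := @gen (m j) (k j) (rkn k j) (rkn m j) => //.
by rewrite -[a *+ m j](subrK (rkn m j)%:R) E'; ring.
Qed.

(** A maximal monomial above m has the eigenvalues of h, hence is h itself. *)
Lemma gen_supp N (h : 'X_{1..N}) p m : joint_eigen a (bar a h) p -> m \in msupp p ->
  cle m h /\ h \in msupp p.
Proof.
move=> ep mp; have [k [kp mk kE]] := joint_eigen_top ep mp.
by have -> : h = k by apply: bar_inj.
Qed.

Lemma gen_eq0 N (h : 'X_{1..N}) p : joint_eigen a (bar a h) p -> p@_h = 0 -> p = 0.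
Proof.
move=> ep ph; apply/eqP; rewrite -msupp_eq0; case E : (msupp p) => [//|m s].
have mp : m \in msupp p by rewrite E inE eqxx.
have [_] := gen_supp ep mp.
by rewrite mcoeff_msupp ph eqxx.
Qed.

(** The intertwiner of an adjacent transposition: the added multiple of p compensates the constant
    in the exchange relations, and the eigenvalues at x and y trade places. *)
Lemma joint_simple N (t : 'I_N -> K) (x y : 'I_N) p : y = x.+1 :> nat ->
  joint_eigen a t p -> t y != t x ->
  joint_eigen a (fun j => t (tperm x y j)) (msym (tperm x y) p + (t y - t x)^-1 *: p).
Proof.
move=> xy ep nt j; set s := tperm x y; set c := (_ - _)^-1.
have cE : c * (t y - t x) = 1 by rewrite mulVf // subr_eq0.
have -> : cherednik a j (msym s p + c *: p) = cherednik a j (msym s p) + c *: cherednik a j p.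
  by rewrite linearD linearZ.
rewrite ep; have [->|jx] := eqVneq j x.
  rewrite (cherednik_simple_l xy (erefl s)) ep msymZ tpermL scalerDr -addrA; congr (_ + _).
  rewrite !scalerA -[X in X + _]scale1r -scalerDl; congr (_ *: _).
  by rewrite -cE; ring.
have [->|jy] := eqVneq j y.
  rewrite (cherednik_simple_r xy (erefl s)) ep msymZ tpermR scalerDr -addrA; congr (_ + _).
  rewrite !scalerA -[X in X + _]scaleN1r -scalerDl; congr (_ *: _).
  by rewrite -cE; ring.
rewrite (cherednik_simple_other xy (erefl s)) // ep msymZ tpermD 1?eq_sym //.
by rewrite scalerDr !scalerA mulrC.
Qed.

Lemma bar_simple N (m : 'X_{1..N}) (x y : 'I_N) j : y = x.+1 :> nat -> m x != m y ->
  bar a (mact (tperm x y) m) j = bar a m (tperm x y j).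
Proof.
move=> xy mxy; rewrite !barE mactE -[in LHS](tpermK x y j).
rewrite (rkn_transport (m := m)) ?mactE ?tpermK // => i l; exact: before_simple.
Qed.

(** Share of one pair of rows in the principal specialisation: d is the distance of the rows and s
    runs over D columns. Grouping by pairs of rows rather than by boxes makes an elementary step
    alter at most one share. *)
Definition fac (D d : nat) : K :=
  \prod_(1 <= s < D.+1) ((a *+ s + d.+1%:R) / (a *+ s + d%:R)).

Lemma facS D d : fac D.+1 d = fac D d * ((a *+ D.+1 + d.+1%:R) / (a *+ D.+1 + d%:R)).
Proof. by rewrite /fac big_nat_recr. Qed.

(** A pair whose longer row stands to the right loses one column. For [before m i j] the
    subtractions never truncate, as a tie has i < j. *)
Definition evfac N (m : 'X_{1..N}) (i j : 'I_N) : K :=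
  fac (m i - m j - (j < i)) (rkn m j - rkn m i).

(* The value at (1,...,1) of the non-symmetric Jack polynomial of index m. *)
Definition evform N (m : 'X_{1..N}) : K :=
  \prod_(p : 'I_N * 'I_N | before m p.1 p.2) evfac m p.1 p.2.

Lemma pair_perm_inj N (s : 'S_N) : injective (fun p : 'I_N * 'I_N => (s p.1, s p.2)).
Proof. by move=> [i j] [i' j'] /= [/perm_inj-> /perm_inj->]. Qed.

(** Only the pair (y, x) changes. It gains the column s = m_y - m_x, and the ratio in that column is
    1 plus the inverse of the difference of eigenvalues. *)
Lemma evform_simple N (m : 'X_{1..N}) (x y : 'I_N) : y = x.+1 :> nat -> (m x < m y)%N ->
  evform (mact (tperm x y) m) = (1 + (bar a m y - bar a m x)^-1) * evform m.
Proof.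
move=> xy mxy; set s := tperm x y; set k := mact s m.
have neq : m x != m y by rewrite neq_ltn mxy.
have bE i j : before k (s i) (s j) = before m i j by apply: before_simple.
have rE j : rkn k (s j) = rkn m j by apply: rkn_transport.
have kE j : k (s j) = m j by rewrite mactE tpermK.
have byx : before m y x by rewrite /before mxy.
rewrite /evform (reindex_inj (@pair_perm_inj _ s)) /=.
rewrite (eq_bigl (fun p => before m p.1 p.2)); last by move=> p; rewrite bE.
rewrite (bigD1 (y, x)) //= [X in _ = _ * X](bigD1 (y, x)) //= mulrA; congr (_ * _).
  rewrite /evfac !kE !rE /s tpermL tpermR xy ltnSn.
  have -> : (x.+1 < x)%N = false by lia.
  have rlt : (rkn m y < rkn m x)%N by rewrite rkn_lt.
  have [D DE] : {D | (m y - m x = D.+1)%N} by exists (m y - m x).-1; lia.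
  rewrite DE subn0 subn1 /= facS mulrC; congr (_ * _).
  set d := (rkn m x - rkn m y)%N.
  have -> : bar a m y - bar a m x = a *+ D.+1 + d%:R.
    rewrite !barE -DE /d mulrnBr 1?ltnW // natrB 1?ltnW //; ring.
  have nz : a *+ D.+1 + d%:R != 0 by apply: gen_neq0.
  by rewrite -natr1 addrA [in LHS]mulrDl divff // mul1r.
apply: eq_bigr => [[i j]] /= /andP[bij]; rewrite xpair_eqE negb_and => ne.
rewrite /evfac !kE !rE; congr (fac (_ - _) _).
rewrite /s; case: (tpermP x y i) => [iE|iE|/eqP ix /eqP iy];
  case: (tpermP x y j) => [jE|jE|/eqP jx /eqP jy]; rewrite ?iE ?jE ?ltnn //.
- by move: bij; rewrite iE jE /before; lia.
- by move: jx jy; rewrite -!val_eqE /=; lia.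
- by move: ne; rewrite iE jE !eqxx.
- by move: jx jy; rewrite -!val_eqE /=; lia.
- by move: ix iy; rewrite -!val_eqE /=; lia.
- by move: ix iy; rewrite -!val_eqE /=; lia.
Qed.

Section RaisingGen.
Variable n : nat.
Implicit Types (m : 'X_{1..n.+1}) (i j : 'I_n.+1).

Definition phim m : 'X_{1..n.+1} :=
  [multinom (m ((cyc n)^-1 i)%g + (i == ord_max))%N | i < n.+1].

Lemma phimE m j : phim m (cyc n j) = (m j + (j == ord0))%N.
Proof. by rewrite mnmE permK -(cyc0 n) (inj_eq perm_inj). Qed.

Lemma before_phi m i j : before (phim m) (cyc n i) (cyc n j) = before m i j.
Proof.
rewrite /before !phimE -!val_eqE /=.
have := cycE i; have := cycE j; have := ltn_ord i; have := ltn_ord j.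
have [i0|i0] := eqVneq (i : nat) 0%N; have [j0|j0] := eqVneq (j : nat) 0%N => ? ? -> ->;
  rewrite ?i0 ?j0; lia.
Qed.

Lemma rkn_phi m j : rkn (phim m) (cyc n j) = rkn m j.
Proof. by apply: rkn_transport => i l; apply: before_phi. Qed.

Lemma joint_phi m p : joint_eigen a (bar a m) p ->
  joint_eigen a (bar a (phim m)) (phi p).
Proof.
move=> ep j; rewrite -[j](permKV (cyc n)); set i := ((cyc n)^-1 j)%g.
have [->|i0] := eqVneq i ord0; last first.
  rewrite cherednik_phi // ep /phi msymZ -scalerAr; congr (_ *: _).
  by rewrite !barE phimE rkn_phi (negPf i0) addn0.
rewrite cyc0 cherednik_phi0 ep -scalerDl /phi msymZ -scalerAr; congr (_ *: _).
rewrite -(cyc0 n) !barE phimE rkn_phi eqxx mulrnDr /=; ring.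
Qed.

(** The first entry gains a box and becomes the last one; in each pair that contains it the box and
    the correction for the positions cancel. *)
Lemma evform_phi m : evform (phim m) = evform m.
Proof.
rewrite /evform (reindex_inj (@pair_perm_inj _ (cyc n))) /=.
rewrite (eq_bigl (fun p => before m p.1 p.2)); last by move=> p; rewrite before_phi.
apply: eq_bigr => [[i j]] /= bij; rewrite /evfac !rkn_phi; congr (fac _ _).
move: bij; rewrite /before !phimE -!val_eqE /=.
have := cycE i; have := cycE j; have := ltn_ord i; have := ltn_ord j.
have [i0|i0] := eqVneq (i : nat) 0%N; have [j0|j0] := eqVneq (j : nat) 0%N => ? ? -> ->;
  rewrite ?i0 ?j0; lia.
Qed.

Lemma phi_coef m (p : {mpoly K[n.+1]}) : (phi p)@_(phim m) = p@_m.
Proof.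
have -> : phim m = (U_(ord_max) + mact (cyc n)^-1 m)%MM.
  by apply/mnmP => i; rewrite mnmDE mnm1E mactE mnmE addnC eq_sym.
rewrite /phi mulrC mcoeffMX mcoeff_mact; congr (p@_ _).
by apply/mnmP => i; rewrite !mactE permK.
Qed.

Lemma ev1_phi (p : {mpoly K[n.+1]}) : ev1 (phi p) = ev1 p.
Proof. by rewrite /phi ev1M ev1X mul1r ev1_msym. Qed.

Lemma phim_mdeg m : mdeg (phim m) = (mdeg m).+1.
Proof.
rewrite !mdegE (reindex_inj (@perm_inj _ (cyc n))) /=.
rewrite (eq_bigr (fun j => m j + (j == ord0))%N); last by move=> j _; rewrite phimE.
rewrite big_split /= -[RHS]addn1; congr (_ + _)%N.
by rewrite (bigD1 ord0) //= big1 // => i /negPf->.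
Qed.

Definition nsData m (p : {mpoly K[n.+1]}) :=
  [/\ joint_eigen a (bar a m) p, p@_m = 1 & ev1 p = evform m].

Lemma nsData0 : nsData 0%MM 1.
Proof.
split; last 1 first.
- rewrite -mpolyX0 ev1X /evform big1 // => [[i j]] _ /=.
  by rewrite /evfac !mnm0E /fac big_geq.
- move=> j; rewrite -mpolyX0; apply/mpolyP => k; rewrite mcoeffZ mcoeffX.
  have [<-|k0] := eqVneq 0%MM k; first by rewrite coef_cherednik_diag mulr1.
  rewrite mulr0; apply/eqP; apply: contraNT k0 => /coef_cherednik_cle[d _ _].
  by rewrite eq_sym -mdeg_eq0 d mdeg0.
- by rewrite -mpolyX0 mcoeffX eqxx.
Qed.

Lemma nsData_phi m p : nsData m p -> nsData (phim m) (phi p).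
Proof.
move=> [ep p1 pe]; split; [exact: joint_phi|by rewrite phi_coef|].
by rewrite ev1_phi evform_phi.
Qed.

Lemma nsData_simple m p (x y : 'I_n.+1) : y = x.+1 :> nat -> (m x < m y)%N ->
  nsData m p ->
  nsData (mact (tperm x y) m) (msym (tperm x y) p + (bar a m y - bar a m x)^-1 *: p).
Proof.
move=> xy mxy [ep p1 pe]; have neq : m x != m y by rewrite neq_ltn mxy.
have nb : bar a m y != bar a m x.
  apply/eqP; rewrite !barE => E.
  have [] := @gen (m y) (m x) (rkn m x) (rkn m y); last by lia.
  by rewrite -[a *+ m y](subrK (rkn m y)%:R) E; ring.
split.
- move=> j; rewrite (joint_simple xy ep nb) bar_simple //.
- rewrite mcoeffD mcoeffZ mcoeff_mact mact_tpermK p1.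
  rewrite (_ : p@_ _ = 0) ?mulr0 ?addr0 //.
  (* The swapped exponent lies strictly above m, so p does not contain it: at level [m y] it has one
     more entry among the first x + 1 positions. *)
  apply: memN_msupp_eq0; apply/negP => /(gen_supp ep)[] [_ _] H _.
  have /H/(_ x.+1 (m y)) : forall c, excess (mact (tperm x y) m) c = excess m c.
    move=> c; rewrite /excess [RHS](reindex_inj (@perm_inj _ (tperm x y))) /=.
    by apply: eq_bigr => i _; rewrite mactE.
  rewrite !headsS mactE tpermL leqnn (leqNgt (m y) (m x)) mxy addn0 addn1.
  rewrite (_ : heads (mact _ _) x _ = heads m x (m y)) ?ltnn //.
  apply: eq_bigr => i ix; rewrite mactE tpermD // -val_eqE /=; lia.
- by rewrite ev1D ev1Z ev1_msym pe evform_simple // mulrDl mul1r.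
Qed.

(** Every composition is reached from 0. A positive last entry is removed by undoing [phim], which
    lowers the degree; otherwise some positive entry is followed by a zero, and moving it to the
    right lowers [wt]. *)
Lemma nsData_exists m : exists p, nsData m p.
Proof.
have [d] := ubnP (mdeg m); elim: d m => // d IHd m dm.
have [m0|mpos] := eqVneq (mdeg m) 0%N.
  by exists 1; move/eqP: m0; rewrite mdeg_eq0 => /eqP->; apply: nsData0.
pose wt (k : 'X_{1..n.+1}) := (\sum_(i < n.+1) k i * (n - i))%N.
have [w] := ubnP (wt m); elim: w m dm mpos => // w IHw m dm mpos wm.
have [mL|mL] := posnP (m ord_max); last first.
  pose k : 'X_{1..n.+1} := [multinom (m (cyc n i) - (i == ord0))%N | i < n.+1].
  have mE : m = phim k.
    apply/mnmP => j; rewrite -[j](permKV (cyc n)) phimE mnmE.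
    case: eqP => [->|_]; last by rewrite subn0 addn0.
    by rewrite cyc0 subnK.
  have [p kp] : exists p, nsData k p.
    by apply: IHd; move: dm; rewrite mE phim_mdeg.
  by exists (phi p); rewrite mE; apply: nsData_phi.
have [x [y [xy mx my]]] : exists x y : 'I_n.+1, [/\ y = x.+1 :> nat, (0 < m x)%N & m y = 0%N].
  apply: boolp.contrapT => nex.
  have [i mi] : exists i, (0 < m i)%N.
    apply: boolp.contrapT => nex'; move/eqP: mpos; apply; rewrite mdegE big1 // => i _.
    by apply/eqP; rewrite -leqn0 leqNgt; apply/negP => mi; apply: nex'; exists i.
  have H := @adj_trans n.+1 (fun x y => (0 < m x)%N ==> (0 < m y)%N).
  have iL : (i < @ord_max n)%N.
    have := ltn_ord i; rewrite ltnS leq_eqVlt => /orP[/eqP iE|//].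
    by move: mi; rewrite (_ : i = ord_max) ?mL //; apply: val_inj.
  have := H _ _ i ord_max iL; rewrite mi mL /= => K1; apply: notF; apply: K1.
    by move=> u v z; case: (0 < m u)%N => //= ->.
  move=> u v uv; apply/implyP => mu; rewrite lt0n; apply/eqP => mv.
  by apply: nex; exists u, v.
have wE : (wt (mact (tperm x y) m) < wt m)%N.
  rewrite /wt (bigD1 x) //= [X in (_ < X)%N](bigD1 x) //=.
  have yx : y != x by rewrite -val_eqE /=; lia.
  rewrite (bigD1 y) //= [X in (_ < _ + X)%N](bigD1 y) //=.
  rewrite (eq_bigr (fun i : 'I_n.+1 => m i * (n - i))%N); last first.
    by move=> i /andP[ix iy]; rewrite mactE tpermD // eq_sym.
  rewrite !mactE tpermL tpermR my; have := ltn_ord y; move: mx; rewrite xy => mx yn.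
  have -> : (n - x = (n - x.+1).+1)%N by lia.
  lia.
have [p kp] : exists p, nsData (mact (tperm x y) m) p.
  by apply: IHw; rewrite ?mdeg_mact //; move: wE wm; lia.
have lt : (mact (tperm x y) m x < mact (tperm x y) m y)%N.
  by rewrite !mactE tpermL tpermR my.
have := nsData_simple xy lt kp; rewrite mact_tpermK => H.
by eexists; exact: H.
Qed.

Lemma joint_ev1 m p : joint_eigen a (bar a m) p -> ev1 p = p@_m * evform m.
Proof.
move=> ep; have [q [eq q1 qe]] := nsData_exists m.
have /eqP : p - p@_m *: q = 0.
  apply: (@gen_eq0 _ m); last by rewrite mcoeffB mcoeffZ q1 mulr1 subrr.
  by rewrite -scaleNr; apply: joint_eigenD => //; apply: joint_eigenZ.
by rewrite subr_eq0 => /eqP->; rewrite ev1Z qe mcoeffZ q1 mulr1.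
Qed.

End RaisingGen.

End Generic.

(** * Symmetrization *)

Section Separation.
Variables (K : fieldType) (a : K) (N : nat).
Variables (V : {mpoly K[N]} -> Prop) (U : K -> Prop).
Hypotheses (VD : forall p q, V p -> V q -> V (p + q))
  (VZ : forall c p, U c -> V p -> V (c *: p))
  (Vch : forall j p, V p -> V (cherednik a j p)) (UN : forall c, U c -> U (- c)).

(** Applying the Cherednik operator minus t_w, divided by t_v - t_w, deletes the term of w and keeps
    that of v. With [V] reduced to 0 this gives linear independence; with [V] the polynomials
    regular at a point it transfers regularity from a sum to its terms. *)
Lemma separation (T : eqType) (O : seq T) (f : T -> {mpoly K[N]}) (t : T -> 'I_N -> K) :
  uniq O -> (forall v, v \in O -> joint_eigen a (t v) (f v)) ->
  (forall v j, v \in O -> U (t v j)) ->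
  (forall v w, v \in O -> w \in O -> v != w ->
     exists j, t v j != t w j /\ U (t v j - t w j)^-1) ->
  V (\sum_(v <- O) f v) -> forall v, v \in O -> V (f v).
Proof.
have [n] := ubnP (size O); elim: n O f => // n IH O f sO uO ef Ut sep Vs v vO.
have [[w wO vw]|OE] : (exists2 w, w \in O & w != v) \/ O = [:: v].
  case: O vO uO {IH sO ef Ut sep Vs} => [//|x [|y O]].
    by rewrite inE => /eqP-> _; right.
  move=> vO /= /andP[xO _]; left.
  have [xv|xv] := eqVneq x v; last by exists x; rewrite ?inE ?eqxx.
  exists y; rewrite ?inE ?eqxx ?orbT //; apply: contraNneq xO => yv.
  by rewrite inE xv yv eqxx.
- rewrite eq_sym in vw; have [j [tj Uj]] := sep v w vO wO vw.
  pose u x := (t v j - t w j)^-1 * (t x j - t w j).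
  have uv : u v = 1 by rewrite /u mulVf // subr_eq0.
  have -> : f v = u v *: f v by rewrite uv scale1r.
  apply: (IH (rem w O) (fun x => u x *: f x)) => //.
  + by rewrite size_rem //; case: (O) sO wO => //= x O' ; rewrite ltnS.
  + exact: rem_uniq.
  + by move=> x /mem_rem xO; apply: joint_eigenZ; apply: ef.
  + by move=> x i /mem_rem xO; apply: Ut.
  + by move=> x y /mem_rem xO /mem_rem yO; apply: sep.
  + have -> : \sum_(x <- rem w O) u x *: f x =
      (t v j - t w j)^-1 *: (cherednik a j (\sum_(x <- O) f x) + (- t w j) *: \sum_(x <- O) f x).
      rewrite linear_sum scaler_sumr -big_split scaler_sumr /=.
      rewrite [RHS](perm_big _ (perm_to_rem wO)) big_cons /= ef // -scalerDl subrr scale0r.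
      rewrite scaler0 add0r big_seq [RHS]big_seq; apply: eq_bigr => x /mem_rem xO.
      by rewrite ef // -scalerDl scalerA.
    by apply: VZ => //; apply: VD; [apply: Vch | apply: VZ; [apply: UN; apply: Ut|]].
  + by rewrite mem_rem_uniq // inE vw.
- by move: Vs; rewrite OE big_seq1.
Qed.

End Separation.

Section Adjacent.
Variables (N lo hi : nat).

Definition ivl : {set 'I_N} := [set i : 'I_N | (lo <= i < hi)%N].

(** A long transposition is a shorter one conjugated by an adjacent one, and splitting off the
    transposition of a moved point with its image leaves a permutation that moves fewer points. *)
Lemma adjacent_perm_on (T : Type) (act : 'S_N -> T -> T) (V : T -> Prop) :
  (forall s1 s2 p, act (s1 * s2)%g p = act s2 (act s1 p)) -> (forall p, act 1%g p = p) ->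
  (forall (x y : 'I_N) p, y = x.+1 :> nat -> (lo <= x)%N -> (y < hi)%N -> V p ->
     V (act (tperm x y) p)) ->
  forall s p, perm_on ivl s -> V p -> V (act s p).
Proof.
move=> aM a1 adj.
have tp (x y : 'I_N) : (x < y)%N -> (lo <= x)%N -> (y < hi)%N ->
    forall p, V p -> V (act (tperm x y) p).
  move=> xy lx yh; have [d dE] : {d | (y - x = d.+1)%N} by exists (y - x).-1; lia.
  elim: d y xy yh dE => [|d IH] y xy yh dE p Vp; first by apply: (adj) => //; lia.
  have zN : (y.-1 < N)%N by have := ltn_ord y; lia.
  pose z := Ordinal zN.
  have -> : tperm x y = (tperm z y * tperm x z * tperm z y)%g.
    rewrite -[RHS]mulgA -{1}(tpermV z y) -[LHS]/(_) -conjgE tpermJ.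
    by rewrite tpermL tpermD // -val_eqE /=; lia.
  rewrite !aM; apply: (adj) => /=; try lia.
  by apply: (IH) => /=; try lia; apply: (adj) => //=; lia.
move=> s; have [n] := ubnP #|[set x | s x != x]|; elim: n s => // n IH s sn p son Vp.
have [s1|s1] := eqVneq s 1%g; first by rewrite s1 a1.
have [x sx] : exists x, s x != x.
  apply/existsP; apply: contraNT s1 => /existsPn H; apply/eqP/permP => x.
  by rewrite perm1; apply/eqP; rewrite -[_ == _]negbK.
have xI : x \in ivl by apply: (subsetP son); rewrite inE.
have sxI : s x \in ivl by rewrite perm_closed.
have sE : s = (tperm x (s x) * (tperm x (s x) * s))%g by rewrite mulgA tperm2 mul1g.
have -> : act s p = act (tperm x (s x) * s)%g (act (tperm x (s x)) p) by rewrite -aM -sE.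
apply: IH.
- rewrite ltnS in sn; apply: leq_trans sn; apply: proper_card; apply/properP; split.
    apply/subsetP => y; rewrite !inE permM; case: tpermP => [->|->|//]; rewrite ?eqxx //.
  by exists (s x); rewrite !inE ?(inj_eq perm_inj) // permM tpermR eqxx.
- apply: perm_onM => //; apply/subsetP => y; rewrite inE; case: tpermP => [->|->|] //.
  by rewrite eqxx.
- move: xI sxI; rewrite !inE => /andP[l1 h1] /andP[l2 h2].
  have [lt|lt|E] := ltngtP x (s x); first exact: tp.
    by rewrite tpermC; apply: tp.
  by move/eqP: sx; case; apply: val_inj.
Qed.

End Adjacent.

Section Symmetrizer.
Variables (R : idomainType) (N M : nat).
Implicit Types (p : {mpoly R[N]}) (s : 'S_N).

(** With [aJ], tells which blocks carry a sign, so that the four types are treated at once. *)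
Definition aI (T : symtype) := match T with AS | AA => true | _ => false end.
Definition aJ (T : symtype) := match T with AA | SA => true | _ => false end.
Definition sgnb (b : bool) s : R := (-1) ^+ (b && odd_perm s).

Lemma sgnbM b s1 s2 : sgnb b (s1 * s2)%g = sgnb b s1 * sgnb b s2.
Proof. by rewrite /sgnb; case: b; rewrite /= ?mulr1 // odd_permM signr_addb. Qed.

Lemma sgnb_neq0 b s : sgnb b s != 0. Proof. by rewrite signr_eq0. Qed.

Lemma symE T p : symmetrizer M T p =
  \sum_(s | perm_on (setI_ N M) s) \sum_(t | perm_on (setJ_ N M) t)
     (sgnb (aI T) s * sgnb (aJ T) t) *: msym s (msym t p).
Proof.
have Z b (P : pred 'S_N) (F : 'S_N -> {mpoly R[N]}) :
  \sum_(s | P s) (-1) ^+ (b && odd_perm s) *: F s =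
  if b then \sum_(s | P s) (-1) ^+ odd_perm s *: F s else \sum_(s | P s) F s.
  by case: b => //=; apply: eq_bigr => s _; rewrite scale1r.
transitivity (\sum_(s | perm_on (setI_ N M) s) sgnb (aI T) s *: msym s
   (\sum_(t | perm_on (setJ_ N M) t) sgnb (aJ T) t *: msym t p)).
  by rewrite /sgnb (Z (aJ T)) Z; case: T.
apply: eq_bigr => s _; rewrite (raddf_sum (msym s)) scaler_sumr; apply: eq_bigr => t _ /=.
by rewrite msymZ scalerA.
Qed.

Lemma perm_onV_mem (S : {set 'I_N}) s : perm_on S s -> perm_on S (s^-1)%g.
Proof. exact: perm_onV. Qed.

Lemma sym_I T u p : perm_on (setI_ N M) u ->
  msym u (symmetrizer M T p) = sgnb (aI T) u *: symmetrizer M T p.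
Proof.
move=> uI; rewrite !symE raddf_sum /= scaler_sumr.
rewrite [RHS](reindex_inj (mulIg u)) /=.
apply: eq_big => [s|s sI]; last first.
  rewrite raddf_sum /= scaler_sumr; apply: eq_bigr => t _.
  rewrite msymZ scalerA -msymMm sgnbM; congr (_ *: _).
  have -> : sgnb (aI T) u * (sgnb (aI T) s * sgnb (aI T) u * sgnb (aJ T) t) =
    (sgnb (aI T) u * sgnb (aI T) u) * (sgnb (aI T) s * sgnb (aJ T) t) by ring.
  by rewrite -expr2 sqrr_sign mul1r.
apply/idP/idP => sI; first by apply: perm_onM.
by rewrite -[s](mulgK u); apply: perm_onM => //; apply: perm_onV.
Qed.

Lemma disjIJ : [disjoint (setI_ N M) & (setJ_ N M)].
Proof. by rewrite disjoint_subset; apply/subsetP => i; rewrite !inE; lia. Qed.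

Lemma sym_J T u p : perm_on (setJ_ N M) u ->
  msym u (symmetrizer M T p) = sgnb (aJ T) u *: symmetrizer M T p.
Proof.
move=> uJ; rewrite !symE raddf_sum /= scaler_sumr.
apply: eq_bigr => s sI; rewrite raddf_sum /= scaler_sumr.
rewrite [RHS](reindex_inj (mulIg u)) /=.
apply: eq_big => [t|t tJ]; last first.
  rewrite msymZ scalerA -!msymMm sgnbM; congr (_ *: _).
    have -> : sgnb (aJ T) u * (sgnb (aI T) s * (sgnb (aJ T) t * sgnb (aJ T) u)) =
      (sgnb (aJ T) u * sgnb (aJ T) u) * (sgnb (aI T) s * sgnb (aJ T) t) by ring.
    by rewrite -expr2 sqrr_sign mul1r.
  by rewrite -!mulgA (perm_onC sI uJ disjIJ).
apply/idP/idP => tJ; first by apply: perm_onM.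
by rewrite -[t](mulgK u); apply: perm_onM => //; apply: perm_onV.
Qed.

End Symmetrizer.

(** * Rearrangements within the two blocks *)

Section Orbit.
Variables (N M : nat).
Implicit Types (m k L : 'X_{1..N}) (s : 'S_N).

Definition blkperm s := [forall i : 'I_N, (s i < M)%N == (i < M)%N].

Lemma blkpermP s : reflect (forall i : 'I_N, (s i < M)%N = (i < M)%N) (blkperm s).
Proof. exact: 'forall_eqP. Qed.

(** The indices of the non-symmetric Jack polynomials that enter P_L; both partitions of L are
    constant on it. *)
Definition orb L : seq 'X_{1..N} := undup [seq mact s L | s <- enum 'S_N & blkperm s].

Lemma orbP L m : reflect (exists2 s, blkperm s & m = mact s L) (m \in orb L).
Proof.
rewrite mem_undup; apply: (iffP mapP) => [[s]|[s bs ->]].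
  by rewrite mem_filter => /andP[bs _] ->; exists s.
by exists s => //; rewrite mem_filter bs /= mem_enum.
Qed.

Lemma orb_uniq L : uniq (orb L). Proof. exact: undup_uniq. Qed.

Definition adj_blk (x y : 'I_N) := (y == x.+1 :> nat) && ((x < M)%N == (y < M)%N).

Lemma orb_act L m s : blkperm s -> m \in orb L -> mact s m \in orb L.
Proof.
move=> /blkpermP bs /orbP[u /blkpermP bu ->]; apply/orbP; exists (s * u)%g.
  by apply/blkpermP => i; rewrite permM bu bs.
by apply/mnmP => i; rewrite !mactE permM.
Qed.

Lemma blkperm_adj x y : adj_blk x y -> blkperm (tperm x y).
Proof.
by case/andP => _ /eqP E; apply/blkpermP => i; case: tpermP => [->|->|] //; rewrite E.
Qed.

Lemma orb_perm L x y : adj_blk x y -> perm_eq (map (mact (tperm x y)) (orb L)) (orb L).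
Proof.
move=> adj; apply: uniq_perm; rewrite ?orb_uniq //.
  by rewrite map_inj_uniq ?orb_uniq //; apply: can_inj (@mact_tpermK _ x y).
move=> m; apply/mapP/idP => [[k kO ->]|mO]; first by apply: orb_act kO; apply: blkperm_adj.
by exists (mact (tperm x y) m); rewrite ?mact_tpermK //; apply: orb_act => //; apply: blkperm_adj.
Qed.

Lemma orb_refl L : L \in orb L.
Proof.
apply/orbP; exists 1%g; first by apply/blkpermP => i; rewrite perm1.
by apply/mnmP => i; rewrite mactE perm1.
Qed.

Lemma orb_star L m : m \in orb L -> sp_star m = sp_star L.
Proof.
case/orbP => s _ ->; apply/excess_star => c; rewrite /excess.
by rewrite [RHS](reindex_inj (@perm_inj _ s)); apply: eq_bigr => i _; rewrite mactE.
Qed.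

Lemma orb_circ L m : m \in orb L -> sp_circ M m = sp_circ M L.
Proof.
case/orbP => s /blkpermP bs ->; apply: decr_rearr_eq; apply: excess_perm.
  by rewrite !size_map.
move=> c; have S (h : 'X_{1..N}) :
    \sum_(x <- [seq (h i + (i < M))%N | i <- enum 'I_N]) (x - c)%N =
    \sum_(i < N) (h i + (i < M) - c)%N by rewrite big_map big_enum.
rewrite !S [RHS](reindex_inj (@perm_inj _ s)).
by apply: eq_bigr => i _; rewrite mactE bs.
Qed.

Lemma orb_mdeg L m : m \in orb L -> mdeg m = mdeg L.
Proof. by case/orbP => s _ ->; rewrite mdeg_mact. Qed.

Definition hblk (B : pred 'I_N) m p v := (\sum_(i < N | (i < p)%N && B i) (v <= m i))%N.

Lemma heads_split m p v :
  heads m p v = (hblk (fun i => i < M) m p v + hblk (fun i => M <= i) m p v)%N.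
Proof.
rewrite /heads (bigID (fun i : 'I_N => (i < M)%N)) /=; congr (_ + _)%N.
by apply: eq_bigl => i; rewrite -leqNgt.
Qed.

Lemma hblk_full B m p v : hblk B m N v = (hblk B m p v + \sum_(i < N | (p <= i)%N && B i) (v <= m i))%N.
Proof.
rewrite /hblk (bigID (fun i : 'I_N => (i < p)%N)) /=; congr (_ + _)%N; apply: eq_bigl => i.
  by rewrite ltn_ord /= andbC.
by rewrite ltn_ord /= -leqNgt andbC.
Qed.

Lemma hblk_act B m s v : (forall i, B (s i) = B i) -> hblk B (mact s m) N v = hblk B m N v.
Proof.
move=> bs; rewrite /hblk [RHS](reindex_inj (@perm_inj _ s)) /=.
by apply: eq_big => [i|i _]; rewrite ?mactE // !ltn_ord bs.
Qed.

(** If some entry below v occurs before p, every entry of the block that is at least v does too;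
    otherwise all entries before p count. Either way the count is the largest possible. *)
Lemma hblk_max (B : pred 'I_N) m k p v : (forall i j : 'I_N, B i -> B j -> (i < j)%N -> (m j <= m i)%N) ->
  hblk B m N v = hblk B k N v -> (hblk B k p v <= hblk B m p v)%N.
Proof.
move=> dec E.
have [/existsP[i0 /and3P[ip Bi lt]]|/existsPn H] :=
  boolP [exists i : 'I_N, [&& (i < p)%N, B i & (m i < v)%N]].
  have z : (\sum_(i < N | (p <= i)%N && B i) (v <= m i) = 0)%N.
    rewrite big1 // => i /andP[pi Bi']; have := dec i0 i Bi Bi'; lia.
  by have := hblk_full B m p v; rewrite z E (hblk_full B k p v); lia.
apply: leq_sum => i /andP[ip Bi]; have := H i; rewrite ip Bi /= -leqNgt => ->.
by case: (v <= k i)%N.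
Qed.

Lemma hblk_min (B : pred 'I_N) m k p v : (forall i j : 'I_N, B i -> B j -> (i < j)%N -> (m i <= m j)%N) ->
  hblk B m N v = hblk B k N v -> (hblk B m p v <= hblk B k p v)%N.
Proof.
move=> inc E.
have [/existsP[i0 /and3P[ip Bi le]]|/existsPn H] :=
  boolP [exists i : 'I_N, [&& (i < p)%N, B i & (v <= m i)%N]].
  have : (\sum_(i < N | (p <= i)%N && B i) (v <= k i) <=
          \sum_(i < N | (p <= i)%N && B i) (v <= m i))%N.
    apply: leq_sum => i /andP[pi Bi']; have := inc i0 i Bi Bi'.
    by case: (v <= k i)%N => //; lia.
  by have := hblk_full B m p v; rewrite E (hblk_full B k p v); lia.
rewrite {1}/hblk big1 // => i /andP[ip Bi]; have := H i; rewrite ip Bi /=.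
by case: (v <= m i)%N.
Qed.

Lemma superpartition_leI m (i j : 'I_N) : superpartition M m ->
  (i < M)%N -> (j < M)%N -> (i < j)%N -> (m j <= m i)%N.
Proof.
move=> /andP[/forall_inP d _] iM jM ij.
have iK : i \in setI_ N M by rewrite inE.
have jK : j \in setI_ N M by rewrite inE.
by have /forall_inP/(_ j jK) := d i iK; rewrite ij.
Qed.

Lemma superpartition_leJ m (i j : 'I_N) : superpartition M m ->
  (M <= i)%N -> (M <= j)%N -> (i < j)%N -> (m j <= m i)%N.
Proof.
move=> /andP[_ /forall_inP d] iM jM ij.
have iK : i \in setJ_ N M by rewrite inE.
have jK : j \in setJ_ N M by rewrite inE.
by have /forall_inP/(_ j jK) := d i iK; rewrite ij.
Qed.

Lemma orb_cle_max L m : superpartition M L -> m \in orb L -> cle L m -> m = L.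
Proof.
move=> sL mO [_ _ H].
have /H hle : forall c, excess L c = excess m c by apply/excess_star; rewrite (orb_star mO).
have [s /blkpermP bs mE] := orbP _ _ mO.
apply/esym/heads_inj => p v; apply/eqP; rewrite eqn_leq hle /= !heads_split.
rewrite mE; apply: leq_add; apply: hblk_max.
- by move=> i j; apply: superpartition_leI.
- by rewrite hblk_act.
- by move=> i j; apply: superpartition_leJ.
- by rewrite hblk_act // => i; rewrite (leqNgt M (s i)) (leqNgt M i) bs.
Qed.

Definition incr_blk m := forall i j : 'I_N,
  (i < M)%N = (j < M)%N -> (i < j)%N -> (m i <= m j)%N.

Lemma orb_cle_min L m e : incr_blk e -> e \in orb L -> m \in orb L -> cle m e -> m = e.
Proof.
move=> inc /orbP[s1 /blkpermP b1 eE] /orbP[s2 /blkpermP b2 mE] [_ _ H].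
have st : sp_star m = sp_star e.
  rewrite (@orb_star L) ?(@orb_star L e) //; apply/orbP; [exists s1|exists s2] => //;
  exact/blkpermP.
have /H hle : forall c, excess m c = excess e c by apply/excess_star.
have hb (B : pred 'I_N) v : (forall s : 'S_N, blkperm s -> forall i, B (s i) = B i) ->
    hblk B e N v = hblk B m N v.
  by move=> Bs; rewrite eE mE !hblk_act //; apply: Bs; apply/blkpermP.
apply/heads_inj => p v; apply/eqP; rewrite eqn_leq hle /= !heads_split.
apply: leq_add; apply: hblk_min.
- by move=> i j Bi Bj; apply: inc; rewrite Bi Bj.
- by apply: hb => s /blkpermP bs i; rewrite bs.
- by move=> i j Bi Bj; apply: inc; rewrite !ltnNge Bi Bj.
- by apply: hb => s /blkpermP bs i; rewrite (leqNgt M (s i)) (leqNgt M i) bs.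
Qed.

End Orbit.

(** * Expansion in non-symmetric Jack polynomials *)

Section Decomposition.
Variables (K : fieldType) (a : K) (n : nat).
Hypothesis gen : forall x y n1 n2 : nat,
  a *+ x + n1%:R = a *+ y + n2%:R -> x = y /\ n1 = n2.
Local Notation N := n.+1.
Implicit Types (v L e : 'X_{1..N}) (p f : {mpoly K[N]}).
Variable E : 'X_{1..N} -> {mpoly K[N]}.
Hypothesis EJ : forall v, joint_eigen a (bar a v) (E v).
Hypothesis E1 : forall v, (E v)@_v = 1.

Lemma gen_natr_neq0 d : (0 < d)%N -> d%:R != 0 :> K.
Proof.
move=> d0; apply/eqP => dE.
by have [] := @gen 0 0 d 0; rewrite ?mulr0n ?add0r //; lia.
Qed.

Lemma E_uniq v p : joint_eigen a (bar a v) p -> p = p@_v *: E v.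
Proof.
move=> ep; apply/eqP; rewrite -subr_eq0; apply/eqP/(gen_eq0 gen (h := v)).
  by rewrite -scaleNr; apply: joint_eigenD => //; apply: joint_eigenZ.
by rewrite mcoeffB mcoeffZ E1 mulr1 subrr.
Qed.

Lemma E_nsData v : nsData a v (E v).
Proof. by split => //; rewrite (joint_ev1 gen (EJ v)) E1 mul1r. Qed.

Definition cc (x y : 'I_N) v : K := (bar a v y - bar a v x)^-1.

Lemma E_up (x y : 'I_N) v : y = x.+1 :> nat -> (v x < v y)%N ->
  E (mact (tperm x y) v) = msym (tperm x y) (E v) + cc x y v *: E v.
Proof.
move=> xy lt; have [ej c1 _] := nsData_simple gen xy lt (E_nsData v).
by rewrite [RHS](E_uniq ej) c1 scale1r.
Qed.

Lemma cc_act (x y : 'I_N) v : y = x.+1 :> nat -> v x != v y ->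
  cc x y (mact (tperm x y) v) = - cc x y v.
Proof. move=> xy ne; rewrite /cc (bar_simple a y xy ne) (bar_simple a x xy ne) tpermL tpermR.
by rewrite -[X in X^-1]opprB invrN. Qed.

Lemma rkn_tie (x y : 'I_N) v : y = x.+1 :> nat -> v x = v y -> rkn v y = (rkn v x).+1.
Proof.
move=> xy vE; rewrite !rknE.
have -> : [set i | before v i y] = x |: [set i | before v i x].
  apply/setP => i; rewrite !inE /before; have [->|ix] := eqVneq i x.
    by rewrite vE ltnn eqxx xy ltnSn.
  by move: ix; rewrite -val_eqE /=; lia.
by rewrite cardsU1 inE before_irr.
Qed.

Definition simple_coef (x y : 'I_N) v : K := if (v x < v y)%N then 1 else 1 - cc x y v ^+ 2.

(** An ascent is the intertwiner. A descent is its inverse, whence the factor 1 - [cc]^2. At a tie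
    [cc] is -1 and E_v is invariant under the swap. *)
Lemma E_simple (x y : 'I_N) v : y = x.+1 :> nat ->
  msym (tperm x y) (E v) = simple_coef x y v *: E (mact (tperm x y) v) - cc x y v *: E v.
Proof.
move=> xy; rewrite /simple_coef; have [lt|lt|vE] := ltngtP (v x) (v y).
- by rewrite scale1r E_up // addrK.
- set w := mact (tperm x y) v; have wlt : (w x < w y)%N by rewrite !mactE tpermL tpermR.
  have vw : v = mact (tperm x y) w by rewrite mact_tpermK.
  have := E_up xy wlt; rewrite -vw => Ev.
  have cE : cc x y w = - cc x y v by rewrite cc_act // neq_ltn lt orbT.
  rewrite {1}Ev msymD msymZ msym_tpermK.
  have -> : msym (tperm x y) (E w) = E v - cc x y w *: E w by rewrite Ev addrK.
  rewrite cE scalerBr scalerBl scale1r !scaleNr scalerN opprK scalerA -expr2.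
  by rewrite addrA addrAC -addrA -scaleNr; congr (_ + _); rewrite scaleNr addrC.
have -> : mact (tperm x y) v = v.
  by apply/mnmP => i; rewrite mactE; case: tpermP => [->|->|].
have cE : cc x y v = -1.
  rewrite /cc !barE vE (rkn_tie xy vE) -natr1.
  have -> : a *+ v y - ((rkn v x)%:R + 1) - (a *+ v y - (rkn v x)%:R) = -1 by ring.
  by rewrite invrN1.
rewrite cE sqrrN expr1n subrr scale0r add0r scaleN1r opprK.
have nb : bar a v y != bar a v x.
  by rewrite -subr_eq0 -invr_eq0 -/(cc x y v) cE oppr_eq0 oner_eq0.
(* If [K E_v - E_v] were nonzero, it would have the eigenvalues of v with those of x and y
   exchanged; a top monomial would then equal v and yet rank x differently. *)
have := joint_simple xy (EJ v) nb; rewrite -/(cc x y v) cE scaleN1r => ej.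
apply/eqP; rewrite -subr_eq0 -msupp_eq0; case mE : (msupp _) => [//|m s].
have mp : m \in msupp (msym (tperm x y) (E v) - E v) by rewrite mE inE eqxx.
have [k [_ _ kE]] := joint_eigen_top ej mp.
have kv j : k j = v j /\ rkn k j = rkn v (tperm x y j).
  have := kE j; rewrite !barE => H.
  have [] := @gen (v (tperm x y j)) (k j) (rkn k j) (rkn v (tperm x y j)).
    by rewrite -[a *+ _](subrK (rkn v (tperm x y j))%:R) H; ring.
  by move=> <- ->; split => //; case: tpermP => [->|->|].
have kE' : k = v by apply/mnmP => j; case: (kv j).
by have [_] := kv x; rewrite kE' tpermL (rkn_tie xy vE); lia.
Qed.

Variables (M : nat) (L : 'X_{1..N}).
Local Notation O := (orb M L).

Definition orb_span f := exists q : 'X_{1..N} -> K, f = \sum_(v <- O) q v *: E v.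

Lemma spanD f g : orb_span f -> orb_span g -> orb_span (f + g).
Proof.
move=> [q ->] [r ->]; exists (fun v => q v + r v).
by rewrite -big_split /=; apply: eq_bigr => v _; rewrite scalerDl.
Qed.

Lemma spanZ c f : orb_span f -> orb_span (c *: f).
Proof.
move=> [q ->]; exists (fun v => c * q v).
by rewrite scaler_sumr; apply: eq_bigr => v _; rewrite scalerA.
Qed.

Lemma span0 : orb_span 0.
Proof. by exists (fun=> 0); rewrite big1 // => v _; rewrite scale0r. Qed.

Lemma span_sum (I : finType) (P : pred I) F : (forall i, P i -> orb_span (F i)) -> orb_span (\sum_(i | P i) F i).
Proof.
by move=> H; elim/big_ind: _ => //; [exact: span0 | exact: spanD].
Qed.

Lemma msym_span x y (q : 'X_{1..N} -> K) : adj_blk M x y ->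
  msym (tperm x y) (\sum_(v <- O) q v *: E v) =
  \sum_(v <- O) (q (mact (tperm x y) v) * simple_coef x y (mact (tperm x y) v) - cc x y v * q v) *: E v.
Proof.
move=> adj; have xy : y = x.+1 :> nat by case/andP: adj => /eqP.
rewrite (raddf_sum (msym (tperm x y))) /=.
under eq_bigr => v _ do rewrite msymZ E_simple // scalerBr !scalerA.
rewrite sumrB; under [RHS]eq_bigr => v _ do rewrite scalerBl.
rewrite sumrB; congr (_ - _); last by apply: eq_bigr => v _; rewrite mulrC.
rewrite -(perm_big _ (orb_perm L adj)) big_map /=.
by apply: eq_bigr => v _; rewrite mact_tpermK.
Qed.

Lemma span_adj x y f : adj_blk M x y -> orb_span f -> orb_span (msym (tperm x y) f).
Proof. by move=> adj [q ->]; rewrite msym_span //; eexists. Qed.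

Lemma span_I s f : perm_on (setI_ N M) s -> orb_span f -> orb_span (msym s f).
Proof.
have -> : setI_ N M = ivl N 0 M by apply/setP => i; rewrite !inE.
apply: (adjacent_perm_on (act := fun s f => msym s f)).
- by move=> s1 s2 p; rewrite msymMm.
- by move=> p; rewrite msym1m.
- by move=> x y p xy _ yM; apply: span_adj; rewrite /adj_blk xy eqxx -xy yM; lia.
Qed.

Lemma span_J s f : perm_on (setJ_ N M) s -> orb_span f -> orb_span (msym s f).
Proof.
have -> : setJ_ N M = ivl N M N by apply/setP => i; rewrite !inE ltn_ord andbT.
apply: (adjacent_perm_on (act := fun s f => msym s f)).
- by move=> s1 s2 p; rewrite msymMm.
- by move=> p; rewrite msym1m.
- by move=> x y p xy Mx _; apply: span_adj; rewrite /adj_blk xy eqxx; lia.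
Qed.

Lemma span_E e : e \in O -> orb_span (E e).
Proof.
move=> eO; exists (fun v => (v == e)%:R).
rewrite (bigD1_seq e) ?orb_uniq //= eqxx scale1r big1 ?addr0 // => v /negPf->.
by rewrite scale0r.
Qed.

Lemma span_sym T f : orb_span f -> orb_span (symmetrizer M T f).
Proof.
move=> sf; rewrite symE; apply: span_sum => s sI; apply: span_sum => t tJ.
by apply: spanZ; apply: span_I => //; apply: span_J.
Qed.

Lemma span_inj (q r : 'X_{1..N} -> K) :
  \sum_(v <- O) q v *: E v = \sum_(v <- O) r v *: E v -> {in O, q =1 r}.
Proof.
move=> H v vO; apply/eqP; rewrite -subr_eq0; apply/eqP.
have H0 : \sum_(v <- O) (q v - r v) *: E v = 0.
  by under eq_bigr => w _ do rewrite scalerBl; rewrite sumrB H subrr.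
have := @separation K a N (fun p => p = 0) (fun=> True) _ _ _ _ _ O
  (fun w => (q w - r w) *: E w) (bar a).
have Z : (q v - r v) *: E v = 0 -> q v - r v = 0.
  by move=> Z; have := congr1 (mcoeff v) Z; rewrite mcoeffZ E1 mulr1 mcoeff0.
move=> sep; apply: Z; apply: sep => //.
- by move=> p0 q0 -> ->; rewrite addr0.
- by move=> c p0 _ ->; rewrite scaler0.
- by move=> j p0 ->; rewrite linear0.
- exact: orb_uniq.
- by move=> w _; apply: joint_eigenZ.
- move=> w w' _ _ ww; apply: boolp.contrapT => nex; move/eqP: ww; apply.
  apply: (bar_inj gen) => j; apply/eqP; apply: boolp.contrapT => /negP ne.
  by apply: nex; exists j.
Qed.

(** Obtained by comparing the coefficients of E at the swapped index. Sorting v step by step, it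
    expresses every coefficient through that of L. *)
Lemma span_recursion (q : 'X_{1..N} -> K) eps x y v :
  msym (tperm x y) (\sum_(v <- O) q v *: E v) = eps *: \sum_(v <- O) q v *: E v ->
  adj_blk M x y -> v \in O -> (v x < v y)%N ->
  q v = (eps - cc x y v) * q (mact (tperm x y) v).
Proof.
move=> sQ adj vO lt; have xy : y = x.+1 :> nat by case/andP: adj => /eqP.
move: sQ; rewrite msym_span // scaler_sumr.
under [RHS]eq_bigr => w _ do rewrite scalerA.
move/span_inj/(_ (mact (tperm x y) v)); rewrite orb_act ?blkperm_adj // => /(_ isT).
rewrite mact_tpermK cc_act ?neq_ltn ?lt // /simple_coef lt mulr1 => H.
by rewrite mulrBl -H; ring.
Qed.

Lemma span_top (q : 'X_{1..N} -> K) : superpartition M L ->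
  (\sum_(v <- O) q v *: E v)@_L = q L.
Proof.
move=> sL; rewrite raddf_sum /= (bigD1_seq L) ?orb_uniq ?orb_refl //=.
rewrite mcoeffZ E1 mulr1 big_seq_cond big1 ?addr0 // => v /andP[vO vL].
rewrite mcoeffZ (_ : (E v)@_L = 0) ?mulr0 //; apply: memN_msupp_eq0.
apply: contraNN vL => /(gen_supp gen (EJ v))[Lv _].
exact/eqP/(orb_cle_max sL vO Lv).
Qed.

(** As e is minimal in the orbit, a permuted copy of E_e contains x^L only through its leading term.
    All pairs of permutations for which this happens carry the same sign, so a positive integer
    survives up to sign. *)
Lemma sym_coef_neq0 T e (s0 t0 : 'S_N) : incr_blk M e ->
  perm_on (setI_ N M) s0 -> perm_on (setJ_ N M) t0 -> e = mact t0 (mact s0 L) ->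
  (aI T -> {in setI_ N M &, injective L}) -> (aJ T -> {in setJ_ N M &, injective L}) ->
  (symmetrizer M T (E e))@_L != 0.
Proof.
move=> inc s0I t0J eE injI injJ.
have blkI s : perm_on (setI_ N M) s -> forall i : 'I_N, (s i < M)%N = (i < M)%N.
  by move=> sI i; have := perm_closed i sI; rewrite !inE.
have blkJ s : perm_on (setJ_ N M) s -> forall i : 'I_N, (s i < M)%N = (i < M)%N.
  by move=> sJ i; have := perm_closed i sJ; rewrite !inE !ltnNge => ->.
have blk s t : perm_on (setI_ N M) s -> perm_on (setJ_ N M) t -> mact t (mact s L) \in O.
  move=> sI tJ; apply/orbP; exists (t * s)%g.
    by apply/blkpermP => i; rewrite permM blkI // blkJ.
  by apply/mnmP => i; rewrite !mactE permM.
have eO : e \in O by rewrite eE; apply: blk.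
rewrite symE raddf_sum /=.
under eq_bigr => s sI.
  rewrite raddf_sum /=; under eq_bigr => t tJ.
    have -> : ((sgnb K (aI T) s * sgnb K (aJ T) t) *: msym s (msym t (E e)))@_L =
      sgnb K (aI T) s0 * sgnb K (aJ T) t0 * (mact t (mact s L) == e)%:R.
      rewrite mcoeffZ !mcoeff_mact.
      have [me|me] := eqVneq (mact t (mact s L)) e; last first.
        rewrite mulr0 (_ : (E e)@_ _ = 0) ?mulr0 //; apply: memN_msupp_eq0.
        apply: contraNN me => /(gen_supp gen (EJ e))[le _]; apply/eqP.
        by apply: (orb_cle_min inc eO) le; apply: blk.
      rewrite me E1 (_ : true%:R = 1) // !mulr1; congr (_ * _); rewrite /sgnb.
        case aT : (aI T) => //=; have inj := injI aT; congr (_ ^+ odd_perm _).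
        apply/permP => i; have [iI|iI] := boolP (i \in setI_ N M); last first.
          by rewrite (out_perm sI iI) (out_perm s0I iI).
        have iJ : i \notin setJ_ N M by move: iI; rewrite !inE -ltnNge.
        apply: inj; rewrite ?perm_closed //.
        have := congr1 (fun h : 'X_{1..N} => h i) (etrans me eE).
        by rewrite !mactE (out_perm tJ iJ) (out_perm t0J iJ).
      case aT : (aJ T) => //=; have inj := injJ aT; congr (_ ^+ odd_perm _).
      apply/permP => i; have [iJ|iJ] := boolP (i \in setJ_ N M); last first.
        by rewrite (out_perm tJ iJ) (out_perm t0J iJ).
      apply: inj; rewrite ?perm_closed //.
      have := congr1 (fun h : 'X_{1..N} => h i) (etrans me eE).
      have tI : t i \notin setI_ N M by rewrite !inE blkJ // -leqNgt; move: iJ; rewrite inE.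
      have t0I : t0 i \notin setI_ N M by rewrite !inE blkJ // -leqNgt; move: iJ; rewrite inE.
      by rewrite !mactE (out_perm sI tI) (out_perm s0I t0I).
    over.
  rewrite -mulr_sumr -natr_sum; over.
rewrite -mulr_sumr -natr_sum mulf_neq0 ?mulf_neq0 ?sgnb_neq0 //.
apply: gen_natr_neq0; rewrite (bigD1 s0) //= (bigD1 t0) //= -eE eqxx.
by [].
Qed.

Lemma sym_adj T x y f : adj_blk M x y ->
  msym (tperm x y) (symmetrizer M T f) =
  (-1) ^+ (if (x < M)%N then aI T else aJ T) *: symmetrizer M T f.
Proof.
case/andP => /eqP xy /eqP blk.
have nxy : x != y by rewrite -val_eqE /=; lia.
have tp (S : {set 'I_N}) : x \in S -> y \in S -> perm_on S (tperm x y).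
  move=> xS yS; apply/subsetP => i; rewrite inE; case: tpermP => [->|->|] //.
  by rewrite eqxx.
have [xM|xM] := boolP (x < M)%N.
  rewrite sym_I; last by apply: tp; rewrite inE -?blk xM.
  by rewrite /sgnb odd_tperm nxy andbT.
rewrite sym_J; last by apply: tp; rewrite inE leqNgt -?blk xM.
by rewrite /sgnb odd_tperm nxy andbT.
Qed.

Lemma bar_polyC v j : (bar a v j)%:P = bar a%:P v j.
Proof. by rewrite !barE rmorphB rmorphMn rmorph_nat. Qed.

Lemma span_eigen f : orb_span f -> sekiguchi_eigen a M L f.
Proof.
move=> [q ->]; rewrite /sekiguchi_eigen /=.
have mE : map_mpoly polyC (\sum_(v <- O) q v *: E v) =
   \sum_(v <- O) (q v)%:P *: map_mpoly polyC (E v).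
  by rewrite (raddf_sum (map_mpoly polyC)) /=; apply: eq_bigr => v _; rewrite map_mpolyZ.
have ej v : joint_eigen a%:P (bar a%:P v) (map_mpoly polyC (E v)).
  by move=> j; rewrite -map_cherednik /= EJ map_mpolyZ /= bar_polyC.
rewrite mE sek_starE sek_circE !linear_sum /=; split.
  rewrite big_seq [RHS]big_seq; apply: eq_bigr => v vO.
  rewrite -(orb_star vO) (sek_joint _ (joint_eigenZ _ (ej v))) -eps_star.
  by [].
rewrite big_seq [RHS]big_seq; apply: eq_bigr => v vO.
by rewrite -(orb_circ vO) (sek_joint _ (joint_eigenZ _ (ej v))) -eps_circ.
Qed.

End Decomposition.

(** * Restriction to a block of variables *)

Section Extract.
Variables (R : idomainType) (N A N' : nat).
Hypothesis AN : (A + N' <= N)%N.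
Implicit Types (f : {mpoly R[N]}) (m : 'X_{1..N}) (b : 'X_{1..N'}) (i l : 'I_N).

Lemma emb_subproof (i : 'I_N') : (A + i < N)%N.
Proof. by have := ltn_ord i; lia. Qed.

Definition emb (i : 'I_N') : 'I_N := Ordinal (emb_subproof i).
Definition inblk i := (A <= i < A + N')%N.

Variable v : 'X_{1..N}.

Definition glue b : 'X_{1..N} :=
  [multinom (if insub (i - A)%N is Some i' then if inblk i then b i' else v i else v i) | i < N].
Definition restr m : 'X_{1..N'} := [multinom m (emb i) | i < N'].

Lemma glue_emb b j : glue b (emb j) = b j.
Proof.
rewrite mnmE /inblk /=; case: insubP => [u _ uE|]; last by rewrite addnC addnK ltn_ord.
have -> : (A <= A + j < A + N')%N by have := ltn_ord j; lia.
by congr (b _); apply/val_inj; rewrite uE addnC addnK.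
Qed.

Lemma glue_out b i : ~~ inblk i -> glue b i = v i.
Proof. by move=> /negPf ib; rewrite mnmE ib; case: insubP. Qed.

Lemma restrE m j : restr m j = m (emb j). Proof. by rewrite mnmE. Qed.

Lemma restr_glue b : restr (glue b) = b.
Proof. by apply/mnmP => j; rewrite restrE glue_emb. Qed.

Lemma inblkP i : reflect (exists j, i = emb j) (inblk i).
Proof.
apply: (iffP idP) => [ib|[j ->]]; last by rewrite /inblk /=; have := ltn_ord j; lia.
have jN : (i - A < N')%N by move: ib; rewrite /inblk; lia.
by exists (Ordinal jN); apply/val_inj => /=; move: ib; rewrite /inblk; lia.
Qed.

Lemma emb_inj : injective emb.
Proof. by move=> i j /(congr1 val) /= /addnI; apply: val_inj. Qed.

Lemma glue_eqP m b : (forall i, ~~ inblk i -> m i = v i) -> restr m = b -> m = glue b.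
Proof.
move=> out rm; apply/mnmP => i; have [/inblkP[j ->]|ib] := boolP (inblk i).
  by rewrite glue_emb -rm restrE.
by rewrite glue_out // out.
Qed.

(** The coefficient in f of the monomial of v in the variables outside the block, as a polynomial in
    the variables of the block. *)
Definition ext f : {mpoly R[N']} :=
  \sum_(m <- msupp f | m == glue (restr m)) f@_m *: 'X_[restr m].

Lemma coef_ext f b : (ext f)@_b = f@_(glue b).
Proof.
rewrite /ext raddf_sum /=.
have [gf|gf] := boolP (glue b \in msupp f); last first.
  rewrite (memN_msupp_eq0 gf) big_seq_cond big1 // => m /andP[mf /eqP mE].
  rewrite mcoeffZ mcoeffX; case: eqP => [rb|_]; last by rewrite mulr0.
  by move: gf; rewrite -rb -mE mf.
rewrite big_mkcond (bigD1_seq (glue b)) ?msupp_uniq //=.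
rewrite restr_glue eqxx mcoeffZ mcoeffX eqxx mulr1 big1 ?addr0 // => m mb.
case: ifP => // /eqP mE; rewrite mcoeffZ mcoeffX; case: eqP => [rb|_]; last by rewrite mulr0.
by move: mb; rewrite mE rb eqxx.
Qed.

(** With c a threshold between the first B entries of v and the others, the right side is the excess
    of v over c plus B c, which bounds the corresponding quantity for m. *)
Lemma sum_set_le m (S : {set 'I_N}) c B : cle m v -> #|S| = B ->
  (forall i, (i < B)%N -> (c <= v i)%N) -> (forall i, (B <= i)%N -> (v i <= c)%N) ->
  (B <= N)%N -> (\sum_(i in S) m i <= \sum_(i < N | (i < B)%N) v i)%N.
Proof.
move=> [_ ex _] cS hi lo BN.
have -> : (\sum_(i < N | (i < B)%N) v i = excess v c + B * c)%N.
  rewrite /excess [X in _ = (X + _)%N](bigID (fun i : 'I_N => (i < B)%N)) /=.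
  rewrite [X in (_ + X + _)%N]big1; last by move=> i; rewrite -leqNgt => /lo; lia.
  have -> : (B * c = \sum_(i < N | (i < B)%N) c)%N.
    by rewrite -(big_ord_widen _ (fun=> c)) // sum_nat_const card_ord.
  by rewrite addn0 -big_split; apply: eq_bigr => i /hi; rewrite /=; lia.
apply: leq_trans (_ : \sum_(i in S) ((m i - c) + c) <= _)%N.
  by apply: leq_sum => i _; lia.
rewrite big_split sum_nat_const cS leq_add2r; apply: leq_trans (ex c).
by rewrite /excess [X in (_ <= X)%N](bigID (mem S)) leq_addr.
Qed.

Lemma sum_upd m (P : pred 'I_N) (F : 'I_N -> nat) j (x : nat) : P j ->
  (forall i, P i -> i != j -> m i = F i) ->
  (\sum_(i < N | P i) m i + F j = \sum_(i < N | P i) F i + m j)%N.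
Proof.
move=> Pj E; rewrite (bigD1 j) //= [X in _ = (X + _)%N](bigD1 j) //=.
rewrite (eq_bigr F); last by move=> i /andP[Pi ij]; apply: E.
lia.
Qed.

(** Thresholds expressing that v is sorted by groups: no entry left of the block is smaller than a
    later one, and no entry right of it is larger than an earlier one. *)
Variables ctop cbot : nat.
Hypotheses (hi1 : forall i, (i < A)%N -> (ctop <= v i)%N)
  (lo1 : forall i, (A <= i)%N -> (v i <= ctop)%N)
  (hi2 : forall i, (i < A + N')%N -> (cbot <= v i)%N)
  (lo2 : forall i, (A + N' <= i)%N -> (v i <= cbot)%N).

Lemma card_ltn B : (B <= N)%N -> #|[set i : 'I_N | (i < B)%N]| = B.
Proof.
move=> BN; rewrite -sum1_card (eq_bigl (fun i : 'I_N => (i < B)%N)); last by move=> i; rewrite inE.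
by rewrite -(big_ord_widen _ (fun=> 1%N)) // sum_nat_const card_ord muln1.
Qed.

Lemma card_swap (B : nat) (i j : 'I_N) : (B <= N)%N -> (i < B)%N -> (B <= j)%N ->
  #|j |: [set l : 'I_N | (l < B)%N] :\ i| = B.
Proof.
move=> BN iB Bj; rewrite cardsU1 !inE ltnNge Bj andbF /=.
by have := cardsD1 i [set l : 'I_N | (l < B)%N]; rewrite card_ltn // inE iB.
Qed.

(* A variable of the top or of the bottom part cannot interact with the block:
   it would create a monomial above v in dominance order. *)
Lemma swap_bound m (B : nat) c (i j : 'I_N) (k : 'X_{1..N}) : cle m v ->
  (forall i, (i < B)%N -> (c <= v i)%N) -> (forall i, (B <= i)%N -> (v i <= c)%N) ->
  (B <= N)%N -> (i < B)%N -> (B <= j)%N ->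
  (forall l, l != i -> l != j -> k l = m l) -> (k i + k j = m i + m j)%N ->
  (\sum_(l < N | (l < B)%N) k l = \sum_(l < N | (l < B)%N) v l)%N ->
  (m i <= k i)%N && (m j <= k i)%N.
Proof.
move=> mv hi lo BN iB Bj kE ksum kv.
have S1 := sum_set_le mv (card_ltn BN) hi lo BN.
have S2 := sum_set_le mv (card_swap BN iB Bj) hi lo BN.
have E1 : (\sum_(l in [set i : 'I_N | (i < B)%N]) m l = \sum_(l < N | (l < B)%N) m l)%N.
  by apply: eq_bigl => l; rewrite inE.
have E3 : (\sum_(l < N | (l < B)%N) m l + k i = \sum_(l < N | (l < B)%N) k l + m i)%N.
  apply: sum_upd => // l lB li; rewrite kE //; apply: contraTneq lB => ->; rewrite -leqNgt //.
have E2 : (\sum_(l in j |: [set l : 'I_N | (l < B)%N] :\ i) m l + m i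
           = \sum_(l < N | (l < B)%N) m l + m j)%N.
  rewrite big_setU1 /=; last by rewrite !inE ltnNge Bj andbF.
  rewrite [X in _ = (X + _)%N](bigD1 i) //=.
  rewrite (eq_bigl (fun l : 'I_N => (l < B)%N && (l != i))); last first.
    by move=> l; rewrite !inE andbC.
  by rewrite addnAC [RHS]addnAC (addnC (m j)).
rewrite E1 in S1; move: S1 S2 E2 E3; rewrite kv.
move: (\sum_(l < N | (l < B)%N) m l)%N (\sum_(l < N | (l < B)%N) v l)%N => a1 a2.
by move: (\sum_(l in _) m l)%N => a3; lia.
Qed.

Lemma glue_sum b B : (B <= A)%N || (A + N' <= B)%N -> mdeg (glue b) = mdeg v ->
  (\sum_(l < N | (l < B)%N) glue b l = \sum_(l < N | (l < B)%N) v l)%N.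
Proof.
case/orP => [BA|AB] dE.
  by apply: eq_bigr => l lB; rewrite glue_out // /inblk; lia.
have : (\sum_(l < N) glue b l = \sum_(l < N) v l)%N by rewrite -!mdegE.
rewrite (bigID (fun l : 'I_N => (l < B)%N)) /= [X in _ = X -> _](bigID (fun l : 'I_N => (l < B)%N)) /=.
rewrite [X in (_ + X)%N = _](eq_bigr (fun l => v l)); last first.
  by move=> l lB; rewrite glue_out // /inblk; lia.
by move/addIn.
Qed.

(** Quotients with a variable outside the block do not reach a glued monomial. The A variables to
    the left survive only in the shift of the operator, which is larger by A than that of the
    operator in the block variables. *)
Lemma coef_block (a : R) j m b : cle m v ->
  (cherednik a (emb j) 'X_[m])@_(glue b) =
  if m == glue (restr m) then
    (cherednik a j 'X_[restr m])@_b - (restr m == b)%:R * A%:R else 0.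
Proof.
move=> mv; have [dE|dE] := eqVneq (mdeg (glue b)) (mdeg v); last first.
  have -> : (cherednik a (emb j) 'X_[m])@_(glue b) = 0.
    apply/eqP; apply: contraNT dE => /coef_cherednik_cle[d _ _].
    by rewrite d; case: mv => ->.
  case: eqP => // mE.
  have db : mdeg b != mdeg (restr m).
    apply: contraNneq dE => db; case: mv => <- _ _; rewrite mE !mdegE.
    apply/eqP; rewrite (bigID inblk) /= [RHS](bigID inblk) /=.
    have sb (c : 'X_{1..N'}) : (\sum_(i < N | inblk i) glue c i = mdeg c)%N.
      rewrite mdegE (reindex_onto emb (fun i => insubd j (i - A)%N)) /=; last first.
        move=> i /inblkP[i' ->]; congr emb; apply/val_inj.
        by rewrite val_insubd /= addKn ltn_ord.
      apply: eq_big => [i|i _]; last by rewrite glue_emb.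
      have -> : inblk (emb i) by apply/inblkP; exists i.
      by apply/eqP/val_inj; rewrite val_insubd /= addKn ltn_ord.
    rewrite !sb db; congr (_ + _)%N; apply: eq_bigr => i ib; by rewrite !glue_out.
  have -> : (cherednik a j 'X_[restr m])@_b = 0.
    by apply/eqP; apply: contraNT db => /coef_cherednik_cle[-> _ _].
  rewrite (_ : restr m == b = false) ?mul0r ?subr0 //.
  by apply: contraNF db => /eqP->.
rewrite coef_cherednikX.
have off i : ~~ inblk i -> agree i (emb j) m (glue b) ->
   ((i < emb j)%N -> ((m i < glue b (emb j) <= m (emb j))%N ||
                      (m (emb j) < glue b (emb j) <= m i)%N) = false) /\
   ((emb j < i)%N -> ((m i <= glue b (emb j) < m (emb j))%N ||
                      (m (emb j) <= glue b (emb j) < m i)%N) = false).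
  move=> ib ag; have jl := ltn_ord j.
  have offE l : l != i -> l != emb j -> glue b l = m l by apply: agree_off ag.
  have sE : (glue b i + glue b (emb j) = m i + m (emb j))%N by case/andP: ag => _ /eqP.
  split=> lt.
    have iA : (i < A)%N by move: ib lt; rewrite /inblk /=; lia.
    have := @swap_bound m A ctop i (emb j) (glue b) mv hi1 lo1 _ iA _ offE sE _.
    move/(_ ltac:(lia) ltac:(rewrite /=; lia) (@glue_sum b A _ dE)).
    by rewrite leqnn => /(_ isT); lia.
  have iA : (A + N' <= i)%N by move: ib lt; rewrite /inblk /=; lia.
  have offE' l : l != emb j -> l != i -> glue b l = m l by move=> h1 h2; apply: offE.
  have sE' : (glue b (emb j) + glue b i = m (emb j) + m i)%N by lia.
  have := @swap_bound m (A + N') cbot (emb j) i (glue b) mv hi2 lo2 AN _ iA offE' sE' _.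
  move/(_ ltac:(rewrite /=; lia) (@glue_sum b (A + N') _ dE)).
  by rewrite leqnn orbT => /(_ isT); lia.
have blkE (P : pred 'I_N) (G : 'I_N -> R) : (forall i, P i -> ~~ inblk i -> G i = 0) ->
    \sum_(i < N | P i) G i = \sum_(i < N' | P (emb i)) G (emb i).
  move=> Z; rewrite (bigID inblk) /= [X in _ + X]big1 ?addr0; last first.
    by move=> i /andP[]; apply: Z.
  rewrite (reindex_onto emb (fun i => insubd j (i - A)%N)) /=; last first.
    move=> i /andP[_ /inblkP[i' ->]]; congr emb; apply/val_inj.
    by rewrite val_insubd /= addKn ltn_ord.
  apply: eq_bigl => i; have -> : inblk (emb i) by apply/inblkP; exists i.
  rewrite andbT; have -> : (insubd j (A + i - A)%N == i).
    by apply/eqP/val_inj; rewrite val_insubd /= addKn ltn_ord.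
  by rewrite andbT.
rewrite (blkE (fun i => (i < emb j)%N)); last first.
  move=> i lt ib; have := off i ib; case: (agree _ _ _ _) => [/(_ isT)[/(_ lt) + _]|_ /=].
    by move/norP=> [/negPf-> /negPf->]; rewrite subr0.
  by rewrite subr0.
rewrite (blkE (fun i => (emb j < i)%N)); last first.
  move=> i lt ib; have := off i ib; case: (agree _ _ _ _) => [/(_ isT)[_ /(_ lt) +]|_ /=].
    by move/norP=> [/negPf-> /negPf->]; rewrite subr0.
  by rewrite subr0.
have agE (i : 'I_N') : i != j -> agree (emb i) (emb j) m (glue b) =
    (m == glue (restr m)) && agree i j (restr m) b.
  move=> ij; apply/idP/andP => [ag|[/eqP mE /andP[/eqP bE sE]]].
    have offE l : l != emb i -> l != emb j -> glue b l = m l by apply: agree_off ag.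
    split.
      apply/eqP; apply: glue_eqP => // l lb; rewrite -offE ?glue_out //;
        apply: contraNneq lb => ->; apply/inblkP; [by exists i | by exists j].
    case/andP: ag => _ sE; apply/andP; split; last by move: sE; rewrite !glue_emb !restrE.
    apply/eqP/mnmP => l; rewrite mupdE restrE.
    case: eqP => [->//|/eqP li]; case: eqP => [->//|/eqP lj].
    by rewrite -offE ?glue_emb // (inj_eq emb_inj).
  apply/andP; split; last by rewrite mE !glue_emb.
  apply/eqP/mnmP => l; rewrite mupdE.
  case: eqP => [->//|/eqP li]; case: eqP => [->//|/eqP lj].
  have [/inblkP[h lE]|lb] := boolP (inblk l); last by rewrite mE !glue_out.
  rewrite lE glue_emb bE mupdE restrE.
  by move: li lj; rewrite lE !(inj_eq emb_inj) => /negPf-> /negPf->.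
have mgE : (m == glue b) = (m == glue (restr m)) && (restr m == b).
  apply/eqP/andP => [mE|[/eqP mE /eqP <-]] //.
  by rewrite mE restr_glue !eqxx.
rewrite mgE; case: eqP => [mE|/eqP/negPf nE] /=; last first.
  have Z (i : 'I_N') : i != j -> agree (emb i) (emb j) m (glue b) = false.
    by move=> ij; rewrite agE // nE.
  rewrite mul0r add0r !big1 ?addr0 // => i lt; rewrite Z ?subr0 // -val_eqE /=;
    by apply/eqP => E; move: lt; rewrite E ltnn.
rewrite coef_cherednikX restrE natrD.
have jE (i : 'I_N') : i != j -> agree (emb i) (emb j) m (glue b) = agree i j (restr m) b.
  by move=> ij; rewrite agE // -mE eqxx.
have -> : \sum_(i < N' | (emb i < emb j)%N)
     ((agree (emb i) (emb j) m (glue b) && (m (emb i) < glue b (emb j) <= m (emb j))%N)%:R -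
      (agree (emb i) (emb j) m (glue b) && (m (emb j) < glue b (emb j) <= m (emb i))%N)%:R) =
   \sum_(i < N' | (i < j)%N)
     ((agree i j (restr m) b && (restr m i < b j <= restr m j)%N)%:R -
      (agree i j (restr m) b && (restr m j < b j <= restr m i)%N)%:R) :> R.
  apply: eq_big => [i|i lt]; first by rewrite /= ltn_add2l.
  by rewrite jE ?glue_emb ?restrE // -val_eqE /=; move: lt => /=; lia.
have -> : \sum_(i < N' | (emb j < emb i)%N)
     ((agree (emb i) (emb j) m (glue b) && (m (emb i) <= glue b (emb j) < m (emb j))%N)%:R -
      (agree (emb i) (emb j) m (glue b) && (m (emb j) <= glue b (emb j) < m (emb i))%N)%:R) =
   \sum_(i < N' | (j < i)%N)
     ((agree i j (restr m) b && (restr m i <= b j < restr m j)%N)%:R -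
      (agree i j (restr m) b && (restr m j <= b j < restr m i)%N)%:R) :> R.
  apply: eq_big => [i|i lt]; first by rewrite /= ltn_add2l.
  by rewrite jE ?glue_emb ?restrE // -val_eqE /=; move: lt => /=; lia.
rewrite -!(restrE m j).
set S1 := \sum_(i < N' | (i < j)%N) _; set S2 := \sum_(i < N' | (j < i)%N) _.
by clearbody S1 S2; ring.
Qed.

Lemma ext_joint (a : R) t f : joint_eigen a t f -> (forall m, m \in msupp f -> cle m v) ->
  joint_eigen a (fun j => t (emb j) + A%:R) (ext f).
Proof.
move=> ef sf j; apply/mpolyP => b.
rewrite /ext linear_sum raddf_sum /= mcoeffZ -/(ext f).
under eq_bigr => m _ do rewrite linearZ mcoeffZ.
have H : (cherednik a (emb j) f)@_(glue b) =
  \sum_(m <- msupp f | m == glue (restr m))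
    f@_m * ((cherednik a j 'X_[restr m])@_b - (restr m == b)%:R * A%:R).
  rewrite coef_cherednik big_seq [RHS]big_seq_cond [RHS]big_mkcondr /=.
  apply: eq_bigr => m mf; rewrite coef_block; last exact: sf.
  by case: ifP; rewrite ?mulr0.
move: H; rewrite ef mcoeffZ; under [X in _ = X]eq_bigr do rewrite mulrBr.
rewrite sumrB => H.
have E : \sum_(m <- msupp f | m == glue (restr m)) f@_m * ((restr m == b)%:R * A%:R)
   = (ext f)@_b * A%:R.
  rewrite /ext raddf_sum /= mulr_suml; apply: eq_bigr => m _.
  by rewrite mcoeffZ mcoeffX mulrA.
rewrite E in H; rewrite mulrDl coef_ext H coef_ext; ring.
Qed.

End Extract.

(** * Eigenvalue collisions *)

Section Walk.
Local Open Scope nat_scope.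
Variables (N k p : nat).
Hypothesis k0 : 0 < k.
Hypothesis cop : coprime k.+1 p.
Implicit Types (f g : nat -> nat) (s S : 'S_N).

(* At [alpha = -(k+1)/p], the eigenvalue of row x is [- cval f x / p]. *)
Definition cval f x := k.+1 * f x + p * x.

(** With p + 1 rather than p, the values [cval] fall by at least k + 1 from one row of a residue
    class to the next. *)
Definition gap f := forall x, x + k.+1 < N -> f (x + k.+1) + p.+1 <= f x.

Definition tight f x := f x == f (x + k) + p.

(** Modulo k + 1 only p x and p y remain, and p is invertible there. *)
Lemma cval_mod f g x y z : cval f x = cval g y + k.+1 * z -> x = y %[mod k.+1].
Proof.
rewrite /cval => E; apply/eqP.
have : p * x == p * y %[mod k.+1].
  apply/eqP; rewrite -(modnMDl (f x)) -[RHS](modnMDl (g y + z)) !(mulnC _ k.+1) E.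
  by congr (_ %% _); lia.
have [xy|/ltnW xy] := leqP x y.
  rewrite eq_sym eqn_mod_dvd ?leq_mul2l ?xy ?orbT // -mulnBr Gauss_dvdr //.
  by rewrite -eqn_mod_dvd // eq_sym.
by rewrite !eqn_mod_dvd ?leq_mul2l ?xy ?orbT // -mulnBr Gauss_dvdr.
Qed.

Lemma mod_add x y : x < y -> x = y %[mod k.+1] -> exists q, y = x + k.+1 * q.+1.
Proof.
move=> xy /esym/eqP; rewrite eqn_mod_dvd 1?ltnW // => /dvdnP[q E].
case: q E => [|q] E; first by lia.
by exists q; rewrite mulnC -E subnKC // ltnW.
Qed.

Lemma gap_iter f x q : gap f -> x + k.+1 * q < N -> f (x + k.+1 * q) + p.+1 * q <= f x.
Proof.
move=> gf; elim: q => [|q IH] H; first by rewrite !muln0 !addn0.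
have /IH : x + k.+1 * q < N by rewrite mulnSr in H; lia.
have := gf (x + k.+1 * q); rewrite -addnA -mulnSr => /(_ H).
rewrite !(mulnSr p.+1); lia.
Qed.

Lemma cval_gap f x q : gap f -> x + k.+1 * q < N ->
  cval f (x + k.+1 * q) + k.+1 * q <= cval f x.
Proof.
move=> gf H; have := gap_iter gf H; rewrite /cval.
rewrite -(leq_pmul2l (ltn0Sn k)); lia.
Qed.

Lemma cval01 f F x : f x <= F x <= (f x).+1 ->
  F x = f x /\ cval F x = cval f x \/ F x = (f x).+1 /\ cval F x = cval f x + k.+1.
Proof.
rewrite /cval => H; have [E|E] : F x = f x \/ F x = (f x).+1 by lia.
  by left; rewrite E.
by right; rewrite E; lia.
Qed.

Lemma mul_le1 q : k.+1 * q.+1 <= k.+1 -> q = 0.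
Proof. by rewrite -[X in _ <= X]muln1 leq_pmul2l //; lia. Qed.

(* Interlacing of the two value sequences within a residue class modulo k+1
   forces the two permutations to coincide. *)
Lemma perm_interlace f F g G s S :
  gap f -> gap F ->
  (forall x, x < N -> f x <= F x <= (f x).+1) ->
  (forall x, x < N -> g x <= G x <= (g x).+1) ->
  (forall i : 'I_N, cval g i = cval f (s i)) ->
  (forall i : 'I_N, cval G i = cval F (S i)) -> S =1 s.
Proof.
move=> gf gF fF gG gs GS.
(* Passing from the lower to the upper sequence changes a value by 0 or k + 1, on both sides, while
   values of one class are at least k + 1 apart. So S i and s i differ by at most one step of the
   class. *)
have opt (i : 'I_N) : [\/ S i = s i,
    F (s i) = (f (s i)).+1 /\ S i = s i + k.+1 :> nat
  | [/\ F (s i) = f (s i), s i = S i + k.+1 :> nat & F (S i) = f (S i)]].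
  have md : S i = s i %[mod k.+1].
    have [[_ E]|[_ E]] := cval01 (gG _ (ltn_ord i)).
      by apply: (@cval_mod F f _ _ 0); rewrite -GS -gs E; lia.
    by apply: (@cval_mod F f _ _ 1); rewrite -GS -gs E; lia.
  have cg := cval01 (gG _ (ltn_ord i)); rewrite GS gs in cg.
  have cs := cval01 (fF _ (ltn_ord (s i))); have cS := cval01 (fF _ (ltn_ord (S i))).
  have [lt|lt|/val_inj->] := ltngtP (S i) (s i); last by constructor 1.
    constructor 3; have [q qE] := mod_add lt md.
    have := @cval_gap F (S i) q.+1 gF; rewrite -qE => /(_ (ltn_ord _)) H1.
    have := @cval_gap f (S i) q.+1 gf; rewrite -qE => /(_ (ltn_ord _)) H2.
    have q0 : q = 0 by apply: mul_le1; lia.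
    by rewrite q0 muln1 in qE H1 H2; split => //; lia.
  constructor 2; have [q qE] := mod_add lt (esym md).
  have := @cval_gap F (s i) q.+1 gF; rewrite -qE => /(_ (ltn_ord _)) H.
  have q0 : q = 0 by apply: mul_le1; lia.
  by rewrite q0 muln1 in qE H; split; lia.
(* If i moves up, the index that S sends to [s i] must itself move up, from a lower row number:
   coming from above would contradict the value of F at [s i]. *)
have noP (x : nat) : forall i : 'I_N, s i = x :> nat -> S i <= s i.
  have [n] := ubnP x; elim: n x => // n IH x xn i six.
  case: (opt i) => [->//|[FE SE]|[_ -> _]]; last by lia.
  pose j := (S^-1)%g (s i); have Sj : S j = s i by rewrite permKV.
  case: (opt j) => [E|[_ SE']|[_ SE' FE']].
  - have ji : j = i by apply: (@perm_inj _ s); rewrite -E Sj.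
    by move: Sj SE; rewrite ji => ->; lia.
  - by rewrite Sj in SE'; have := IH (s j) _ j erefl; rewrite Sj; lia.
  - by move: FE' FE; rewrite Sj; lia.
have noQ (x : nat) : forall i : 'I_N, N - s i = x -> s i <= S i.
  have [n] := ubnP x; elim: n x => // n IH x xn i six.
  case: (opt i) => [->//|[_ ->]|[FE SE FE2]]; first by lia.
  pose j := (S^-1)%g (s i); have Sj : S j = s i by rewrite permKV.
  case: (opt j) => [E|[FE' SE']|[_ SE' _]].
  - have ji : j = i by apply: (@perm_inj _ s); rewrite -E Sj.
    by move: Sj SE; rewrite ji => ->; lia.
  - have jE : s j = S i :> nat by move: SE'; rewrite Sj; lia.
    by move: FE' FE2; rewrite jE; lia.
  - rewrite Sj in SE'; have := ltn_ord (s j).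
    by have := IH (N - s j) _ j erefl; rewrite Sj; lia.
by move=> i; apply/val_inj/eqP; rewrite /= eqn_leq (noP _ i erefl) (noQ _ i erefl).
Qed.

Lemma cval_modE f g (x y : nat) : cval g x = cval f y -> y = x %[mod k.+1].
Proof. by move=> E; apply: (@cval_mod f g _ _ 0); rewrite E; lia. Qed.

(** The residues give s i = s j + 1 modulo k + 1. When s does not increase, the monotonicity of g
    and the drops of f squeeze each other into equalities, leaving a jump back by exactly k. *)
Lemma walk_step f g s (i j : 'I_N) :
  gap f -> (forall x, x + k < N -> f (x + k) + p <= f x) ->
  (forall x y, x <= y < N -> g y <= g x) ->
  (forall i : 'I_N, cval g i = cval f (s i)) -> i = j.+1 :> nat ->
  s j < s i \/ [/\ s j = s i + k :> nat, tight f (s i) & g j = g i].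
Proof.
move=> gf tf gd gs ij.
have [lt|le] := ltnP (s j) (s i); [by left|right].
have gji : g i <= g j by apply: gd; have := ltn_ord i; lia.
have mi := cval_modE (gs i); have mj := cval_modE (gs j).
have ne : s j != s i by rewrite (inj_eq perm_inj) -val_eqE /=; lia.
have lt : s i < (s j).+1 by lia.
have md : s i = (s j).+1 %[mod k.+1].
  by rewrite mi ij -addn1 -modnDml -mj modnDml addn1.
have [q qE] := mod_add lt md.
have sjE : s j = s i + k + k.+1 * q :> nat by rewrite mulnSr in qE; lia.
have sjN := ltn_ord (s j).
have := @gap_iter f (s i + k) q gf; rewrite -sjE => /(_ sjN) H1.
have skN : s i + k < N by lia.
have H2 := tf _ skN.
have Ei := gs i; have Ej := gs j; rewrite /cval ij in Ei; rewrite /cval in Ej; rewrite ij in gji.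
rewrite -(leq_pmul2l (ltn0Sn k)) in H1.
rewrite -(leq_pmul2l (ltn0Sn k)) in H2.
rewrite -(leq_pmul2l (ltn0Sn k)) in gji.
have Pj : p * s j = p * s i + p * k + p * (k.+1 * q) by rewrite sjE; lia.
have q0 : q = 0.
  suff : k.+1 * q = 0 by move/eqP; rewrite muln_eq0 => /eqP.
  lia.
rewrite q0 muln0 addn0 in sjE; rewrite q0 in H1 Pj; rewrite sjE in Ej H1 Pj.
have gE : g j = g i.
  rewrite ij; apply/eqP; by rewrite -(eqn_pmul2l (ltn0Sn k)); apply/eqP; lia.
split => //; rewrite /tight -(eqn_pmul2l (ltn0Sn k)); apply/eqP; lia.
Qed.

(* Take the first index moved down by s, and the last index moved up before it:
   in between, s is the identity. *)
Lemma walk_crossing (P : nat -> Prop) s :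
  (forall i : 'I_N, s i = i %[mod k.+1]) ->
  (forall i j : 'I_N, i = j.+1 :> nat -> s j < s i \/ s j = s i + k :> nat /\ P i) ->
  s <> 1%g ->
  exists u w : nat, [/\ k <= u, u - k < w, w <= u, w + k < N & u.+1 < N] /\
   [/\ P u.+1, P w, (forall i : 'I_N, i = u.+1 :> nat -> s i = u - k :> nat)
     & (forall i : 'I_N, w <= i <= u -> s i = i)].
Proof.
move=> md step s1.
have [b bneg] : exists b : 'I_N, s b < b.
  apply: boolp.contrapT => H; apply: s1; apply/permP => i; rewrite perm1.
  have {}H (i' : 'I_N) : i' <= s i' by rewrite leqNgt; apply/negP => lt; apply: H; exists i'.
  have [n] := ubnP (N - i); elim: n i => // n IH i iN.
  have [lt|] := ltnP i (s i); last by move=> le; apply/val_inj/eqP; rewrite /= eqn_leq le H.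
  have E : s (s i) = s i by apply: IH; have := ltn_ord (s i); lia.
  by have := perm_inj E => E'; rewrite E' ltnn in lt.
pose n1 := [arg min_(i < b | s i < i) (i : nat)].
have [n1neg n1min] : s n1 < n1 /\ forall i : 'I_N, i < n1 -> i <= s i.
  rewrite /n1; case: arg_minnP => // i si H; split => // j ji.
  by rewrite leqNgt; apply/negP => /H; lia.
(* Otherwise s would fix [s n1], and injectivity would give [s n1 = n1]. *)
have [c /andP[cn1 cpos]] : exists c : 'I_N, (c < n1) && (c < s c).
  apply: boolp.contrapT => H.
  have fx : s (s n1) = s n1.
    apply/val_inj/eqP; rewrite /= eqn_leq n1min // andbT leqNgt; apply/negP => lt.
    by apply: H; exists (s n1); rewrite n1neg lt.
  by have := perm_inj fx => E; rewrite E ltnn in n1neg.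
pose w1 := [arg max_(i > c | (i < n1) && (i < s i)) (i : nat)].
have [w1n w1pos w1max] : [/\ w1 < n1, w1 < s w1 & forall i : 'I_N, w1 < i -> i < n1 -> s i = i].
  rewrite /w1; case: arg_maxnP => [|i /andP[i1 i2] H]; first by rewrite cn1.
  split => // j ij jn; apply/val_inj/eqP; rewrite /= eqn_leq n1min // andbT leqNgt.
  by apply/negP => lt; have := H j; rewrite jn lt => /(_ isT); lia.
have uN : n1.-1 < N by have := ltn_ord n1; lia.
pose u := Ordinal uN; have nu : n1 = u.+1 :> nat by rewrite /=; lia.
have su := n1min u; have {su}su : u <= s u by apply: su; lia.
have [|[sE Pn]] := step n1 u nu; first by lia.
have [q qE] := mod_add n1neg (md n1).
have q0 : k.+1 <= k.+1 * q.+1 by rewrite leq_pmulr.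
have suE : s u = u :> nat by lia.
have sn1 : s n1 = u - k :> nat by lia.
have w1u : w1 < u.
  have : w1 != u by apply/eqP => E; rewrite E suE ltnn in w1pos.
  by rewrite -val_eqE /=; lia.
have wN : w1.+1 < N by have := ltn_ord u; lia.
pose w := Ordinal wN.
have sw : s w = w by apply: w1max => /=; lia.
have [|[sE' Pw]] := step w w1 erefl; first by rewrite sw /=; lia.
exists u, w1.+1; split.
  split => //; try lia.
  (* Otherwise u - k would be fixed by s while also being the image of [n1]. *)
  - rewrite ltnNge; apply/negP => le.
    have vN : u - k < N by lia.
    have fx : s (Ordinal vN) = Ordinal vN by apply: w1max => /=; lia.
    have : Ordinal vN = n1 by apply: (@perm_inj _ s); rewrite fx; apply/val_inj; rewrite /= sn1.
    by move/(congr1 val) => /=; lia.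
  - by have := ltn_ord (s w1); rewrite sE' sw.
  - by rewrite -nu.
split => //; first by rewrite -nu.
- by move=> i iE; rewrite -sn1; congr (nat_of_ord (s _)); apply/val_inj; rewrite /= iE -nu.
- move=> i /andP[wi iu]; apply: w1max => //; lia.
Qed.

End Walk.

Import Num.Theory.

(** * Poles *)

Lemma mulr_rot4 (K : fieldType) (c x y z : K) : c * (x * (y * z)) = x * (y * (c * z)).
Proof. by ring. Qed.

Lemma mulf_divK2 (K : fieldType) (x y u w : K) : y != 0 -> w != 0 ->
  x * u / (y * w) * y = x * (u / w).
Proof. by move=> y0 w0; field; rewrite w0 y0. Qed.

Section Regular.
Variables (F : numFieldType) (a0 : F).
Local Notation K := (ratfun F).
Local Notation a := (alpha_gen F).
Local Notation val := (ratfun_value a0).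
Implicit Types (c : K) (y : F) (q : {poly F}).

Lemma tofrac_natr n : FracField.tofrac n%:R = n%:R :> K.
Proof. by rewrite tofracMn tofrac1. Qed.

Lemma alpha_generic (x y n1 n2 : nat) : a *+ x + n1%:R = a *+ y + n2%:R -> x = y /\ n1 = n2.
Proof.
have E z n : a *+ z + n%:R = FracField.tofrac ('X *+ z + n%:R) :> K.
  by rewrite tofracD tofracMn tofrac_natr.
rewrite !E => /eqP; rewrite tofrac_eq => /eqP H.
have C i := congr1 (fun q : {poly F} => q`_i) H.
have := C 0%N; have := C 1%N.
rewrite -!polyC_natr !coefD !coefMn !coefX !coefC /= !mul0rn !add0r !addr0.
by move=> /eqP + /eqP; rewrite !eqr_nat => /eqP-> /eqP->.
Qed.

Lemma horner_neq0 q : q.[a0] != 0 -> FracField.tofrac q != 0 :> K.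
Proof. by move=> qa; rewrite tofrac_eq0; apply: contraNneq qa => ->; rewrite horner0. Qed.

Lemma value_poly q : val (FracField.tofrac q) q.[a0].
Proof.
by exists q, 1; rewrite hornerC oner_neq0 tofrac1 !divr1.
Qed.

Lemma value_alpha : val a a0.
Proof. by have := value_poly 'X; rewrite hornerX. Qed.

Lemma value_nat n : val n%:R n%:R.
Proof.
have := value_poly n%:R; rewrite -polyC_natr hornerC polyC_natr.
by rewrite tofrac_natr.
Qed.

Lemma valueD c c' y y' : val c y -> val c' y' -> val (c + c') (y + y').
Proof.
move=> [n [d [d0 -> ->]]] [n' [d' [d0' -> ->]]].
exists (n * d' + n' * d), (d * d'); split.
- by rewrite hornerM mulf_neq0.
- by rewrite tofracD !tofracM addf_div ?horner_neq0.
- by rewrite hornerD !hornerM addf_div.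
Qed.

Lemma valueM c c' y y' : val c y -> val c' y' -> val (c * c') (y * y').
Proof.
move=> [n [d [d0 -> ->]]] [n' [d' [d0' -> ->]]].
exists (n * n'), (d * d'); split.
- by rewrite hornerM mulf_neq0.
- by rewrite !tofracM mulf_div.
- by rewrite !hornerM mulf_div.
Qed.

Lemma valueN c y : val c y -> val (- c) (- y).
Proof.
move=> [n [d [d0 -> ->]]]; exists (- n), d; split => //.
  by rewrite tofracN mulNr.
by rewrite hornerN mulNr.
Qed.

Lemma valueB c c' y y' : val c y -> val c' y' -> val (c - c') (y - y').
Proof. by move=> cy /valueN; apply: valueD. Qed.

Lemma valueV c y : val c y -> y != 0 -> val c^-1 y^-1.
Proof.
move=> [n [d [d0 -> ->]]]; rewrite mulf_eq0 invr_eq0 negb_or => /andP[n0 _].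
exists d, n; split => //; by rewrite invf_div.
Qed.

Lemma value_uniq c y y' : val c y -> val c y' -> y = y'.
Proof.
move=> [n [d [d0 cE ->]]] [n' [d' [d0' cE' ->]]].
by rewrite -!ratfun_evalE // -cE cE'.
Qed.

Lemma value_eval c y : val c y -> ratfun_eval a0 c = y.
Proof. by move=> [n [d [d0 -> ->]]]; rewrite ratfun_evalE. Qed.

Lemma valueMn c y n : val c y -> val (c *+ n) (y *+ n).
Proof. by move=> cy; rewrite -[c *+ n]mulr_natr -[y *+ n]mulr_natr; apply: valueM cy (value_nat n). Qed.

Definition reg c := exists y, val c y.

Lemma regD c c' : reg c -> reg c' -> reg (c + c').
Proof. by move=> [y H] [y' H']; exists (y + y'); apply: valueD. Qed.
Lemma regM c c' : reg c -> reg c' -> reg (c * c').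
Proof. by move=> [y H] [y' H']; exists (y * y'); apply: valueM. Qed.
Lemma regN c : reg c -> reg (- c).
Proof. by move=> [y H]; exists (- y); apply: valueN. Qed.
Lemma reg_nat n : reg n%:R.
Proof. by exists n%:R; apply: value_nat. Qed.
Lemma reg0 : reg 0. Proof. exact: (reg_nat 0). Qed.
Lemma reg_alphaMn x : reg (a *+ x).
Proof. by exists (a0 *+ x); apply/valueMn/value_alpha. Qed.

Lemma reg_sum (I : Type) (s : seq I) (P : pred I) (G : I -> K) :
  (forall i, P i -> reg (G i)) -> reg (\sum_(i <- s | P i) G i).
Proof.
by move=> H; elim/big_ind: _ => //; [exact: reg0 | exact: regD].
Qed.

Definition unitv c := exists2 y, val c y & y != 0.

Lemma unitvM c c' : unitv c -> unitv c' -> unitv (c * c').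
Proof. by move=> [y H y0] [y' H' y0']; exists (y * y'); [apply: valueM | rewrite mulf_neq0]. Qed.

Lemma unitvV c : unitv c -> unitv c^-1.
Proof. by move=> [y H y0]; exists y^-1; [apply: valueV | rewrite invr_eq0]. Qed.

Lemma unitv1 : unitv 1. Proof. by exists 1; [exact: (value_nat 1) | rewrite oner_neq0]. Qed.

(** Uniformiser of F(alpha) at a0. *)
Definition pi0 : K := a - FracField.tofrac a0%:P.

Lemma value_pi0 : val pi0 0.
Proof.
rewrite -(subrr a0); apply: valueB; first exact: value_alpha.
by have := value_poly a0%:P; rewrite hornerC.
Qed.

Lemma pi0_neq0 : pi0 != 0.
Proof.
rewrite /pi0 -tofracN -tofracD tofrac_eq0 -size_poly_eq0.
by rewrite -polyCN size_XaddC.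
Qed.

(* c has order e1 - e2 at a0. *)
Definition ords c (e1 e2 : nat) := exists2 u, unitv u & c * pi0 ^+ e2 = pi0 ^+ e1 * u.

Lemma ords1 : ords 1 0 0.
Proof. by exists 1; [exact: unitv1 | rewrite !expr0]. Qed.

Lemma ordsM c c' e1 e2 f1 f2 :
  ords c e1 e2 -> ords c' f1 f2 -> ords (c * c') (e1 + f1) (e2 + f2).
Proof.
move=> [u uu E] [w uw E']; exists (u * w); first exact: unitvM.
by rewrite !exprD mulrACA E E' mulrACA.
Qed.

Lemma ords_prod (I : Type) (s : seq I) (P : pred I) (G : I -> K) (e1 e2 : I -> nat) :
  (forall i, P i -> ords (G i) (e1 i) (e2 i)) ->
  ords (\prod_(i <- s | P i) G i) (\sum_(i <- s | P i) e1 i) (\sum_(i <- s | P i) e2 i).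
Proof.
move=> H; elim: s => [|i s IH]; first by rewrite !big_nil; apply: ords1.
rewrite !big_cons; case: ifP => // Pi; by apply: ordsM => //; apply: H.
Qed.

(** For regular c the unit would be a multiple of [pi0] by a regular function, and so have value
    0. *)
Lemma ords_pole c e1 e2 : ords c e1 e2 -> (e1 < e2)%N -> ~ reg c.
Proof.
move=> [u [y uy y0] E] lt [z cz].
have E' : u = pi0 * (c * pi0 ^+ (e2 - e1).-1).
  apply: (mulfI (expf_neq0 e1 pi0_neq0)); rewrite -E.
  have -> : e2 = (e1 + (e2 - e1).-1.+1)%N by lia.
  rewrite exprD exprS (_ : (e1 + (e2 - e1).-1.+1 - e1).-1 = (e2 - e1).-1); last by lia.
  exact: mulr_rot4.
have regx : reg (c * pi0 ^+ (e2 - e1).-1).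
  apply: regM; first by exists z.
  elim: (_.-1) => [|j IH]; first by rewrite expr0; apply: (reg_nat 1).
  by rewrite exprS; apply: regM => //; exists 0; apply: value_pi0.
case: regx => w /(valueM value_pi0); rewrite -E' => H.
by move: y0; rewrite (value_uniq uy H) mul0r eqxx.
Qed.

Lemma linear_ords s d : (0 < s)%N -> exists2 u,
  unitv u & a *+ s + d%:R = pi0 ^+ (a0 *+ s + d%:R == 0) * u.
Proof.
move=> s0; have [E|E] := eqVneq (a0 *+ s + d%:R) 0.
  exists s%:R; first by exists s%:R; [apply: value_nat | rewrite pnatr_eq0; lia].
  rewrite expr1 mulrBl mulr_natr; congr (_ + _).
  rewrite -mulrN; have -> : - s%:R = FracField.tofrac (- s%:R) :> K.
    by rewrite tofracN tofrac_natr.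
  rewrite -tofracM mulrN -polyC_natr -polyCM mulr_natr -polyCN.
  have -> : - (a0 *+ s) = d%:R by apply/eqP; rewrite eq_sym -addr_eq0 addrC E.
  by rewrite polyC_natr tofrac_natr.
exists (a *+ s + d%:R); last by rewrite expr0 mul1r.
by exists (a0 *+ s + d%:R) => //; apply: valueD; [apply/valueMn/value_alpha | apply: value_nat].
Qed.

Lemma ratio_ords s d : (0 < s)%N ->
  ords ((a *+ s + d.+1%:R) / (a *+ s + d%:R))
    (a0 *+ s + d.+1%:R == 0) (a0 *+ s + d%:R == 0).
Proof.
move=> s0; have [u uu uE] := linear_ords d.+1 s0; have [w uw wE] := linear_ords d s0.
exists (u / w); first by apply: unitvM => //; apply: unitvV.
have w0 : w != 0.
  by case: uw => y wy; apply: contraNneq => w0; move: wy; rewrite w0 => wy; rewrite (value_uniq wy (value_nat 0)).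
have pp (b : nat) : pi0 ^+ b != 0 := expf_neq0 b pi0_neq0.
rewrite uE wE; exact: mulf_divK2 (pp _) w0.
Qed.

End Regular.

Section Regp.
Variables (F : numFieldType) (a0 : F) (N : nat).
Local Notation K := (ratfun F).
Local Notation a := (alpha_gen F).
Implicit Types (p : {mpoly K[N]}).

Definition regp p := forall m, reg a0 p@_m.

Lemma regpD p q : regp p -> regp q -> regp (p + q).
Proof. by move=> H1 H2 m; rewrite mcoeffD; apply: regD. Qed.

Lemma regpZ c p : reg a0 c -> regp p -> regp (c *: p).
Proof. by move=> H1 H2 m; rewrite mcoeffZ; apply: regM. Qed.

Lemma regp_msym s p : regp p -> regp (msym s p).
Proof. by move=> H m; rewrite mcoeff_mact. Qed.

Lemma regp_cherednik j p : regp p -> regp (cherednik a j p).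
Proof.
move=> H k; rewrite coef_cherednik; apply: reg_sum => m _; apply: regM => //.
rewrite coef_cherednikX; apply: regD; first apply: regD.
- by apply: regM; [apply: reg_nat | apply: regD; [apply: reg_alphaMn | apply/regN/reg_nat]].
- by apply: reg_sum => i _; apply: regD; [apply: reg_nat | apply/regN/reg_nat].
- by apply: reg_sum => i _; apply: regD; [apply: reg_nat | apply/regN/reg_nat].
Qed.

Lemma reg_bar (m : 'X_{1..N}) j : reg a0 (bar a m j).
Proof. by rewrite barE; apply: regD; [apply: reg_alphaMn | apply/regN/reg_nat]. Qed.

Lemma regp_ev1 p : regp p -> reg a0 (ev1 p).
Proof. by move=> H; rewrite ev1E; apply: reg_sum. Qed.

End Regp.

Section Pole.
Variables (F : numFieldType) (a0 : F) (k p : nat).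
Hypotheses (p0 : (0 < p)%N) (cop : coprime k.+1 p) (a0E : a0 *+ p + k.+1%:R = 0).
Local Notation a := (alpha_gen F).

(** The equation reads d p = (k+1) s. By coprimality k + 1 divides d, and d is below its second
    multiple. *)
Lemma resonance s d : (0 < s)%N -> (0 < d < (k.+1).*2)%N ->
  (a0 *+ s + d%:R == 0) = (s == p) && (d == k.+1).
Proof.
move=> s0 /andP[d0 d2].
have E : (a0 *+ s + d%:R == 0) = (d * p == k.+1 * s)%N.
  rewrite -(eqr_nat F) !natrM -[LHS](mulrI_eq0 _ (@mulfI F p%:R _)) ?pnatr_eq0 -?lt0n //.
  have -> : p%:R * (a0 *+ s + d%:R) = (a0 *+ p + k.+1%:R) * s%:R + (d%:R * p%:R - k.+1%:R * s%:R).
    by rewrite -!(mulr_natr a0); ring.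
  by rewrite a0E mul0r add0r subr_eq0.
rewrite E; apply/eqP/andP => [H|[/eqP-> /eqP->]] //.
have : (k.+1 %| d * p)%N by rewrite H dvdn_mulr.
rewrite Gauss_dvdl // => /dvdnP[q qE].
have q1 : q = 1%N.
  case: q qE => [|[|q]] // qE; first by rewrite qE in d0.
  by move: d2; rewrite qE -muln2 (mulnC q.+2) ltn_pmul2l.
rewrite q1 mul1n in qE; split; last by rewrite qE.
by move: H; rewrite qE => /eqP; rewrite eqn_pmul2l // eq_sym.
Qed.

(** Only the column s = p matters: its numerator vanishes at distance k and its denominator at
    distance k + 1. *)
Lemma fac_ords D d : (0 < d < k.*2.+1)%N ->
  ords a0 (fac a D d) ((d == k) && (p <= D)%N) ((d == k.+1) && (p <= D)%N).
Proof.
move=> dk; have C (b : bool) : ((b && (p <= D)%N) : nat) =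
  (\sum_(1 <= s < D.+1) ((s == p) && b))%N.
  case: b => /=; last by rewrite big1 // => i _; rewrite andbF.
  rewrite (eq_bigr (fun s => (s == p : nat))); last by move=> s _; rewrite andbT.
  have [pD|Dp] := leqP p D; last first.
    rewrite big_nat_cond big1 // => i /andP[/andP[_ iD] _]; case: eqP iD => //; lia.
  rewrite (bigD1_seq p) ?iota_uniq ?mem_index_iota //= ?eqxx; last by lia.
  by rewrite big1 // => i /negPf->.
rewrite !C /fac big_nat_cond [X in ords _ _ X _]big_nat_cond [X in ords _ _ _ X]big_nat_cond.
apply: ords_prod => s /andP[/andP[s0 _] _].
by have := ratio_ords a0 d s0; rewrite !resonance //; lia.
Qed.

Variable n : nat.
Local Notation N := n.+1.
Implicit Types (b : 'X_{1..N}).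

(* Two inverted tight pairs of rows kill two of the zeros of the numerator of
   the principal specialisation but none of its n - k poles. *)
Lemma evform_pole b B : (0 < B <= k)%N -> n = (B + k)%N ->
  (forall i j, rkn b j = (rkn b i + k.+1)%N -> (b j + p < b i)%N) ->
  (forall i j, rkn b i = 0%N \/ rkn b i = B -> rkn b j = (rkn b i + k)%N ->
      (j < i)%N /\ b i = (b j + p)%N) ->
  ~ reg a0 (evform a b).
Proof.
move=> Bk nE gp inv; rewrite /evform.
pose d (i j : 'I_N) := (rkn b j - rkn b i)%N.
pose D (i j : 'I_N) := (b i - b j - (j < i))%N.
pose e1 (q : 'I_N * 'I_N) := ((d q.1 q.2 == k) && (p <= D q.1 q.2)%N : nat).
pose e2 (q : 'I_N * 'I_N) := ((d q.1 q.2 == k.+1) && (p <= D q.1 q.2)%N : nat).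
have O : ords a0 (\prod_(q : 'I_N * 'I_N | before b q.1 q.2) evfac a b q.1 q.2)
   (\sum_(q | before b q.1 q.2) e1 q) (\sum_(q | before b q.1 q.2) e2 q).
  apply: ords_prod => -[i j] /=; rewrite -rkn_lt => lt.
  by apply: fac_ords; have := rkn_ltN b j; lia.
apply: ords_pole O _.
have pE (e : 'I_N * 'I_N -> nat) : (\sum_(q | before b q.1 q.2) e q =
    \sum_i \sum_(j | before b i j) e (i, j))%N.
  by rewrite (pair_big_dep xpredT (fun i j => before b i j) (fun i j => e (i, j))) /=;
     apply: eq_big => -[].
have rkE x : (x < N)%N -> {i | rkn b i = x}.
  move=> xN; exists ((rkp b)^-1 (Ordinal xN))%g.
  by rewrite -rkpE permKV.
have rkI i j : rkn b i = rkn b j -> i = j.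
  by move=> E; apply: (@rk_inj _ b); apply/val_inj.
(* Pairs at distance k start at the rows 0 to B. Those starting at 0 and B are tight and inverted,
   so only p - 1 columns are counted and the column p is missing. *)
have le1 i : (\sum_(j | before b i j) e1 (i, j) <= (0 < rkn b i < B))%N.
  have [bi|bi] := boolP (0 < rkn b i < B)%N.
    have kN : (rkn b i + k < N)%N by lia.
    have [j jE] := rkE _ kN.
    rewrite (bigD1 j) /=; last by rewrite -rkn_lt; lia.
    rewrite big1 ?addn0 ?leq_b1 // => l /andP[lt lj]; rewrite /e1 /d /=.
    case: eqP => //= dk; case/eqP: lj; apply: rkI; move: lt; rewrite -rkn_lt; lia.
  rewrite big1 // => j lt; rewrite /e1 /d /D /=; case: eqP => //= dk.
  move: lt; rewrite -rkn_lt => lt.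
  have [||ji bE] := inv i j; have := rkn_ltN b j; lia.
(* Each of the rows 0 to B - 1 has a partner at distance k + 1; the drop of at least p + 1 leaves p
   columns even if the pair is inverted. *)
have le2 i : ((rkn b i < B) <= \sum_(j | before b i j) e2 (i, j))%N.
  have [bi|bi] := boolP (rkn b i < B)%N => //.
  have kN : (rkn b i + k.+1 < N)%N by lia.
  have [j jE] := rkE _ kN.
  rewrite (bigD1 j) /=; last by rewrite -rkn_lt; lia.
  by rewrite /e2 /d /D /= jE addKn eqxx; have := gp _ _ jE; lia.
have [z zE] := rkE 0%N isT.
rewrite !pE (bigD1 z) //= [X in (_ < X)%N](bigD1 z) //=.
have := le1 z; have := le2 z; rewrite zE => l1 l2.
rewrite -addSn; apply: leq_add; first by apply: leq_ltn_trans l2 (leq_trans _ l1); lia.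
apply: leq_sum => i _; apply: leq_trans (le1 i) _; apply: leq_trans (le2 i); lia.
Qed.

End Pole.

(** * Rows of a superpartition *)

Section Rows.
Variables (N : nat).
Implicit Types (m L G : 'X_{1..N}).

Lemma rkn_onto m x : (x < N)%N -> exists i, rkn m i = x.
Proof. by move=> xN; exists ((rkp m)^-1 (Ordinal xN))%g; rewrite -rkpE permKV. Qed.

Lemma rkn_inj m i j : rkn m i = rkn m j -> i = j.
Proof. by move=> E; apply: (@rk_inj _ m); apply/val_inj. Qed.

Lemma rearr_noninc (s : seq nat) x y : (x <= y)%N ->
  (nth 0 (decr_rearr s) y <= nth 0 (decr_rearr s) x)%N.
Proof.
move=> xy; have [yN|yN] := ltnP y (size (decr_rearr s)); last by rewrite (nth_default _ yN).
have srt : sorted geq (decr_rearr s) by apply: sort_sorted => u v; apply: leq_total.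
apply: (sorted_leq_nth (leT := geq)) => //; rewrite ?inE //.
- exact: geq_trans.
- by move=> u; rewrite /geq /=.
- exact: leq_ltn_trans xy yN.
Qed.

Lemma circ_interlace M m x : (x < N)%N ->
  (nth 0 (sp_star m) x <= nth 0 (sp_circ M m) x <= (nth 0 (sp_star m) x).+1)%N.
Proof.
move=> xN; have [i <-] := rkn_onto m xN; rewrite nth_star nth_circ.
by case: (i < M)%N; lia.
Qed.

Lemma rkn_act m (x y : 'I_N) j : y = x.+1 :> nat -> m x != m y ->
  rkn (mact (tperm x y) m) (tperm x y j) = rkn m j.
Proof.
move=> xy ne; apply: (rkn_transport (s := tperm x y)) => i i'.
exact: before_simple.
Qed.

Lemma star_mact m s : sp_star (mact s m) = sp_star m.
Proof.
apply: decr_rearr_eq; apply: excess_perm; first by rewrite !size_parts.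
move=> c; rewrite -!excessE /excess [RHS](reindex_inj (@perm_inj _ s)) /=.
by apply: eq_bigr => i _; rewrite mactE.
Qed.

(** The excesses of the two partitions differ by the number of entries of block I at each level. So
    the content of I is known, that of J follows, and each block is sorted. *)
Lemma star_circ_inj M L G : superpartition M L -> superpartition M G ->
  sp_star L = sp_star G -> sp_circ M L = sp_circ M G -> G = L.
Proof.
move=> sL sG st ci.
have ex : forall c, excess L c = excess G c by apply/excess_star.
have hM v : heads L M v = heads G M v.
  have := excess_circ M L v; have := excess_circ M G v.
  rewrite (perm_big _ (perm_decr_rearr ci)) /= ex => -> /addnI ->.
  by [].
have hN v : heads L N v = heads G N v.
  have E (m : 'X_{1..N}) : heads m N v = (\sum_(x <- parts m) (v <= x))%N.
    rewrite /heads big_map big_enum /=; apply: eq_bigl => i; by rewrite ltn_ord.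
  by rewrite !E; apply: perm_big; apply: perm_decr_rearr st.
have hI (m : 'X_{1..N}) v : hblk (fun i : 'I_N => i < M)%N m N v = heads m M v.
  by rewrite /hblk /heads; apply: eq_bigl => i; rewrite ltn_ord.
have hJ v : hblk (fun i : 'I_N => M <= i)%N L N v = hblk (fun i : 'I_N => M <= i)%N G N v.
  by have := hN v; rewrite !(heads_split M) !hI hM => /addnI.
have hI' v : hblk (fun i : 'I_N => i < M)%N L N v = hblk (fun i : 'I_N => i < M)%N G N v.
  by rewrite !hI.
apply/heads_inj => p v; apply/eqP; rewrite eqn_leq !(heads_split M).
apply/andP; split; apply: leq_add; apply: hblk_max => //.
- by move=> i j; apply: superpartition_leI.
- by move=> i j; apply: superpartition_leJ.
- by move=> i j; apply: superpartition_leI.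
- by move=> i j; apply: superpartition_leJ.
Qed.

Lemma orb_superpartition M L m : superpartition M L -> superpartition M m ->
  m \in orb M L -> m = L.
Proof.
move=> sL sm mO; apply: (@star_circ_inj M) => //.
  by rewrite (orb_star mO).
by rewrite (orb_circ mO).
Qed.

Lemma superpartition_adj M m :
  (forall x y, adj_blk M x y -> (m y <= m x)%N) -> superpartition M m.
Proof.
move=> H.
have R : forall x y : 'I_N, (x < y)%N ->
    (x < y)%N && (((x < M)%N == (y < M)%N) ==> (m y <= m x)%N).
  apply: adj_trans => [x y z /andP[xy /implyP Hxy] /andP[yz /implyP Hyz]|x y xy].
    rewrite (ltn_trans xy yz) /=; apply/implyP => /eqP blk.
    have yM : (y < M)%N = (x < M)%N by apply/idP/idP; lia.
    by apply: leq_trans (Hyz _) (Hxy _); rewrite yM ?blk eqxx.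
  by rewrite xy ltnSn /=; apply/implyP => blk; apply: H; rewrite /adj_blk xy eqxx.
apply/andP; split; apply/forall_inP => i iS; apply/forall_inP => j jS; apply/implyP => ij;
  have /andP[_ /implyP] := R _ _ ij; move: iS jS; rewrite !inE.
  by move=> -> -> /(_ isT).
by move=> iM jM; rewrite (ltnNge i) (ltnNge j) iM jM => /(_ isT).
Qed.

(** Decreases whenever an adjacent ascent is swapped; the measure for sorting inside the blocks. *)
Definition weight m := (\sum_(i < N) m i * i)%N.

Lemma weight_swap (x y : 'I_N) (f : 'I_N -> nat) : y = x.+1 :> nat -> (f x < f y)%N ->
  (\sum_(i < N) f (tperm x y i) * i < \sum_(i < N) f i * i)%N.
Proof.
move=> xy lt; have nyx : y != x by rewrite -val_eqE /=; lia.
rewrite (bigD1 x) //= (bigD1 y) //= [X in (_ < X)%N](bigD1 x) //= [X in (_ < _ + X)%N](bigD1 y) //=.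
rewrite tpermL tpermR !addnA.
rewrite (eq_bigr (fun i : 'I_N => f i * i)%N); last first.
  by move=> i /andP[ix iy]; rewrite tpermD // eq_sym.
by rewrite ltn_add2r xy; lia.
Qed.

(** The preimage of the first A indices is an initial segment with A elements. *)
Lemma perm_downset (s : 'S_N) A : (A <= N)%N ->
  (forall i j : 'I_N, (i < j)%N -> (s j < A)%N -> (s i < A)%N) ->
  forall i, (s i < A)%N = (i < A)%N.
Proof.
move=> AN H.
pose S := [set i : 'I_N | (s i < A)%N].
have cS : #|S| = A.
  have -> : S = s @^-1: [set i : 'I_N | (i < A)%N] by apply/setP => i; rewrite !inE.
  by rewrite -[s]invgK preim_permV card_imset ?card_ltn //; apply: perm_inj.
move=> i; apply/idP/idP => [siA|iA].
  rewrite ltnNge; apply/negP => Ai.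
  have : [set j : 'I_N | (j < i.+1)%N] \subset S.
    apply/subsetP => j; rewrite !inE ltnS leq_eqVlt => /orP[/eqP/val_inj->//|ji].
    exact: H ji siA.
  by move/subset_leq_card; rewrite cS card_ltn //; lia.
apply/negPn/negP => siA.
have : S \subset [set j : 'I_N | (j < i)%N].
  apply/subsetP => j; rewrite !inE => sj; rewrite ltnNge leq_eqVlt; apply/negP => /orP[/eqP/val_inj E|ij].
    by rewrite E sj in siA.
  by move: siA; rewrite (H _ _ ij).
by move/subset_leq_card; rewrite cS card_ltn //; have := ltn_ord i; lia.
Qed.

End Rows.

Section CvalFacts.
Variables (N k p : nat) (lam : nat -> nat).
Hypotheses (k0 : (0 < k)%N) (cop : coprime k.+1 p) (gp : gap N k p lam).
Hypothesis mon : forall x y, (x <= y)%N -> (lam y <= lam x)%N.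
Local Notation c := (cval k p lam).

Lemma cval_inj x y : (x < N)%N -> (y < N)%N -> c x = c y -> x = y.
Proof.
wlog xy : x y / (x <= y)%N.
  by move=> H xN yN E; have [/H->|/ltnW/H->] := leqP x y.
move=> xN yN E; apply/eqP; rewrite eqn_leq xy leqNgt; apply/negP => lt.
have [q qE] := mod_add k0 cop lt (cval_modE k0 cop (esym E)).
have := @cval_gap N k p k0 cop lam x q.+1 gp; rewrite -qE => /(_ yN); rewrite E.
by rewrite mulSn; lia.
Qed.

(** Treats the zeros of 1 - [cc], the recursion factor of a symmetric block: only equal rows would
    produce one. *)
Lemma cval_next x y : (y < x < N)%N -> c x = (c y + p)%N -> lam x = lam y.
Proof.
case/andP => yx xN E.
(* The constant sequence [lam y] takes the value [c y + p] at y + 1, so x = y + 1 modulo k + 1. *)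
have E' : cval k p (fun=> lam y) y.+1 = c x by rewrite E /cval; lia.
have md := cval_modE k0 cop E'.
have [|lt|xE] := ltngtP x y.+1; first by lia.
  have [q qE] := mod_add k0 cop lt (esym md).
  have yN : (y + k.+1 * q.+1 < N)%N by lia.
  have := gap_iter k0 cop gp yN; have := @mon (y + k.+1 * q.+1) x; rewrite qE.
  move=> /(_ ltac:(lia)) H1 H2; move: E; rewrite /cval qE.
  move: H1 H2; set u := lam _; set w := lam (y + _)%N => H1 H2 E.
  have H3 : (k.+1 * (u + p.+1 * q.+1) <= k.+1 * lam y)%N by rewrite leq_pmul2l //; lia.
  by move: H3 E; rewrite !mulnDr !(mulSn p) mulnDr; nia.
by move: E; rewrite /cval xE => E; apply/eqP; rewrite -(eqn_pmul2l (ltn0Sn k)); apply/eqP; lia.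
Qed.

(** Treats the zeros of -1 - [cc], the recursion factor of an antisymmetric block: they force a
    tight pair of rows at distance k. *)
Lemma cval_tight x y : (forall x, (x + k < N)%N -> (lam (x + k) + p <= lam x)%N) ->
  (y < x < N)%N -> c y = (c x + p)%N -> x = (y + k)%N /\ lam y = (lam x + p)%N.
Proof.
move=> tf /andP[yx xN] E.
have E' : cval k p (fun=> lam x) x.+1 = c y by rewrite E /cval; lia.
have [|q qE] := @mod_add k p k0 cop y x.+1 _ (cval_modE k0 cop E'); first by lia.
have xE : x = (y + k + k.+1 * q)%N by rewrite mulnSr in qE; lia.
have := @gap_iter N k p k0 cop lam (y + k) q gp; rewrite -xE => /(_ xN) H1.
have ykN : (y + k < N)%N by lia.
have H2 := tf _ ykN.
have E2 : lam y = (lam x + p * q.+1)%N.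
  apply/eqP; rewrite -(eqn_pmul2l (ltn0Sn k)); apply/eqP; rewrite mulnDr.
  move: E; rewrite /cval.
  have -> : (k.+1 * (p * q.+1) = p * (k.+1 * q.+1))%N by rewrite mulnCA.
  have -> : (p * (k.+1 * q.+1) = p * x.+1 - p * y)%N by rewrite qE mulnDr addKn.
  have : (p * y <= p * x.+1)%N by rewrite leq_mul2l; lia.
  by rewrite mulnS; lia.
have q0 : q = 0%N by move: H1 H2; rewrite E2 mulnS mulSn; lia.
by rewrite q0 muln0 addn0 in xE; rewrite q0 muln1 in E2.
Qed.

End CvalFacts.

(** * Regular non-symmetric Jack polynomials and a contradiction *)

Section Regularity.
Variables (F : numFieldType) (a0 : F) (k p n M : nat) (L : 'X_{1..n.+1}).
Local Notation N := n.+1.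
Local Notation K := (ratfun F).
Local Notation a := (alpha_gen F).
Hypotheses (k0 : (0 < k)%N) (p0 : (0 < p)%N) (cop : coprime k.+1 p).
Hypothesis a0E : a0 *+ p + k.+1%:R = 0.
Variable E : 'X_{1..N} -> {mpoly K[N]}.
Hypothesis EJ : forall v, joint_eigen a (bar a v) (E v).
Hypothesis E1 : forall v, (E v)@_v = 1.
Local Notation lam := (nth 0%N (sp_star L)).
Local Notation lamc := (nth 0%N (sp_circ M L)).
Hypothesis gapL : gap N k p lam.
Hypothesis weakL : forall x, (x + k < N)%N -> (lam (x + k) + p.+1 <= lamc x)%N.
Implicit Types (v w : 'X_{1..N}).

(** Eigenvalue of row x at a0. Distinct rows have distinct values, so the eigenvalues on an orbit
    stay separated after specialisation. *)
Definition tau x : F := a0 *+ lam x - x%:R.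

Lemma tauE x : tau x *+ p = - (cval k p lam x)%:R.
Proof.
rewrite /tau /cval natrD !natrM -!(mulr_natr a0) -(mulr_natr (_ - _)).
have -> : k.+1%:R = - (a0 * p%:R) :> F.
  by apply/eqP; rewrite -addr_eq0 addrC mulr_natr a0E.
by ring.
Qed.

Lemma tau_sub x y d : tau y - tau x = d%:R -> cval k p lam x = (cval k p lam y + d * p)%N.
Proof.
move=> H; apply/eqP; rewrite -(eqr_nat F) natrD natrM -H mulr_natr mulrnBl !tauE.
by apply/eqP; ring.
Qed.

Lemma lam_mon x y : (x <= y)%N -> (lam y <= lam x)%N.
Proof. exact: rearr_noninc. Qed.

Lemma tau_inj x y : (x < N)%N -> (y < N)%N -> tau x = tau y -> x = y.
Proof.
move=> xN yN H; apply: (cval_inj k0 cop gapL) => //.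
by have := @tau_sub x y 0; rewrite H subrr mul0n addn0; apply.
Qed.

Lemma lam_tight x : (x + k < N)%N -> (lam (x + k) + p <= lam x)%N.
Proof.
move=> xk; have xN : (x < N)%N by lia.
by have := weakL xk; have /andP[_] := circ_interlace M L xN; lia.
Qed.

Lemma lamE v j : sp_star v = sp_star L -> lam (rkn v j) = v j.
Proof. by move=> <-; rewrite nth_star. Qed.

Lemma bar_value v j : sp_star v = sp_star L -> ratfun_value a0 (bar a v j) (tau (rkn v j)).
Proof.
move=> st; rewrite barE /tau lamE //.
by apply: valueB; [apply/valueMn/value_alpha | apply: value_nat].
Qed.

Lemma cc_value v x y : sp_star v = sp_star L -> x != y ->
  ratfun_value a0 (cc a x y v) (tau (rkn v y) - tau (rkn v x))^-1.
Proof.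
move=> st xy; apply: valueV; first by apply: valueB; apply: bar_value.
rewrite subr_eq0; apply: contraNneq xy => /tau_inj H.
by apply/eqP/esym/(@rkn_inj _ v)/H; apply: rkn_ltN.
Qed.

Section Orbit.
Variables (T : symtype) (q : 'X_{1..N} -> K).
Hypotheses (sL : superpartition M L) (aIT : aI T = false) (qL : q L = 1).
Local Notation O := (orb M L).
Local Notation Q := (\sum_(v <- O) q v *: E v).
Hypothesis Qreg : regp a0 Q.
Hypothesis Qsym : forall x y, adj_blk M x y ->
  msym (tperm x y) Q = (-1) ^+ (if (x < M)%N then aI T else aJ T) *: Q.

(** A factor of the recursion can vanish only if the two eigenvalues differ by the sign of the
    block. Difference 1 would make the entries equal. Difference -1 would give a tight pair whose
    upper row lies in J, hence is not raised in the circled partition, against weak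
    admissibility. *)
Lemma coef_unit v : v \in O -> unitv a0 (q v).
Proof.
have [d] := ubnP (weight v); elim: d v => // d IH v vd vO.
have [/existsP[x /existsP[y /andP[adj lt]]]|/existsPn H] :=
  boolP [exists x, exists y, adj_blk M x y && (v x < v y)%N]; last first.
  rewrite (_ : v = L) ?qL; first exact: unitv1.
  apply: orb_superpartition (sL) _ (vO); apply: superpartition_adj => x y adj.
  by have /existsPn/(_ y) := H x; rewrite adj /= -leqNgt.
have [/eqP xy /eqP blk] := andP adj.
have xny : x != y by rewrite -val_eqE /=; lia.
have st := orb_star vO.
rewrite (span_recursion (@alpha_generic F) EJ E1 (Qsym adj) adj vO lt).
apply: unitvM; last first.
  apply: IH; last by apply: orb_act vO; apply: blkperm_adj.
  have -> : weight (mact (tperm x y) v) = (\sum_(i < N) v (tperm x y i) * i)%N.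
    by apply: eq_bigr => i _; rewrite mactE.
  by apply: leq_trans (weight_swap xy lt) _; rewrite -/(weight v); lia.
set b := (if _ then _ else _) : bool.
have ccv := cc_value st xny.
have XN := rkn_ltN v x; have YN := rkn_ltN v y.
have YX : (rkn v y < rkn v x)%N by rewrite rkn_lt /before lt.
exists ((-1) ^+ b - (tau (rkn v y) - tau (rkn v x))^-1).
  apply: valueB ccv; case: (b); last exact: (value_nat a0 1).
  by rewrite expr1; apply: valueN; exact: (value_nat a0 1).
rewrite subr_eq0; apply/eqP => H.
have {H} : tau (rkn v y) - tau (rkn v x) = (-1) ^+ b.
  by rewrite -[LHS]invrK -H; case: (b); rewrite ?expr1 ?expr0 ?invrN1 ?invr1.
case bE : b; last first.
  rewrite expr0 => /(@tau_sub _ _ 1); rewrite mul1n => /(cval_next k0 cop gapL lam_mon).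
  by rewrite YX XN !lamE // => /(_ isT); lia.
rewrite expr1 => /(congr1 -%R); rewrite opprB opprK => /(@tau_sub _ _ 1); rewrite mul1n.
move/(cval_tight k0 cop gapL lam_tight); rewrite YX XN => /(_ isT)[xE tE].
have yM : (y < M)%N = false.
  by move: bE; rewrite /b blk; case: (y < M)%N; rewrite ?aIT.
have := @weakL (rkn v y); rewrite -xE => /(_ XN).
by rewrite -(orb_circ vO) nth_circ yM => H; move: H tE; rewrite !lamE //; lia.
Qed.

Lemma orb_reg v : v \in O -> regp a0 (E v).
Proof.
move=> vO; have [y qy y0] := coef_unit vO.
have qn0 : q v != 0.
  by apply: contraNneq y0 => q0; move: qy; rewrite q0 => qy; rewrite (value_uniq qy (value_nat a0 0)).
rewrite -[E v](scalerK qn0); apply: regpZ; first by exists y^-1; apply: valueV.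
move: vO; apply: (separation (@regpD _ a0 N) (@regpZ _ a0 N)
   (@regp_cherednik _ a0 N) (@regN _ a0) (f := fun w => q w *: E w) (t := bar a)).
- exact: orb_uniq.
- by move=> w _; apply: joint_eigenZ.
- by move=> w j _; apply: reg_bar.
- move=> w w' wO wO' ww.
  have [j jE] : exists j, rkn w j != rkn w' j.
    apply/existsP; apply: contraNT ww => /existsPn H; apply/eqP/mnmP => j.
    have /negPn/eqP R := H j.
    by rewrite -(lamE j (orb_star wO)) R lamE // (orb_star wO').
  have vd := valueB (bar_value j (orb_star wO)) (bar_value j (orb_star wO')).
  have t0 : tau (rkn w j) - tau (rkn w' j) != 0.
    by rewrite subr_eq0; apply: contraNneq jE => /tau_inj->//; apply: rkn_ltN.
  exists j; split; last by exists (tau (rkn w j) - tau (rkn w' j))^-1; apply: valueV.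
  apply: contraNneq t0 => bE; move: vd; rewrite bE subrr => vd.
  by rewrite (value_uniq vd (value_nat a0 0)).
- exact: Qreg.
Qed.

End Orbit.

Variables A B : nat.
Hypotheses (AB : (A < B <= A + k)%N) (BN : (B + k < N)%N).
Hypotheses (tA : lam A = (lam (A + k) + p)%N) (tB : lam B = (lam (B + k) + p)%N).

(** For a tight pair of rows, the order of positions that removes the column p from its share of the
    principal specialisation. *)
Definition inverted v x := forall i j : 'I_N, rkn v i = x -> rkn v j = (x + k)%N -> (j < i)%N.

Definition good v := [/\ sp_star v = sp_star L, regp a0 (E v), inverted v A & inverted v B].

(** Rows before A, from A to B + k, and after B + k. Both tight pairs lie in the middle group, so
    swaps between groups preserve their inversions. *)
Definition grp x : nat := ((A <= x) + (B + k < x))%N.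

Lemma inverted_act v (x y : 'I_N) z : y = x.+1 :> nat -> v x != v y ->
  grp (rkn v x) != grp (rkn v y) -> grp z = grp (z + k) ->
  inverted v z -> inverted (mact (tperm x y) v) z.
Proof.
move=> xy vxy gxy gz inv i j.
rewrite -{1}(tpermK x y i) -{1}(tpermK x y j) !rkn_act // => iz jz.
have := inv _ _ iz jz; have E0 : grp (rkn v (tperm x y i)) = grp (rkn v (tperm x y j)).
  by rewrite iz jz.
move: iz jz E0; case: (tpermP x y i) => [->|->|/eqP ix /eqP iy];
  case: (tpermP x y j) => [->|->|/eqP jx /eqP jy] iz jz E0; rewrite ?E0 ?eqxx // in gxy *.
- by rewrite !ltnn.
- by move: jx jy; rewrite -!val_eqE /=; lia.
- by rewrite !ltnn.
- by move: jx jy; rewrite -!val_eqE /=; lia.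
- by move: ix iy; rewrite -!val_eqE /=; lia.
- by move: ix iy; rewrite -!val_eqE /=; lia.
Qed.

(** Bringing a row of a smaller group to the left is a swap at an ascent of v. There the new
    polynomial is the intertwiner applied to the old one, with a coefficient that has a value at
    a0. *)
Lemma good_sorted v : good v -> exists2 w, good w &
  forall i j : 'I_N, (i < j)%N -> (grp (rkn w i) <= grp (rkn w j))%N.
Proof.
pose W v := (\sum_(i < N) (2 - grp (rkn v i)) * i)%N.
have [d] := ubnP (W v); elim: d v => // d IH v vd gv.
have [/existsP[x /existsP[y /andP[/eqP xy lt]]]|/existsPn H] :=
  boolP [exists x : 'I_N, exists y : 'I_N, (y == x.+1 :> nat) && (grp (rkn v y) < grp (rkn v x))%N];
  last first.
  exists v => //; apply: (adj_trans (r := fun i j => grp (rkn v i) <= grp (rkn v j))%N).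
    by move=> x y z; apply: leq_trans.
  by move=> x y xy; have /existsPn/(_ y) := H x; rewrite xy eqxx /= -leqNgt.
have [st rg iA iB] := gv.
have YX : (rkn v y < rkn v x)%N by move: lt; rewrite /grp; lia.
have vlt : (v x < v y)%N by move: YX; rewrite rkn_lt /before xy; lia.
have vne : v x != v y by rewrite neq_ltn vlt.
have gne : grp (rkn v x) != grp (rkn v y) by rewrite neq_ltn lt orbT.
have xny : x != y by rewrite -val_eqE /=; lia.
apply: (IH (mact (tperm x y) v)).
  apply: leq_trans _ (ltnSE vd).
  have -> : W (mact (tperm x y) v) = (\sum_(i < N) (2 - grp (rkn v (tperm x y i))) * i)%N.
    by apply: eq_bigr => i _; rewrite -{1}(tpermK x y i) rkn_act.
  have := @weight_swap N x y (fun i => 2 - grp (rkn v i))%N xy; apply.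
  by move: lt; rewrite /grp; lia.
split.
- by rewrite star_mact.
- rewrite (E_up (@alpha_generic F) EJ E1 xy vlt); apply: regpD; first exact: regp_msym.
  by apply: regpZ => //; eexists; apply: cc_value.
- by apply: inverted_act => //; rewrite /grp; lia.
- by apply: inverted_act => //; rewrite /grp; lia.
Qed.

(* The part of E_v in the variables of the block of rows A..B+k is again a
   non-symmetric Jack polynomial. *)
Lemma no_good v : good v -> False.
Proof.
case/good_sorted => {}v [st rg iA iB] srt.
(* At most 2k + 1 rows, so that row distances stay at most 2k and [resonance] applies to every
   factor. *)
pose n' := (B - A + k)%N; pose N' := n'.+1.
have AN : (A + N' <= N)%N by rewrite /N' /n'; lia.
have dA i : (rkn v i < A)%N = (i < A)%N.
  rewrite -rkpE; apply: perm_downset => [|x y xy]; first by lia.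
  by rewrite !rkpE => yA; have := srt _ _ xy; rewrite /grp; lia.
have dB i : (rkn v i < A + N')%N = (i < A + N')%N.
  rewrite -rkpE; apply: perm_downset => // x y xy.
  by rewrite !rkpE => yA; have := srt _ _ xy; rewrite /grp /N' /n' in yA *; lia.
pose b := restr AN v.
have gb : glue A v b = v by apply/esym/(@glue_eqP _ _ _ AN).
have bef i j : before v (emb AN i) (emb AN j) = before b i j.
  by rewrite /before !restrE /= ltn_add2l.
(* The A positions left of the block hold the rows before A, and nothing to the right of the block
   ranks before a row of it. *)
have rkb j : rkn v (emb AN j) = (A + rkn b j)%N.
  rewrite !rknE -[X in (X + _)%N](@card_ltn N A) ?(leq_trans _ AN) ?leq_addr //.
  rewrite -(card_imset [set i | before b i j] (@emb_inj _ _ _ AN)).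
  rewrite -cardsUI (_ : _ :&: _ = set0) ?cards0 ?addn0; last first.
    apply/setP => i; rewrite !inE; apply/negP => /andP[iA' /imsetP[i' _ iE]].
    by move: iA'; rewrite iE /=; lia.
  congr #|pred_of_set _|; apply/setP => i; rewrite !inE.
  apply/idP/orP => [bi|[iA'|/imsetP[i' + ->]]]; last by rewrite inE bef.
    have [iA'|iA'] := ltnP i A; [by left|right].
    have : (i < A + N')%N.
      rewrite -dB; apply: leq_ltn_trans (_ : rkn v (emb AN j) < _)%N.
        by apply: ltnW; rewrite rkn_lt.
      by rewrite dB /= ltn_add2l.
    move=> iB'; have /(inblkP AN)[i' iE] : inblk A N' i by rewrite /inblk iA' iB'.
    by rewrite iE; apply/imsetP; exists i' => //; rewrite inE -bef -iE.
  by rewrite -rkn_lt; apply: leq_trans (_ : rkn v i < A)%N _; rewrite ?dA // leqNgt dA /=; lia.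
have ej : joint_eigen a (bar a b) (ext AN v (E v)).
  have vl i : lam (rkn v i) = v i by apply: lamE.
  have := @ext_joint _ N A N' AN v (lam A) (lam (B + k)) _ _ _ _ a (bar a v) (E v) (EJ v) _.
  move=> H j; rewrite (H _ _ _ _ _ j).
  - congr (_ *: _); rewrite !barE restrE rkb natrD; ring.
  - by move=> i iA'; rewrite -vl; apply: lam_mon; have := dA i; lia.
  - by move=> i iA'; rewrite -vl; apply: lam_mon; have := dA i; lia.
  - by move=> i iA'; rewrite -vl; apply: lam_mon; have := dB i; rewrite /N' /n'; lia.
  - by move=> i iA'; rewrite -vl; apply: lam_mon; have := dB i; rewrite /N' /n'; lia.
  - by move=> m /(gen_supp (@alpha_generic F) (EJ v))[].
have := joint_ev1 (@alpha_generic F) ej.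
rewrite coef_ext gb E1 mul1r => evE.
have bl j : b j = lam (A + rkn b j) by rewrite -rkb lamE // restrE.
apply: (@evform_pole _ a0 k p p0 cop a0E n' b (B - A)%N).
- lia.
- by [].
- move=> i j ij; rewrite !bl ij; have := @gapL (A + rkn b i)%N.
  have := rkn_ltN b j; rewrite ij (addnA A) => iN.
  have iN' : (A + rkn b i + k.+1 < N)%N by apply: leq_trans (AN); rewrite -addnA ltn_add2l.
  by move=> /(_ iN'); rewrite (addnS _ p).
- move=> i j [i0|i0] ij; rewrite !bl ij i0; split.
  + have := @iA (emb AN i) (emb AN j); rewrite !rkb ij i0 /= ltn_add2l; apply; lia.
  + by rewrite addn0 add0n tA.
  + have := @iB (emb AN i) (emb AN j); rewrite !rkb ij i0 /= ltn_add2l; apply; lia.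
  + by rewrite addnA subnKC //; lia.
- rewrite -evE; apply: regp_ev1 => m; rewrite coef_ext; exact: rg.
Qed.

End Regularity.

(** * Superpartitions with the same Sekiguchi eigenvalues *)

Section EpsPerm.
Variables (F : numFieldType) (a0 : F) (k p N : nat).
Hypothesis a0E : a0 *+ p + k.+1%:R = 0.

Lemma eps_prod (f : seq nat) : eps N f a0%:P 'X =
  \prod_(t <- [tuple i%:R - a0 *+ nth 0%N f i | i < N]) ('X - t%:P).
Proof.
rewrite /eps big_tuple; apply: eq_bigr => i _; rewrite tnth_mktuple.
by rewrite polyCB !polyCMn polyC1 opprB addrA.
Qed.

(** Both sides are split polynomials in u, so their roots agree up to a permutation; multiplied by
    p, a root is the integer [cval]. *)
Lemma eps_perm (f g : seq nat) : eps N f a0%:P 'X = eps N g a0%:P 'X ->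
  exists s : 'S_N, forall i : 'I_N, cval k p (nth 0%N g) i = cval k p (nth 0%N f) (s i).
Proof.
rewrite !eps_prod => /prod_XsubC_eq; rewrite perm_sym => /tuple_permP[s sE].
exists s => i; have := congr1 (fun t : seq F => nth 0 t i) sE.
rewrite -!tnth_nth !tnth_mktuple => E.
apply/eqP; rewrite -(eqr_nat F) /cval !(natrD _ (k.+1 * _) (p * _)) !natrM.
have -> : k.+1%:R = - (a0 * p%:R) :> F.
  by apply/eqP; rewrite -addr_eq0 addrC mulr_natr a0E.
apply/eqP; have {E} := congr1 (fun x => x * p%:R) E.
rewrite !mulrBl -!(mulr_natr a0) => E.
transitivity ((nth 0%N g i)%:R * - (a0 * p%:R) + i%:R * p%:R); first by ring.
transitivity ((nth 0%N f (s i))%:R * - (a0 * p%:R) + (s i)%:R * p%:R); last by ring.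
transitivity (i%:R * p%:R - a0 * (nth 0%N g i)%:R * p%:R); first by ring.
by rewrite E; ring.
Qed.

End EpsPerm.

Section StrictRows.
Variables (N M : nat).
Local Open Scope nat_scope.

(** Equality of rows x and x + 1 with row x + 1 in I would put row x further left, hence in I as
    well, against strictness. *)
Lemma strict_interlace (m : 'X_{1..N}) x : strict M m -> x.+1 < N ->
  nth 0 (sp_circ M m) x.+1 <= nth 0 (sp_star m) x.
Proof.
move=> /forall_inP st xN; have [i iE] := rkn_onto m (ltnW xN); have [j jE] := rkn_onto m xN.
rewrite -jE -iE nth_circ nth_star.
have : before m i j by rewrite -rkn_lt iE jE.
rewrite /before; have [jM|jM] := ltnP j M; last by lia.
case/orP => [|/andP[/eqP E ij]]; first by lia.
have iI : i \in setI_ N M by rewrite inE; lia.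
have jI : j \in setI_ N M by rewrite inE.
by have /forall_inP/(_ j jI) := st i iI; rewrite ij E ltnn.
Qed.

Lemma weak_gap k p (L : 'X_{1..N}) : strict M L -> weakly_admissible M k p.+1 L -> gap N k p (nth 0 (sp_star L)).
Proof.
move=> st wk x xN; have := wk x.+1; rewrite addSnnS => /(_ xN).
have xN' : x.+1 < N by lia.
by have := @strict_interlace L x st xN'; lia.
Qed.

End StrictRows.

Section Collision.
Variables (N M k p : nat).
Hypotheses (k0 : (0 < k)%N) (cop : coprime k.+1 p).
Variables (L G : 'X_{1..N}) (s S : 'S_N).
Local Notation lam := (nth 0%N (sp_star L)).
Local Notation Lam := (nth 0%N (sp_circ M L)).
Local Notation gam := (nth 0%N (sp_star G)).
Local Notation Gam := (nth 0%N (sp_circ M G)).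
Local Notation c := (cval k p).
Hypotheses (sE : forall i : 'I_N, c gam i = c lam (s i))
  (SE : forall i : 'I_N, c Gam i = c Lam (S i)).
Local Open Scope nat_scope.

Lemma size_star (m : 'X_{1..N}) : size (sp_star m) = N.
Proof. by rewrite size_sort size_parts. Qed.

Lemma size_circ (m : 'X_{1..N}) : size (sp_circ M m) = N.
Proof. by rewrite size_sort size_map size_enum_ord. Qed.

Lemma perm1_eq (u v : seq nat) (t : 'S_N) : size u = N -> size v = N ->
  (forall i : 'I_N, c (nth 0 v) i = c (nth 0 u) (t i)) -> t = 1%g -> u = v.
Proof.
move=> su sv E t1; apply: (@eq_from_nth _ 0); first by rewrite su sv.
move=> i; rewrite su => iN; have := E (Ordinal iN); rewrite t1 perm1 /cval /=.
by move=> H; apply/eqP; rewrite -(eqn_pmul2l (ltn0Sn k)); apply/eqP; lia.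
Qed.

Lemma circ_noninc (m : 'X_{1..N}) x y : x <= y ->
  nth 0 (sp_circ M m) y <= nth 0 (sp_circ M m) x.
Proof. exact: rearr_noninc. Qed.

Lemma star_noninc (m : 'X_{1..N}) x y : x <= y -> nth 0 (sp_star m) y <= nth 0 (sp_star m) x.
Proof. exact: rearr_noninc. Qed.

Lemma eq_of_perm1 : s = 1%g -> S =1 s ->
  sp_star L = sp_star G /\ sp_circ M L = sp_circ M G.
Proof.
move=> s1 Ss; split.
  by apply: perm1_eq sE _; rewrite ?size_star // s1.
by apply: perm1_eq SE _; rewrite ?size_circ //; apply/permP => i; rewrite Ss s1.
Qed.

(** Moderate admissibility leaves no tight pair in the circled partition, so its permutation never
    jumps back. *)
Lemma strong_rigid : strongly_admissible M k p.+1 L ->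
  sp_star L = sp_star G /\ sp_circ M L = sp_circ M G.
Proof.
move=> [mod str].
have gl : gap N k p lam by move=> x /str.
have gL : gap N k p Lam.
  move=> x xN; have := mod x; have := @circ_noninc L (x + k) (x + k.+1); lia.
have Ss := perm_interlace k0 cop gl gL (@circ_interlace N M L) (@circ_interlace N M G) sE SE.
suff S1 : S = 1%g by apply: eq_of_perm1 => //; apply/permP => i; rewrite -Ss S1.
apply: boolp.contrapT => S1.
have [||u [w [_ [[]]]]] := @walk_crossing N k p k0 cop (fun=> False) S _ _ S1.
- by move=> i; apply: (cval_modE k0 cop (SE i)).
- move=> i j ij; left.
  have tf x : x + k < N -> Lam (x + k) + p <= Lam x by move=> /mod; lia.
  have gd x y : x <= y < N -> Gam y <= Gam x by case/andP => xy _; apply: circ_noninc.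
  have [//|[sj /eqP tt _]] := walk_step k0 cop gL tf gd SE ij.
  by have := mod (S i); have := ltn_ord (S j); rewrite sj tt => H /(_ H); lia.
Qed.

Definition collision A B :=
  [/\ A < B <= A + k, B + k < N, lam A = lam (A + k) + p, lam B = lam (B + k) + p &
   [/\ Lam A = (lam A).+1, Lam (A + k) = (lam (A + k)).+1,
       Lam B = (lam B).+1 & Lam (B + k) = (lam (B + k)).+1]].

(** Strictness supplies the drops of both partitions, so one permutation serves both. A jump back is
    then tight in each of them, which under weak admissibility forces the two rows of L to be raised
    in the circled partition. *)
Lemma weak_collision : strict M L -> weakly_admissible M k p.+1 L ->
  (sp_star L = sp_star G /\ sp_circ M L = sp_circ M G) \/
  (~~ strict M G /\ exists A B, collision A B).
Proof.
move=> st wk; have gl := weak_gap st wk.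
have gL : gap N k p Lam.
  move=> x xN; have xN' : x + k < N by lia.
  have xN2 : (x + k).+1 < N by lia.
  by have := wk x xN'; have := @strict_interlace N M L (x + k) st xN2; rewrite (addnS x k); lia.
have Ss := perm_interlace k0 cop gl gL (@circ_interlace N M L) (@circ_interlace N M G) sE SE.
have [s1|/eqP s1] := eqVneq s 1%g; [by left; apply: eq_of_perm1|right].
have tfl x : x + k < N -> lam (x + k) + p <= lam x.
  by move=> xN; have := wk x xN; have := @circ_interlace N M L x; lia.
have tfL x : x + k < N -> Lam (x + k) + p <= Lam x.
  by move=> xN; have := wk x xN; have := @circ_interlace N M L (x + k) xN; lia.
have gdl x y : x <= y < N -> gam y <= gam x by case/andP => xy _; apply: star_noninc.
have gdL x y : x <= y < N -> Gam y <= Gam x by case/andP => xy _; apply: circ_noninc.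
pose P x := exists i : 'I_N, [/\ i = x :> nat, s i + k < N, tight k p lam (s i), tight k p Lam (s i)
   & gam x.-1 = gam x].
have [||u [w [[ku uw wu wN uN]]]] := @walk_crossing N k p k0 cop P s _ _ s1.
- by move=> i; apply: (cval_modE k0 cop (sE i)).
- move=> i j ij.
  have [|[sj t1 g1]] := walk_step k0 cop gl tfl gdl sE ij; first by left.
  right; split => //; exists i; split => //; first by rewrite -sj.
    have [|[_ t2 _]] := walk_step k0 cop gL tfL gdL SE ij; first by rewrite !Ss; lia.
    by rewrite -Ss.
  by rewrite ij /= -ij.
move=> [[i1 [i1E i1N t1 T1 g1]] [i2 [i2E i2N t2 T2 _]] sA sB].
have A1 := sA _ i1E; have B1 : s i2 = i2 by apply: sB; lia.
rewrite A1 in t1 T1 i1N; rewrite B1 i2E in t2 T2.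
have shape x : x + k < N -> tight k p lam x -> tight k p Lam x ->
   [/\ lam x = lam (x + k) + p, Lam x = (lam x).+1 & Lam (x + k) = (lam (x + k)).+1].
  move=> xN /eqP e1 /eqP e2; have := wk x xN; have := @circ_interlace N M L x; have := @circ_interlace N M L (x + k) xN.
  by split; lia.
have [a1 a2 a3] := shape _ i1N t1 T1; have [b1 b2 b3] := shape _ wN t2 T2.
(* The upper pair starts at u - k, the row on which u + 1 lands; the lower one starts at the fixed
   row w. *)
split; last by exists (u - k), w; split => //; lia.
(* In G the rows u and u + 1 are equal, while row u + 1 is raised. *)
apply/negP => stG; have := @strict_interlace N M G u stG uN.
have := sE i1; have := SE i1; rewrite Ss A1 i1E /cval a2 => E1 E2.
have G1 : Gam u.+1 = (gam u.+1).+1.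
  by apply/eqP; rewrite -(eqn_pmul2l (ltn0Sn k)); apply/eqP; lia.
by rewrite G1 -g1 /=; lia.
Qed.

End Collision.

(** * Monomial expansions and specialisation *)

Section BlockMono.
Variables (R : idomainType) (N : nat).
Implicit Types (K : {set 'I_N}) (nu m : 'X_{1..N}) (s : 'S_N) (f g : {mpoly R[N]}).

Definition cut K nu : 'X_{1..N} := [multinom if i \in K then nu i else 0%N | i < N].

Lemma cutE K nu i : cut K nu i = if i \in K then nu i else 0%N.
Proof. by rewrite mnmE. Qed.

Lemma mactM s t m : mact s (mact t m) = mact (s * t)%g m.
Proof. by apply/mnmP => i; rewrite !mactE permM. Qed.

Lemma mact1 m : mact 1%g m = m.
Proof. by apply/mnmP => i; rewrite mactE perm1. Qed.

Lemma prod_cut K nu s :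
  \prod_(i in K) ('X_(s i) : {mpoly R[N]}) ^+ nu i = 'X_[mact s^-1 (cut K nu)].
Proof.
rewrite (mpolyXE R s) big_mkcond; apply: eq_bigr => i _.
by rewrite mactE permK cutE; case: ifP; rewrite ?expr0.
Qed.

Definition blk_mono (b : bool) K nu : {mpoly R[N]} :=
  if b then alt_mono R K nu else sym_mono R K nu.

Lemma monoE M T L : mono R M T L =
  blk_mono (aI T) (setI_ N M) L * blk_mono (aJ T) (setJ_ N M) L.
Proof. by case: T. Qed.

Lemma coef_alt K nu m : (alt_mono R K nu)@_m =
  \sum_(s : 'S_N | perm_on K s) (-1) ^+ s * (mact s^-1 (cut K nu) == m)%:R.
Proof.
rewrite /alt_mono raddf_sum /=; apply: eq_bigr => s _.
by rewrite mcoeffZ prod_cut mcoeffX.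
Qed.

Lemma mpolyX_eq m m' : ('X_[m] == 'X_[m'] :> {mpoly R[N]}) = (m == m').
Proof.
apply/eqP/eqP => [H|->] //; have := congr1 (mcoeff m) H.
by rewrite !mcoeffX eqxx; case: eqP => // _ /eqP; rewrite oner_eq0.
Qed.

Lemma coef_sym K nu m : (sym_mono R K nu)@_m =
  [exists s : 'S_N, perm_on K s && (mact s^-1 (cut K nu) == m)]%:R.
Proof.
rewrite /sym_mono raddf_sum /=; set l := undup _.
have lX p : p \in l -> exists2 s : 'S_N, perm_on K s & p = 'X_[mact s^-1 (cut K nu)].
  rewrite mem_undup => /mapP[s]; rewrite mem_enum => sK ->.
  by exists s => //; rewrite prod_cut.
have E : \sum_(p <- l) p@_m = \sum_(p <- l) (p == 'X_[m])%:R.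
  rewrite big_seq [RHS]big_seq; apply: eq_bigr => p /lX[s _ ->].
  by rewrite mcoeffX mpolyX_eq.
rewrite E; have [/existsP[s /andP[sK /eqP sm]]|/existsPn H] :=
  boolP [exists s : 'S_N, perm_on K s && (mact s^-1 (cut K nu) == m)].
  have Xl : 'X_[m] \in l.
    rewrite mem_undup; apply/mapP; exists s; first by rewrite mem_enum.
    by rewrite prod_cut sm.
  rewrite (bigD1_seq _ Xl (undup_uniq _)) /= eqxx big1 ?addr0 // => p /negPf->.
  by [].
rewrite big_seq big1 // => p /lX[s sK ->]; rewrite mpolyX_eq.
by have := H s; rewrite sK /= => /negPf->.
Qed.

Lemma blk_supp b K nu m : (blk_mono b K nu)@_m != 0 ->
  exists2 s : 'S_N, perm_on K s & m = mact s (cut K nu).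
Proof.
case: b; rewrite /blk_mono ?coef_alt ?coef_sym => nz.
  have [/existsP[s /andP[sK /eqP sm]]|/existsPn H] :=
    boolP [exists s : 'S_N, perm_on K s && (mact s^-1 (cut K nu) == m)].
    by exists s^-1%g => //; apply: perm_onV_mem.
  rewrite big1 ?eqxx // in nz => s sK.
  by have := H s; rewrite sK /= => /negPf->; rewrite mulr0.
move: nz; case: existsP => [[s /andP[sK /eqP sm]] _|_]; last by rewrite eqxx.
by exists s^-1%g => //; apply: perm_onV_mem.
Qed.

Lemma perm_on_tperm K x y : x \in K -> y \in K -> perm_on K (tperm x y).
Proof.
move=> xK yK; apply/subsetP => i; rewrite inE; case: tpermP => [->|->|] //.
by rewrite eqxx.
Qed.

Lemma blk_act b K nu m x y : x \in K -> y \in K -> x != y ->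
  (blk_mono b K nu)@_(mact (tperm x y) m) = (-1) ^+ b * (blk_mono b K nu)@_m.
Proof.
move=> xK yK xy; have tK := perm_on_tperm xK yK.
have sE (s : 'S_N) : (mact s^-1 (cut K nu) == mact (tperm x y) m) =
    (mact ((s * tperm x y)^-1)%g (cut K nu) == m).
  rewrite -(inj_eq (can_inj (mact_tpermK x y))) mact_tpermK mactM.
  by rewrite invMg tpermV.
have on (s : 'S_N) : perm_on K (s * tperm x y)%g = perm_on K s.
  apply/idP/idP => H; last exact: perm_onM.
  by rewrite -[s](mulgK (tperm x y)) tpermV; apply: perm_onM.
case: b; rewrite /blk_mono.
  rewrite !coef_alt mulr_sumr [RHS](reindex_inj (mulIg (tperm x y))) /=.
  apply: eq_big => [s|s _]; first by rewrite on.
  by rewrite sE odd_permM odd_tperm xy addbT signrN expr1 mulN1r mulNr opprK.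
rewrite !coef_sym expr0 mul1r; congr (_%:R); congr nat_of_bool.
apply/existsP/existsP => -[s /andP[sK sm]].
  by exists (s * tperm x y)%g; rewrite on sK -sE.
exists (s * tperm x y)%g; rewrite on sK sE -mulgA tperm2 mulg1.
by [].
Qed.

Lemma blk_lead (b : bool) K nu : (b -> {in K &, injective nu}) -> (blk_mono b K nu)@_(cut K nu) = 1.
Proof.
case: b => inj; rewrite /blk_mono ?coef_alt ?coef_sym; last first.
  rewrite (_ : [exists s, _]) //; apply/existsP; exists 1%g.
  by rewrite perm_on1 invg1 mact1 eqxx.
rewrite (bigD1 1%g) ?perm_on1 //= invg1 mact1 eqxx odd_perm1 mulr1 big1 ?addr0 //.
move=> s /andP[sK s1]; case: eqP => [E|_]; last by rewrite mulr0.
case/eqP: s1; apply: invg_inj; rewrite invg1; apply/permP => i; rewrite perm1.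
have sK' := perm_onV_mem sK.
have [iK|iK] := boolP (i \in K); last by rewrite (out_perm sK' iK).
apply: (inj isT) => //; first by rewrite perm_closed.
have := congr1 (fun h : 'X_{1..N} => h i) E.
by rewrite mactE !cutE perm_closed // iK.
Qed.

Lemma mcoeff_sum f m : \sum_(h <- msupp f) f@_h * (h == m)%:R = f@_m.
Proof.
rewrite [in RHS](mpolyE f) raddf_sum /=; apply: eq_bigr => h _.
by rewrite mcoeffZ mcoeffX.
Qed.

Lemma coef_mul_disjoint (K J : {set 'I_N}) f g m : (forall i, (i \in J) = (i \notin K)) ->
  (forall h, h \in msupp f -> cut K h = h) -> (forall h, h \in msupp g -> cut J h = h) ->
  (f * g)@_m = f@_(cut K m) * g@_(cut J m).
Proof.
move=> KJ sf sg; rewrite {1}(mpolyE f) {1}(mpolyE g) mulr_suml raddf_sum /=.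
rewrite -(mcoeff_sum f) -(mcoeff_sum g) mulr_suml big_seq [RHS]big_seq.
apply: eq_bigr => h hf; rewrite [X in X@_m]mulr_sumr raddf_sum /= [RHS]mulr_sumr big_seq [RHS]big_seq.
apply: eq_bigr => h' hg; rewrite -scalerAl -scalerAr scalerA mcoeffZ -mpolyXD mcoeffX.
rewrite mulrACA -natrM mulnb; congr (_ * (nat_of_bool _)%:R).
apply/eqP/andP => [<-|[/eqP hE /eqP hE']].
  split; apply/eqP/mnmP => i; rewrite cutE mnmDE.
    rewrite -(sf _ hf) -(sg _ hg) !cutE KJ; by case: ifP; rewrite ?addn0.
  rewrite -(sf _ hf) -(sg _ hg) !cutE KJ; by case: (i \in K).
by rewrite hE hE'; apply/mnmP => i; rewrite mnmDE !cutE KJ; case: (i \in K); rewrite ?addn0.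
Qed.

End BlockMono.

Section Mono.
Variables (R : idomainType) (N M : nat).
Implicit Types (m G L : 'X_{1..N}) (f g : {mpoly R[N]}) (K : {set 'I_N}).
Local Notation I := (setI_ N M).
Local Notation J := (setJ_ N M).

Lemma mem_setJ i : (i \in J) = (i \notin I).
Proof. by rewrite !inE -leqNgt. Qed.

Lemma cut_mact K s m : perm_on K s -> cut K (mact s m) = mact s (cut K m).
Proof. by move=> sK; apply/mnmP => i; rewrite !(cutE, mactE) perm_closed. Qed.

Lemma cut_mact_out K K' s m : perm_on K' s -> [disjoint K & K'] -> cut K (mact s m) = cut K m.
Proof.
move=> sK dis; apply/mnmP => i; rewrite !(cutE, mactE); case: ifP => // iK.
by rewrite (out_perm sK) // (disjointFr dis iK).
Qed.

Lemma cut_id K m : cut K (cut K m) = cut K m.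
Proof. by apply/mnmP => i; rewrite !cutE; case: (i \in K). Qed.

Lemma coef_mono T L m : (mono R M T L)@_m =
  (blk_mono R (aI T) I L)@_(cut I m) * (blk_mono R (aJ T) J L)@_(cut J m).
Proof.
rewrite monoE; apply: coef_mul_disjoint; first exact: mem_setJ.
  move=> h; rewrite mcoeff_msupp => /blk_supp[s sK ->].
  by rewrite cut_mact // cut_id.
move=> h; rewrite mcoeff_msupp => /blk_supp[s sK ->].
by rewrite cut_mact // cut_id.
Qed.

(** Symmetry of type T in terms of coefficients and adjacent swaps, a form that passes to
    specialisations one coefficient at a time. *)
Definition csym T f := forall x y m, adj_blk M x y ->
  f@_(mact (tperm x y) m) = (-1) ^+ (if (x < M)%N then aI T else aJ T) * f@_m.

Lemma csym_symP T f : (forall x y, adj_blk M x y ->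
    msym (tperm x y) f = (-1) ^+ (if (x < M)%N then aI T else aJ T) *: f) -> csym T f.
Proof. by move=> H x y m adj; rewrite -mcoeff_mact H // mcoeffZ. Qed.

Lemma csymD T f g : csym T f -> csym T g -> csym T (f + g).
Proof. by move=> H1 H2 x y m adj; rewrite !mcoeffD H1 // H2 // mulrDr. Qed.

Lemma csymZ T c f : csym T f -> csym T (c *: f).
Proof. by move=> H x y m adj; rewrite !mcoeffZ H // mulrCA. Qed.

Lemma csym0 T : csym T 0.
Proof. by move=> x y m adj; rewrite !mcoeff0 mulr0. Qed.

Lemma csym_mono T L : csym T (mono R M T L).
Proof.
move=> x y m /andP[/eqP xy /eqP blk]; rewrite !coef_mono.
have nxy : x != y by rewrite -val_eqE /=; lia.
have dis := disjIJ N M.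
have [xM|xM] := boolP (x < M)%N.
  have xI : x \in I by rewrite inE.
  have yI : y \in I by rewrite inE -blk.
  have tI := perm_on_tperm xI yI.
  rewrite (cut_mact _ tI) (cut_mact_out _ tI); last by rewrite disjoint_sym.
  by rewrite blk_act // mulrA.
have xJ : x \in J by rewrite mem_setJ inE.
have yJ : y \in J by rewrite mem_setJ inE -blk.
have tJ := perm_on_tperm xJ yJ.
by rewrite (cut_mact _ tJ) (cut_mact_out _ tJ) // blk_act // mulrCA.
Qed.

Lemma mono_supp T L m : (mono R M T L)@_m != 0 -> m \in orb M L.
Proof.
rewrite coef_mono mulf_eq0 negb_or => /andP[/blk_supp[s sI sE] /blk_supp[t tJ tE]].
have sb i : (s i < M)%N = (i < M)%N by have := perm_closed i sI; rewrite !inE.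
have tb i : (t i < M)%N = (i < M)%N.
  by have := perm_closed i tJ; rewrite !inE !ltnNge => ->.
apply/orbP; exists (s * t)%g; first by apply/blkpermP => i; rewrite permM tb sb.
apply/mnmP => i; rewrite -mactM !mactE.
have [iI|iI] := boolP (i \in I).
  have := congr1 (fun h : 'X_{1..N} => h i) sE; rewrite mactE !cutE perm_closed // iI => ->.
  by rewrite (out_perm tJ) // mem_setJ perm_closed // iI.
have := congr1 (fun h : 'X_{1..N} => h i) tE; rewrite mactE !cutE perm_closed // mem_setJ iI => ->.
by rewrite (out_perm sI).
Qed.

Lemma in_indexE T L : in_index M T L =
  [&& superpartition M L, aI T ==> strict M L & aJ T ==> decr_on J L].
Proof. by case: T; rewrite /in_index /= ?andbT. Qed.

Lemma decr_on_inj K L : decr_on K L -> {in K &, injective L}.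
Proof.
move=> /forall_inP H i j iK jK E; have [lt|lt|/val_inj//] := ltngtP i j.
  by have /forall_inP/(_ j jK) := H i iK; rewrite lt E ltnn.
by have /forall_inP/(_ i iK) := H j jK; rewrite lt E ltnn.
Qed.

Lemma in_index_inj T L : in_index M T L ->
  (aI T -> {in I &, injective L}) /\ (aJ T -> {in J &, injective L}).
Proof.
rewrite in_indexE => /and3P[_ /implyP h1 /implyP h2].
by split=> [/h1|/h2]; apply: decr_on_inj.
Qed.

Lemma mono_lead T L : in_index M T L -> (mono R M T L)@_L = 1.
Proof. by move=> /in_index_inj[h1 h2]; rewrite coef_mono !blk_lead // mulr1. Qed.

Lemma mono_index T L G : in_index M T L -> in_index M T G ->
  (mono R M T L)@_G = (G == L)%:R.
Proof.
move=> iL iG; have [->|ne] := eqVneq G L; first exact: mono_lead.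
apply/eqP; apply: contraNT ne => /mono_supp; rewrite !in_indexE in iL iG.
by move=> GO; apply/eqP/(@orb_superpartition _ M) => //; [case/and3P: iL | case/and3P: iG].
Qed.

End Mono.

Section Sorting.
Variables (F : numFieldType) (N M : nat).
Implicit Types (m G L : 'X_{1..N}) (f : {mpoly F[N]}).

Lemma adj_decr (K : {set 'I_N}) m (B : pred 'I_N) : (forall i, (i \in K) = B i) ->
  (forall x y z : 'I_N, (x < y < z)%N -> B x -> B z -> B y) ->
  (forall x y : 'I_N, y = x.+1 :> nat -> B x -> B y -> (m y < m x)%N) -> decr_on K m.
Proof.
move=> KB cB H.
have Rr : forall x y : 'I_N, (x < y)%N -> (x < y)%N && ((B x && B y) ==> (m y < m x)%N).
  apply: adj_trans => [x y z /andP[xy /implyP Hxy] /andP[yz /implyP Hyz]|x y xy].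
    rewrite (ltn_trans xy yz) /=; apply/implyP => /andP[Bx Bz].
    have By : B y by apply: cB Bx Bz; rewrite xy yz.
    by apply: ltn_trans (Hyz _) (Hxy _); rewrite ?By ?Bx ?Bz.
  by rewrite xy ltnSn /=; apply/implyP => /andP[Bx By]; apply: H.
apply/forall_inP => i; rewrite KB => Bi; apply/forall_inP => j; rewrite KB => Bj.
by apply/implyP => ij; have /andP[_ /implyP] := Rr _ _ ij; apply; rewrite Bi Bj.
Qed.

(** Swaps inside a block change a coefficient by a sign at most, so m can be sorted; a tie in an
    antisymmetric block would make the coefficient its own opposite. *)
Lemma csym_sort T f m : csym M T f -> f@_m != 0 ->
  exists G, [/\ in_index M T G, G \in orb M m & f@_G != 0].
Proof.
move=> cf; have [d] := ubnP (weight m); elim: d m => // d IH m md fm.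
have [/existsP[x /existsP[y /andP[adj lt]]]|/existsPn H] :=
  boolP [exists x, exists y, adj_blk M x y && (m x < m y)%N].
  have [/eqP xy _] := andP adj.
  have [||G [iG GO fG]] := IH (mact (tperm x y) m).
  - have -> : weight (mact (tperm x y) m) = (\sum_(i < N) m (tperm x y i) * i)%N.
      by apply: eq_bigr => i _; rewrite mactE.
    by apply: leq_trans (weight_swap xy lt) _; rewrite -/(weight m); lia.
  - by rewrite cf // mulf_neq0 // expf_neq0 // oppr_eq0 oner_eq0.
  exists G; split => //; case/orbP: GO => s bs ->.
  apply: orb_act => //; apply: orb_act; first exact: blkperm_adj.
  exact: orb_refl.
exists m; split => //; last exact: orb_refl.
have nolt x y : adj_blk M x y -> (m y <= m x)%N.
  by move=> adj; have /existsPn/(_ y) := H x; rewrite adj /= -leqNgt.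
have notie x y : adj_blk M x y -> (if (x < M)%N then aI T else aJ T) -> (m y < m x)%N.
  move=> adj anti; rewrite ltn_neqAle nolt // andbT; apply: contraNneq fm => E.
  have := cf x y m adj; rewrite anti expr1 mulN1r.
  have -> : mact (tperm x y) m = m.
    by apply/mnmP => i; rewrite mactE; case: tpermP => [->|->|].
  by move/eqP; rewrite -addr_eq0 -mulr2n mulrn_eq0.
rewrite in_indexE superpartition_adj //=; apply/andP; split; apply/implyP => aT.
  apply: (@adj_decr _ _ (fun i => i < M)%N) => [i|x y z|x y xy xM yM]; first by rewrite inE.
    by lia.
  have adj : adj_blk M x y by rewrite /adj_blk xM yM xy !eqxx.
  by apply: (notie _ _ adj); rewrite xM.
apply: (@adj_decr _ _ (fun i => M <= i)%N) => [i|x y z|x y xy xM yM]; first by rewrite inE.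
  by lia.
have xM' : (x < M)%N = false by lia.
have adj : adj_blk M x y by rewrite /adj_blk xM' xy eqxx; lia.
by apply: (notie _ _ adj); rewrite xM'.
Qed.

Lemma csym_eq T f g : csym M T f -> csym M T g ->
  (forall G, in_index M T G -> f@_G = g@_G) -> f = g.
Proof.
move=> cf cg H; apply/mpolyP => m; apply/eqP; rewrite -subr_eq0 -mcoeffB.
apply: contraT => nz; have cd : csym M T (f - g).
  by rewrite -scaleN1r; apply: csymD => //; apply: csymZ.
have [G [iG _]] := csym_sort cd nz; by rewrite mcoeffB H // subrr eqxx.
Qed.

Lemma sp_gt_irr L : sp_gt M L L = false.
Proof. by rewrite /sp_gt /dom_gt !eqxx. Qed.

Lemma sp_gt_neq L G : sp_gt M L G -> ~ (sp_star L = sp_star G /\ sp_circ M L = sp_circ M G).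
Proof. by move=> gt [E1 E2]; move: gt; rewrite /sp_gt /dom_gt E1 E2 !eqxx. Qed.

Lemma sum_bounded (d : nat) (P : pred 'X_{1..N}) (V : zmodType) (c : 'X_{1..N} -> V) m :
  (forall G, P G -> G != m -> c G = 0) ->
  \sum_(G : 'X_{1..N < d} | P G) c G = if (mdeg m < d)%N && P m then c m else 0.
Proof.
move=> H; have [md|md] /= := ltnP (mdeg m) d; last first.
  rewrite big1 // => G PG; apply: H => //; apply: contraTneq md => <-.
  by rewrite -ltnNge bmdeg.
case: ifP => Pm; last first.
  by rewrite big1 // => G PG; apply: H => //; apply: contraFneq Pm => <-.
rewrite (bigD1 (BMultinom md)) //= big1 ?addr0 // => G /andP[PG ne].
by apply: H.
Qed.

Lemma triangularP T L f : in_index M T L ->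
  triangular M T L f <->
  [/\ csym M T f, f@_L = 1 &
    forall G, in_index M T G -> G != L -> f@_G != 0 -> mdeg G = mdeg L /\ sp_gt M L G].
Proof.
move=> iL; set P := fun G => [&& in_index M T G, mdeg G == mdeg L & sp_gt M L G].
have csum c : csym M T (mono F M T L + \sum_(G : 'X_{1..N < (mdeg L).+1} | P G) c (G : 'X_{1..N}) *: mono F M T G).
  apply: csymD; first exact: csym_mono.
  elim/big_ind: _ => [|f1 f2|G _]; [exact: csym0 | exact: csymD | exact/csymZ/csym_mono].
have coef c G : in_index M T G ->
   (mono F M T L + \sum_(G : 'X_{1..N < (mdeg L).+1} | P G) c (G : 'X_{1..N}) *: mono F M T G)@_G =
   (G == L)%:R + if P G then c G else 0.
  move=> iG; rewrite mcoeffD mono_index // raddf_sum /=; congr (_ + _).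
  under eq_bigr => H /and3P[iH _ _] do rewrite mcoeffZ mono_index //.
  rewrite (@sum_bounded _ P _ (fun H => c H * (G == H)%:R) G) ?eqxx ?mulr1.
    case PG : (P G); last by rewrite andbF.
    by case/and3P: PG => _ /eqP->; rewrite ltnSn.
  by move=> H _ /negPf; rewrite eq_sym => ->; rewrite mulr0.
split=> [[c ->]|[cf fL H]].
  split; first exact: csum.
    by rewrite coef // eqxx /P sp_gt_irr !andbF addr0.
  move=> G iG ne; rewrite coef // (negPf ne) add0r.
  by case: ifP => [/and3P[_ /eqP]|]; rewrite ?eqxx.
exists (fun G => f@_G); apply: (@csym_eq T) => // [|G iG]; first exact: (csum (fun G => f@_G)).
apply: etrans (esym (coef (fun G => f@_G) G iG)).
have [->|ne] := eqVneq G L; first by rewrite fL /P sp_gt_irr !andbF addr0.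
rewrite add0r; case: ifP => // PG; apply/eqP; apply: contraFT PG => nz.
by have [dG gt] := H _ iG ne nz; rewrite /P iG dG eqxx gt.
Qed.

End Sorting.

(** * Specialisation of alpha *)

Section RingRelation.
(** Evaluation at a0 is defined on part of F(alpha) only, so it is handled as a relation compatible
    with the ring operations rather than as a morphism. *)
Variables (R S : idomainType) (rl : R -> S -> Prop).
Hypotheses (rl0 : rl 0 0) (rl1 : rl 1 1)
  (rlD : forall x x' y y', rl x y -> rl x' y' -> rl (x + x') (y + y'))
  (rlM : forall x x' y y', rl x y -> rl x' y' -> rl (x * x') (y * y'))
  (rlN : forall x y, rl x y -> rl (- x) (- y)).

Lemma rel_muln x y n : rl x y -> rl (x *+ n) (y *+ n).
Proof.
move=> H; elim: n => [|n IH]; first by rewrite !mulr0n.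
by rewrite !mulrS; apply: rlD.
Qed.

Lemma rel_nat n : rl n%:R n%:R. Proof. exact: rel_muln. Qed.

Lemma rel_sum (I : Type) (s : seq I) (P : pred I) f g :
  (forall i, P i -> rl (f i) (g i)) -> rl (\sum_(i <- s | P i) f i) (\sum_(i <- s | P i) g i).
Proof. by move=> H; elim/big_rec2: _ => // i x y Pi; apply: rlD; apply: H. Qed.

Lemma rel_prod (I : Type) (s : seq I) (P : pred I) f g :
  (forall i, P i -> rl (f i) (g i)) -> rl (\prod_(i <- s | P i) f i) (\prod_(i <- s | P i) g i).
Proof. by move=> H; elim/big_rec2: _ => // i x y Pi; apply: rlM; apply: H. Qed.

Lemma rel_eps N lam a b u v : rl a b -> rl u v -> rl (eps N lam a u) (eps N lam b v).
Proof.
move=> ab uv; apply: rel_prod => i _; apply: rlD; last exact/rlN/rel_nat.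
by apply: rlD => //; apply: rel_muln.
Qed.

Variable N : nat.
Definition mrel (p : {mpoly R[N]}) (q : {mpoly S[N]}) := forall m, rl p@_m q@_m.

(** Gives two related polynomials a common list of monomials, as their supports may differ. *)
Lemma coef_cherednik_sub (A : idomainType) (a : A) j (p : {mpoly A[N]}) k (s : seq 'X_{1..N}) :
  uniq s -> {subset msupp p <= s} ->
  (cherednik a j p)@_k = \sum_(m <- s) p@_m * (cherednik a j 'X_[m])@_k.
Proof.
move=> us sub; rewrite coef_cherednik [RHS](bigID (fun m => m \in msupp p)) /=.
rewrite [X in _ = _ + X]big1 ?addr0; last by move=> m /memN_msupp_eq0->; rewrite mul0r.
rewrite -[RHS]big_filter; apply: perm_big; apply: uniq_perm.
- exact: msupp_uniq.
- exact: filter_uniq.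
- by move=> m; rewrite mem_filter; case: (boolP (m \in msupp p)) => //= /sub->.
Qed.

Lemma mrel_cherednik a b j p q : rl a b -> mrel p q -> mrel (cherednik a j p) (cherednik b j q).
Proof.
move=> ab pq k; pose s := undup (msupp p ++ msupp q).
rewrite !(@coef_cherednik_sub _ _ _ _ _ s) ?undup_uniq //; last 2 first.
- by move=> m mq; rewrite mem_undup mem_cat mq orbT.
- by move=> m mq; rewrite mem_undup mem_cat mq.
apply: rel_sum => m _; apply: rlM => //; rewrite !coef_cherednikX.
apply: rlD; first apply: rlD.
- apply: rlM; first exact: rel_nat.
  by apply: rlD; [apply: rel_muln | apply/rlN/rel_nat].
- by apply: rel_sum => i _; apply: rlD; [exact: rel_nat | apply/rlN/rel_nat].
- by apply: rel_sum => i _; apply: rlD; [exact: rel_nat | apply/rlN/rel_nat].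
Qed.

Lemma mrelZ c d p q : rl c d -> mrel p q -> mrel (c *: p) (d *: q).
Proof. by move=> H1 H2 m; rewrite !mcoeffZ; apply: rlM. Qed.

Lemma mrel_sek w w' a b p q : (forall j, rl (w j) (w' j)) -> rl a b -> mrel p q ->
  mrel (sek w a p) (sek w' b q).
Proof.
move=> ww ab pq; rewrite /sek; elim: (enum _) => [|i s IH] //= m.
rewrite [X in rl X _]mcoeffD [X in rl _ X]mcoeffD.
exact: rlD (mrelZ (ww i) IH m) (mrel_cherednik i ab IH m).
Qed.

End RingRelation.

(** * Reversal inside the blocks and the index [eta_of] *)

Section Reversal.
Variables (N lo hi : nat).
Hypothesis hN : (hi <= N)%N.

Definition rvn (i : 'I_N) : nat := if (lo <= i < hi)%N then (lo + hi - i.+1)%N else i.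

Lemma rvn_lt i : (rvn i < N)%N.
Proof. by rewrite /rvn; case: ifP; have := ltn_ord i; lia. Qed.

Definition rvo i := Ordinal (rvn_lt i).

Lemma rvoK : involutive rvo.
Proof. by move=> i; apply/val_inj; rewrite /= /rvn /= /rvn; case: ifP; case: ifP; lia. Qed.

Definition rvp : 'S_N := perm (can_inj rvoK).

Lemma rvpE i : rvp i = rvn i :> nat. Proof. by rewrite permE. Qed.

End Reversal.

Section Eta.
Variables (N M : nat).
Hypothesis MN : (M <= N)%N.
Implicit Types L : 'X_{1..N}.

Lemma rvp_I : perm_on (setI_ N M) (rvp 0 MN).
Proof.
apply/subsetP => i; rewrite !inE; apply: contraR => iM.
by apply/eqP/val_inj; rewrite /= rvpE /rvn; case: ifP => //; lia.
Qed.

Lemma rvp_J : perm_on (setJ_ N M) (rvp M (leqnn N)).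
Proof.
apply/subsetP => i; rewrite !inE; apply: contraR => iM.
by apply/eqP/val_inj; rewrite /= rvpE /rvn; case: ifP => //; lia.
Qed.

Lemma rvpE2 i : rvp 0 MN (rvp M (leqnn N) i) =
  (if (i < M)%N then M - i.+1 else N + M - i.+1)%N :> nat.
Proof.
rewrite rvpE /rvn rvpE /rvn ltn_ord andbT /= add0n; have iN := ltn_ord i.
have [iM|iM] := ltnP i M; first by rewrite iM.
have -> : (M + N - i.+1 < M)%N = false by lia.
by rewrite addnC.
Qed.

Lemma etaE L : eta_of M L = mact (rvp M (leqnn N)) (mact (rvp 0 MN) L).
Proof.
apply/mnmP => i; rewrite mnmE !mactE.
have iN := ltn_ord i.
have szt : size (take M (parts L)) = M by rewrite size_takel // size_parts.
have szd : size (drop M (parts L)) = (N - M)%N by rewrite size_drop size_parts.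
rewrite nth_cat size_rev szt; case: ifP => iM.
  rewrite nth_rev ?szt // nth_take; last by lia.
  set j := (rvp 0 MN _); have -> : (M - i.+1)%N = j :> nat.
    by rewrite /j rvpE2 iM.
  by rewrite nth_parts.
rewrite nth_rev ?szd; last by lia.
rewrite nth_drop; set j := (rvp 0 MN _).
have -> : (M + (N - M - (i - M).+1))%N = j :> nat.
  by rewrite /j rvpE2 iM; lia.
by rewrite nth_parts.
Qed.

Lemma eta_orb L : eta_of M L \in orb M L.
Proof.
apply/orbP; exists (rvp M (leqnn N) * rvp 0 MN)%g; last by rewrite etaE mactM.
apply/blkpermP => i; rewrite permM rvpE2.
by have := ltn_ord i; case: (ltnP i M); lia.
Qed.

Lemma eta_incr L : superpartition M L -> incr_blk M (eta_of M L).
Proof.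
move=> sL i j blk ij.
have iN := ltn_ord i; have jN := ltn_ord j.
rewrite etaE !mactE; set i' := rvp 0 MN _; set j' := rvp 0 MN _.
have i'E : i' = (if (i < M)%N then M - i.+1 else N + M - i.+1)%N :> nat.
  by rewrite /i' rvpE2.
have j'E : j' = (if (j < M)%N then M - j.+1 else N + M - j.+1)%N :> nat.
  by rewrite /j' rvpE2.
have lt : (j' < i')%N by rewrite i'E j'E -blk; case: ifP; lia.
have [iM|iM] := boolP (i < M)%N.
  by apply: (superpartition_leI sL) lt; rewrite ?i'E ?j'E -?blk iM; lia.
by apply: (superpartition_leJ sL) lt; rewrite ?i'E ?j'E -?blk (negPf iM); lia.
Qed.

End Eta.

Section NsJack.
Variables (F : numFieldType) (n : nat).
Local Notation N := n.+1.
Local Notation a := (alpha_gen F).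
Implicit Types v : 'X_{1..N}.

(** The eigenfunction built by intertwiners has its support below v for [cle], which is contained in
    the order of the definition. *)
Lemma nsJack_spec v : is_nsJack v (nsJack F v).
Proof.
rewrite /nsJack; apply: classical_sets.xgetPex.
have [f [ej f1 _]] := nsData_exists (@alpha_generic F) v.
exists f; split => //; exists (fun m => f@_m); apply/mpolyP => m.
rewrite mcoeffD mcoeffX raddf_sum /=.
under eq_bigr => h _ do rewrite mcoeffZ mcoeffX.
rewrite (@sum_bounded _ _ (comp_gt v) _ (fun h => f@_h * (h == m)%:R) m); last first.
  by move=> h _ /negPf->; rewrite mulr0.
rewrite eqxx mulr1; have [<-|ne] := eqVneq v m.
  by rewrite f1 /comp_gt eqxx andbF addr0.
rewrite add0r; have [fm|fm] := boolP (m \in msupp f); last first.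
  by rewrite (memN_msupp_eq0 fm) if_same.
have [mv _] := gen_supp (@alpha_generic F) ej fm.
by rewrite (cle_comp_gt mv ne) andbT; case: mv => -> _ _; rewrite ltnSn.
Qed.

Lemma nsJack_joint v : joint_eigen a (bar a v) (nsJack F v).
Proof. by case: (nsJack_spec v). Qed.

Lemma nsJack_lead v : (nsJack F v)@_v = 1.
Proof.
have [[c ->] _] := nsJack_spec v; rewrite mcoeffD mcoeffX raddf_sum /= eqxx.
under eq_bigr => h _ do rewrite mcoeffZ mcoeffX.
rewrite (@sum_bounded _ _ (comp_gt v) _ (fun h => c h * (h == v)%:R) v); last first.
  by move=> h _ /negPf->; rewrite mulr0.
by rewrite /comp_gt eqxx andbF addr0.
Qed.

End NsJack.

(** * Existence and uniqueness at the special value *)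

Section Main.
Variables (F : numFieldType) (k p n M : nat) (T : symtype) (L : 'X_{1..n.+1}) (a0 : F).
Local Notation N := n.+1.
Local Notation K := (ratfun F).
Local Notation a := (alpha_gen F).
Hypotheses (k0 : (0 < k)%N) (p0 : (0 < p)%N) (cop : coprime k.+1 p).
Hypotheses (a0E : a0 *+ p + k.+1%:R = 0) (MN : (M <= N)%N) (iL : in_index M T L).
Local Notation E := (@nsJack F N).
Local Notation gen := (@alpha_generic F).
Local Notation J := (jack F M T L).
Local Notation val := (ratfun_value a0).

Let sL : superpartition M L. Proof. by move: iL; rewrite in_indexE => /and3P[]. Qed.

Lemma jack_span : orb_span E M L J.
Proof. by apply/spanZ/(span_sym gen (@nsJack_joint F n) (@nsJack_lead F n))/span_E/eta_orb. Qed.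

Lemma jack_lead : J@_L = 1.
Proof.
rewrite mcoeffZ mulVf //; have [h1 h2] := in_index_inj iL.
have H := sym_coef_neq0 gen (@nsJack_joint F n) (@nsJack_lead F n)
  (eta_incr MN sL) (rvp_I MN) (rvp_J MN) (etaE MN L) h1 h2.
exact: H.
Qed.

Lemma jack_sym x y : adj_blk M x y ->
  msym (tperm x y) J = (-1) ^+ (if (x < M)%N then aI T else aJ T) *: J.
Proof.
move=> /(sym_adj T (E (eta_of M L))); rewrite /jack.
move: (symmetrizer M T _) => Q; move: (Q@_L)^-1 => c H.
by rewrite msymZ H !scalerA mulrC.
Qed.

(** G lies below some v in the orbit of L, and v has the partitions of L; were both partitions of G
    equal to these, G would be L. *)
Lemma jack_supp G : in_index M T G -> G != L -> J@_G != 0 ->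
  mdeg G = mdeg L /\ sp_gt M L G.
Proof.
rewrite in_indexE => /and3P[sG _ _] GL; have [q ->] := jack_span.
rewrite raddf_sum /= => nz.
have [v vO Gv] : exists2 v, v \in orb M L & G \in msupp (E v).
  apply: boolp.contrapT => H; move: nz; rewrite big_seq big1 ?eqxx // => v vO.
  rewrite mcoeffZ (_ : (E v)@_G = 0) ?mulr0 //; apply: memN_msupp_eq0.
  by apply/negP => Gv; apply: H; exists v.
have [cl _] := gen_supp gen (@nsJack_joint F n v) Gv.
split; first by case: (cl) => -> _ _; apply: orb_mdeg vO.
have dm := cle_dom cl; rewrite (orb_star vO) in dm.
rewrite /sp_gt; have [st|st] := eqVneq (sp_star L) (sp_star G); last first.
  by rewrite /dom_gt st dm.
have dc := @cle_dom_circ _ M _ _ cl; rewrite (orb_star vO) (orb_circ vO) in dc.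
apply/orP; right; rewrite /dom_gt dc // andbT.
by apply: contraNneq GL => ci; apply/eqP/(star_circ_inj sL sG).
Qed.

Hypothesis Jreg : no_pole_at a0 J.
Local Notation P0 := (jack_at a0 M T L).

Lemma jack_value m : val J@_m P0@_m.
Proof.
have [y Jy] := Jreg m; suff -> : P0@_m = y by [].
rewrite /jack_at /map_mpoly /mmap raddf_sum /=.
under eq_bigr => h _ do rewrite mmap1_id mul_mpolyC mcoeffZ mcoeffX.
have [mJ|mJ] := boolP (m \in msupp J).
  rewrite (bigD1_seq m mJ (msupp_uniq _)) /= eqxx mulr1 big1 ?addr0; first exact: value_eval.
  by move=> h /negPf->; rewrite mulr0.
rewrite big_seq big1; last first.
  by move=> h hJ; case: eqP => [hm|_]; rewrite ?mulr0 //; rewrite -hm hJ in mJ.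
by move: Jy; rewrite (memN_msupp_eq0 mJ) => /(value_uniq (value_nat a0 0)).
Qed.

Lemma jack_at_triangular : triangular M T L P0.
Proof.
apply/(triangularP _ iL); split.
- move=> x y m adj; apply: value_uniq (jack_value _) _.
  rewrite (csym_symP jack_sym) //; apply: valueM (jack_value _).
  case: (if _ then _ else _ : bool); last exact: (value_nat a0 1).
  by rewrite !expr1; apply: valueN; exact: (value_nat a0 1).
- by have := jack_value L; rewrite jack_lead => /value_uniq; apply; exact: (value_nat a0 1).
- move=> G iG GL nz; apply: jack_supp => //; apply: contraNneq nz => J0.
  by have := jack_value G; rewrite J0 => H; rewrite (value_uniq H (value_nat a0 0)).
Qed.

Definition pvalue (f : {poly K}) (g : {poly F}) := forall i, val f`_i g`_i.

(** The equations over F(alpha)[u] specialise coefficient by coefficient in u, and a value at a0 is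
    unique when it exists. *)
Lemma jack_at_eigen : sekiguchi_eigen a0 M L P0.
Proof.
have v0 : val 0 0 := value_nat a0 0.
have r0 : pvalue 0 0 by move=> i; rewrite !coef0.
have rC c y : val c y -> pvalue c%:P y%:P by move=> H i; rewrite !coefC; case: ifP.
have r1 : pvalue 1 1 by apply: rC; exact: (value_nat a0 1).
have rD f f' g g' : pvalue f g -> pvalue f' g' -> pvalue (f + f') (g + g').
  by move=> H1 H2 i; rewrite !coefD; apply: valueD.
have rN f g : pvalue f g -> pvalue (- f) (- g).
  by move=> H i; rewrite !coefN; apply: valueN.
have rM f f' g g' : pvalue f g -> pvalue f' g' -> pvalue (f * f') (g * g').
  move=> H1 H2 i; rewrite !coefM; apply: (rel_sum v0).
    by move=> *; apply: valueD.
  by move=> j _; apply: valueM.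
have rX : pvalue 'X 'X by move=> i; rewrite !coefX; apply: value_nat.
have ra : pvalue a%:P a0%:P by apply/rC/value_alpha.
have rJ : mrel pvalue (map_mpoly polyC J) (map_mpoly polyC P0).
  by move=> m; rewrite !mcoeff_map_mpoly /=; apply/rC/jack_value.
have uq f g g' : pvalue f g -> pvalue f g' -> g = g'.
  by move=> H1 H2; apply/polyP => i; apply: value_uniq (H1 i) (H2 i).
have [s1 s2] := span_eigen (@nsJack_joint F n) jack_span.
split; apply/mpolyP => m.
  move: s1; rewrite !sek_starE => s1.
  have h1 := mrel_sek r0 r1 rD rM rN (w := fun=> 'X) (w' := fun=> 'X) (fun=> rX) ra rJ.
  have h2 := mrelZ rM (rel_eps r0 r1 rD rM rN N (sp_star L) ra rX) rJ.
  by apply: uq (h1 m) _; rewrite s1; apply: h2.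
move: s2; rewrite !sek_circE => s2.
have rw (j : 'I_N) : pvalue ('X + a%:P *+ (j < M)%N) ('X + a0%:P *+ (j < M)%N).
  by apply: (rD) => //; apply: (rel_muln r0 rD).
have h1 := mrel_sek r0 r1 rD rM rN rw ra rJ.
have h2 := mrelZ rM (rel_eps r0 r1 rD rM rN N (sp_circ M L) ra rX) rJ.
by apply: uq (h1 m) _; rewrite s2; apply: h2.
Qed.

(** The four rows of a collision stand in block I, where the entries of [eta_of M L] increase; so
    both tight pairs are inverted from the start. *)
Lemma no_collision A B : aI T = false -> strict M L -> weakly_admissible M k p.+1 L ->
  collision M k p L A B -> False.
Proof.
move=> aT st wk [AB BN tA tB [cA cAk cB cBk]].
have gl : gap N k p (nth 0%N (sp_star L)) := weak_gap st wk.
have [q qE] := jack_span.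
have qL : q L = 1 by rewrite -(span_top gen (@nsJack_joint F n) (@nsJack_lead F n) q sL) -qE jack_lead.
have rgE : regp a0 (E (eta_of M L)).
  apply: (orb_reg k0 p0 cop a0E (@nsJack_joint F n) (@nsJack_lead F n) gl wk sL aT qL).
  - by rewrite -qE.
  - by rewrite -qE; exact: jack_sym.
  - exact: eta_orb.
have inc := eta_incr MN sL.
have inv x : nth 0%N (sp_star L) x = (nth 0%N (sp_star L) (x + k) + p)%N ->
    nth 0%N (sp_circ M L) x = (nth 0%N (sp_star L) x).+1 ->
    nth 0%N (sp_circ M L) (x + k) = (nth 0%N (sp_star L) (x + k)).+1 ->
    inverted k (eta_of M L) x.
  move=> t1 c1 c2 i j iE jE; have eO := eta_orb MN L.
  move: t1 c1 c2; rewrite -(orb_star eO) -(orb_circ eO) -jE -iE !nth_star !nth_circ => t1 c1 c2.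
  have [ij|ij|ij] := ltngtP i j => //.
    by have := inc i j; move: c1 c2; case: (i < M)%N; case: (j < M)%N; lia.
  by move: t1; rewrite (val_inj ij); lia.
refine (no_good k0 p0 cop a0E (@nsJack_joint F n) (@nsJack_lead F n) gl AB BN tA tB
  (v := eta_of M L) _).
split; first by rewrite (orb_star (eta_orb MN L)).
- exact: rgE.
- exact: inv.
- exact: inv.
Qed.

Lemma eigen_top f g : sekiguchi_eigen a0 M L f -> top_at g f -> f@_g != 0 ->
  eps N (sp_star L) a0%:P 'X = eps N (sp_star g) a0%:P 'X /\
  eps N (sp_circ M L) a0%:P 'X = eps N (sp_circ M g) a0%:P 'X.
Proof.
move=> [e1 e2] tf fg.
have tf' : top_at g (map_mpoly polyC f).
  by move=> m gm mg; rewrite mcoeff_map_mpoly /= tf // polyC0.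
have fg' : (map_mpoly polyC f)@_g != 0 by rewrite mcoeff_map_mpoly /= polyC_eq0.
move: e1 e2; rewrite sek_starE sek_circE => e1 e2; split; apply: (mulIf fg').
  by have := sek_top (fun=> 'X) a0%:P tf'; rewrite e1 mcoeffZ (eps_star _ _ g) => ->.
have := sek_top (fun j : 'I_N => 'X + a0%:P *+ (j < M)%N) a0%:P tf'.
by rewrite e2 mcoeffZ (eps_circ _ _ _ g) => ->.
Qed.

Lemma eigenB f g : sekiguchi_eigen a0 M L f -> sekiguchi_eigen a0 M L g ->
  sekiguchi_eigen a0 M L (f - g).
Proof.
move=> [f1 f2] [g1 g2]; rewrite /sekiguchi_eigen /= raddfB /= sek_starE sek_circE.
move: f1 f2 g1 g2; rewrite !sek_starE !sek_circE => f1 f2 g1 g2.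
by rewrite !linearB /= f1 f2 g1 g2.
Qed.

Hypothesis adm : admissible M k p.+1 L.

Lemma jack_at_unique P : triangular M T L P -> sekiguchi_eigen a0 M L P -> P = P0.
Proof.
move=> /(triangularP _ iL)[cP PL PG] eP.
have /(triangularP _ iL)[cP0 P0L P0G] := jack_at_triangular.
apply/eqP; rewrite -subr_eq0 -msupp_eq0; case mE : (msupp _) => [//|m s'].
have mD : m \in msupp (P - P0) by rewrite mE inE eqxx.
have [g [gD _ tg]] := top_exists mD; rewrite mcoeff_msupp in gD.
have eD := eigenB eP jack_at_eigen.
have [es ec] := eigen_top eD tg gD.
have cD : csym M T (P - P0) by rewrite -scaleN1r; apply: csymD => //; apply: csymZ.
have [G [iG GO DG]] := csym_sort cD gD.
rewrite -(orb_star GO) in es; rewrite -(orb_circ GO) in ec.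
have GL : G != L by apply: contraNneq DG => ->; rewrite mcoeffB PL P0L subrr.
have gt : sp_gt M L G.
  have [PG0|PGn] := eqVneq P@_G 0; last by case: (PG _ iG GL PGn).
  apply: (P0G G iG GL _).2; move: DG; rewrite mcoeffB PG0 sub0r oppr_eq0 //.
have [s sE] := eps_perm a0E es; have [S SE] := eps_perm a0E ec.
have ne := sp_gt_neq gt.
case: adm => [str|[st wk]]; first by case: ne; exact: (strong_rigid k0 cop sE SE str).
have [/ne//|[nst [A [B col]]]] := weak_collision k0 cop sE SE st wk.
(* For a type antisymmetric in I the index G is strict, which the collision denies. *)
case aT : (aI T); last by case: (no_collision aT st wk col).
by move: iG; rewrite in_indexE aT (negPf nst) /= andbF.
Qed.

End Main.

Theorem mainTheorem3 (R : realType) (N m n k r : nat) (T : symtype)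
    (L : 'X_{1..N})
    (hN : (1 <= N)%N) (hm : (m <= N)%N)
    (hk : (1 <= k)%N) (hr : (2 <= r)%N)
    (hkr : gcdn (k + 1) (r - 1) = 1%N)
    (hn : mdeg L = n)
    (hT : in_index m T L)
    (hadm : admissible m k r L)
    (hreg : no_pole_at (alpha_kr R[i] k r) (jack R[i] m T L)) :
  let a : R[i] := alpha_kr R[i] k r in
  let P0 : {mpoly R[i][N]} := jack_at a m T L in
  (triangular m T L P0 /\ sekiguchi_eigen a m L P0) /\
  (forall P : {mpoly R[i][N]},
     triangular m T L P /\ sekiguchi_eigen a m L P -> P = P0).
Proof.
case: N L hN hm hn hT hadm hreg => [//|N'] L _ hm hn hT hadm hreg a P0.
(* Here r = p + 2, so the parameter p of the earlier sections, which stands for r - 1, becomes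
   [p.+1]. *)
case: r hr hkr hadm hreg @a @P0 => [//|[//|p]] _ hkr hadm hreg a P0.
have cop : coprime k.+1 p.+1 by rewrite /coprime -hkr addn1 subn1.
have aE : a *+ p.+1 + k.+1%:R = 0.
  by rewrite /a /alpha_kr -[_ *+ p.+1]mulr_natr divfK ?pnatr_eq0 // addNr.
split; first split.
- exact: (jack_at_triangular hm hT hreg).
- exact: (jack_at_eigen hm hreg).
- by move=> P [tP eP]; exact: (jack_at_unique hk (ltn0Sn p) cop aE hm hT hreg hadm tP eP).
Qed.
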